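(* Let $p\in\{1,\ldots,k\}$ be fixed and let $\varphi:\mathfrak h\to V^*$ be a Segre–Veronese factorization structure such that $\Gamma_j$, $j\ne p$, decompose in grouped $p$-slots, i.e. $\Gamma_j=\mathrm{ins}_p\big((e_j^p)^{\otimes d_p}\otimes\tilde\Gamma_j\big)$ for some $e_j^p\in W_p^*$, or the Veronese factorization structure. Let $(g_\beta,J_\beta)$ be the separable Kähler geometry associated with this factorization structure and $\beta\in\mathfrak h$, and let $A_{ir}$, $r=1,\ldots,d_i$, $i=1,\ldots,k$, be a solution of the corresponding extremality equation (E). Then, for $d_p\ge1$, we have the following. (1) If $\langle\mu,\beta\rangle$ and $\partial_{x_{pq}}\langle\mu,\beta\rangle$ are linearly dependent over polynomials $\mathbb R[x_{pq}]$, i.e. $\varphi(\beta)=\mathrm{ins}_p\big((a,b)^{\otimes d_p}\otimes\tilde\beta\big)$ for some $\tilde\beta$ (in the Veronese case $\varphi(\beta)=t(a,b)^{\otimes m}$, $t\in\mathbb R\setminus\{0\}$), and $b\ne0$, then for each $q=1,\ldots,d_p$ $$A_{pq}(x_{pq})=\frac{(a+bx_{pq})^{m+1}}{\prod_{j\in O_p}\langle(1,x_{pq}),e_j^p\rangle^{d_j}}\int\!\!\int\Upsilon_p(x_{pq})\frac{\prod_{j\in O_p}\langle(1,x_{pq}),e_j^p\rangle^{d_j-1}}{(a+bx_{pq})^{m+3}}dx_{pq}dx_{pq},$$ where $\Upsilon_p$ is a $q$-independent polynomial of degree at most $L_p$ with constant coefficients. (The double integral produces a linear term from constants of integration, which depend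 on both $p$ and $q$.) The statement remains valid for $b=0$ when the resulting constant $1/a^2$ is omitted or viewed as a part of $\Upsilon_p$. (2) If $d_p\ge2$, $\ell_p<m$, $\langle\mu,\beta\rangle^2,\langle\mu,\beta\rangle\partial_{x_{pq}}\langle\mu,\beta\rangle,(\partial_{x_{pq}}\langle\mu,\beta\rangle)^2$ are linearly independent over $\mathbb R(x_{pq})$, and $\langle\mu,\beta\rangle_x^2,\langle\mu,\beta\rangle_x\langle\mu,\beta\rangle',(\langle\mu,\beta\rangle')^2$ are linearly independent over $\mathbb R(x)$, then $$A_{pq}(x_{pq})=\frac{N_p(x_{pq})}{\prod_{j\ne p}\langle(1,x_{pq}),e_j^p\rangle^{d_j}},\quad q=1,\ldots,d_p,$$ where $N_p$ is a $q$-independent polynomial of degree at most $\ell_p$. (3) If $d_p\ge2$, $\ell_p=m$ and $\langle\mu,\beta\rangle_x^2,\langle\mu,\beta\rangle_x\langle\mu,\beta\rangle',(\langle\mu,\beta\rangle')^2$ are linearly independent over $\mathbb R(x)$, then $$A_{pq}(x_{pq})=\frac{N_p(x_{pq})}{\prod_{j\ne p}\langle(1,x_{pq}),e_j^p\rangle^{d_j}},\quad q=1,\ldots,d_p,$$ where $N_p$ is a $q$-independent polynomial of degree at most $m+2$. (4) If $d_p=2$, $\ell_p<m$, $\langle\mu,\beta\rangle^2,\langle\mu,\beta\rangle\partial_{x_{pq}}\langle\mu,\beta\rangle,(\partial_{x_{pq}}\langle\mu,\beta\rangle)^2$ are linearly independent over $\mathbb R(x_{pq})$, and $\langle\mu,\beta\rangle_x$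 and $\langle\mu,\beta\rangle'$ are linearly dependent over $\mathbb R(x)$, then $$A_{pq}(x_{pq})=\frac{N_{pq}(x_{pq})}{\prod_{j\ne p}\langle(1,x_{pq}),e_j^p\rangle^{d_j}},\quad q=1,2,$$ where $N_{pq}$, $q=1,2$, is a polynomial of degree at most $\ell_p$, and $A(x):=A_{p1}(x)-A_{p2}(x)$ satisfies the ODE $(\dagger)$ of the context. Additionally, if the factorization structure is the product Segre–Veronese factorization structure, then this case occurs if and only if $m\ge4$ and $k\ge2$, and $A_{pq}(x_{pq})=N_p(x_{pq})$, $q=1,2$, where $N_p$ is a $q$-independent polynomial of degree at most $\ell_p=3$. (5) If $d_p=2$, $\ell_p=m$, $\langle\mu,\beta\rangle$ and $\partial_{x_{pq}}\langle\mu,\beta\rangle$ are linearly independent over $\mathbb R[x_{pq}]$, and $\langle\mu,\beta\rangle_x$ and $\langle\mu,\beta\rangle'$ are linearly dependent over $\mathbb R(x)$, then $$A_{pq}(x_{pq})=\frac{N_{pq}(x_{pq})}{\prod_{j\ne p}\langle(1,x_{pq}),e_j^p\rangle^{d_j}},\quad q=1,2,$$ where $N_{pq}$, $q=1,2$, is a polynomial of degree at most $m+2$, and $A(x):=A_{p1}(x)-A_{p2}(x)$ satisfies the ODE $(\dagger)$. Additionally, if the factorization structure is the Veronese factorization structure, then this case occurs if and only if $m=2$, and (with $\langle\mu,\beta\rangle=\kappa(a+b(x_{p1}+x_{p2})+cx_{p1}x_{p2})$, where $c\ne0$ and $a+2bx+cx^2$ has no real root) $$A_{pq}(x_{pq})=N_p(x_{pq})+\nu_{pq}^0(b+cx_{pq})\big(ac-b^2+(b+cx_{pq})^2\big)+\nu_{pq}^1\big((ac-b^2)^2-(b+cx_{pq})^4\big),\quad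 q=1,2,$$ where $N_p$ is a $q$-independent polynomial of degree at most $4$ and $a,b,c,\nu_{pq}^0,\nu_{pq}^1\in\mathbb R$. Furthermore, if the factorization structure is the product Segre–Veronese factorization structure with $k\ge2$, then this case occurs if and only if the factorization structure is 3-dimensional and corresponds to the partition $3=1+2$, in which case $A_{pq}(x_{pq})=N_p(x_{pq})$, $q=1,2$, for a $q$-independent polynomial $N_p$ of degree at most $m+2=5$. (6) If $d_p=1$, $\ell_p<m$, and $\langle\mu,\beta\rangle^2,\langle\mu,\beta\rangle\partial_{x_{p1}}\langle\mu,\beta\rangle,(\partial_{x_{p1}}\langle\mu,\beta\rangle)^2$ are linearly independent over $\mathbb R(x_{p1})$, then $A_{p1}(x_{p1})=N_p(x_{p1})/\prod_{j\ne p}\langle(1,x_{p1}),e_j^p\rangle^{d_j}$, where $N_p$ is a polynomial of degree at most $\ell_p$. (7) If $d_p=1$ and $\ell_p=m$, then $A_{p1}(x_{p1})=N_p(x_{p1})/\prod_{j\ne p}\langle(1,x_{p1}),e_j^p\rangle^{d_j}$, where $N_p$ is a polynomial of degree at most $m+2$.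
   Context: Segre–Veronese factorization structure. Let $m=d_1+\cdots+d_k$, $m\ge2$, $d_j\ge1$, $W_1,\dots,W_k$ 2-dimensional real vector spaces, $V^*=\bigotimes_{i=1}^k(W_i^* )^{\otimes d_i}$ with slots labelled $(i,r)$; the slots $(p,1),\dots,(p,d_p)$ are the grouped $p$-slots. $\mathrm{ins}_j$ denotes the linear map reordering tensor factors so that the first $d_j$ factors are put in the grouped $j$-slots (used also when some other group of slots is absent). Let $\Gamma_j\in\bigotimes_{r\ne j}(W_r^* )^{\otimes d_r}$ be non-zero tensors such that $\mathfrak h:=\sum_{j}\mathrm{ins}_j(S^{d_j}W_j^*\otimes\langle\Gamma_j\rangle)\subset V^*$ has dimension $m+1$; $\varphi:\mathfrak h\hookrightarrow V^*$ is the inclusion. Veronese: $k=1$, $p=1$, $d_1=m$, $\mathfrak h=S^mW^*$, $\Gamma_1=1$, products over $j\neq p$ are 1. Product Segre–Veronese: $\Gamma_j=(1,0)^{\otimes(m-d_j)}$ for all $j$ (in suitable bases), so that all denominators below are 1. Notation. Identify $W_i,W_i^*$ with $\mathbb R^2$, $\langle(u,v),(a,b)\rangle=ua+vb$. With real variables $x_{ir}$: $\mathbf x=\bigotimes_{i,r}(1,x_{ir})$, $\hat{\mathbf x}_i=\bigotimes_{j\ne i}\bigotimes_s(1,x_{js})$, $\langle\mu,\alpha\rangle=\langle\mathbf x,\varphi(\alpha)\rangle$, $\Delta_{ir}=\prod_{s\ne r}(x_{ir}-x_{is})$ ($=1$ if $d_i=1$), $\mu_\beta=\mu/\langle\mu,\beta\rangle$.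 Fix $0\ne\beta\in\mathfrak h$. The separable Kähler geometry with (angular coordinate form $dt$ valued in $\mathfrak h/\langle\beta\rangle$) has metric $g_\beta=\sum_{i,r}\big(\frac{\Delta_{ir}\langle\hat{\mathbf x}_i,\Gamma_i\rangle}{A_{ir}(x_{ir})\langle\mu,\beta\rangle}dx_{ir}^2+\frac{A_{ir}(x_{ir})\langle\mu,\beta\rangle}{\Delta_{ir}\langle\hat{\mathbf x}_i,\Gamma_i\rangle}\langle\partial_{x_{ir}}\mu_\beta,dt\rangle^2\big)$ and complex structure $J_\beta dx_{ir}=\frac{A_{ir}(x_{ir})\langle\mu,\beta\rangle}{\Delta_{ir}\langle\hat{\mathbf x}_i,\Gamma_i\rangle}\langle\partial_{x_{ir}}\mu_\beta,dt\rangle$. Only its extremality equation is used: a solution is a family of smooth non-vanishing functions $A_{ir}$ of one variable on open intervals $I_{ir}$ (with $\Delta_{ir},\langle\hat{\mathbf x}_i,\Gamma_i\rangle,\langle\mu,\beta\rangle$ non-vanishing on $\prod I_{ir}$) such that for some $\alpha\in\mathfrak h$ $$\text{(E)}\quad\sum_{i=1}^k\sum_{r=1}^{d_i}\frac{\langle\mu,\beta\rangle^{m+3}}{\Delta_{ir}\langle\hat{\mathbf x}_i,\Gamma_i\rangle\prod_{b=1}^k\langle\hat{\mathbf x}_b,\Gamma_b\rangle^{d_b}}\partial_{x_{ir}}^2\Big(\frac{A_{ir}(x_{ir})}{\langle\mu,\beta\rangle^{m+1}}\prod_{j=1}^k\langle\hat{\mathbf x}_j,\Gamma_j\rangle^{d_j}\Big)=\langle\mu,\alpha\rangle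 .$$ Solutions consist of rational functions; $A_{pq}(x)$ is viewed in $\mathbb R(x)$. ``$q$-independent'' means the same polynomial for all $q$. $O_p$ is the set of $j\ne p$ with $e_j^p\notin\langle(1,0)\rangle$. $\ell_p$: multiply (E) by $\Delta_{pq}\prod_b\langle\hat{\mathbf x}_b,\Gamma_b\rangle^{d_b}$; $\ell_p$ is the maximum of the $x_{pq}$-degrees of the (polynomial in $x_{pq}$) coefficients at $A_{ir},A'_{ir},A''_{ir}$, $(i,r)\ne(p,q)$, and of the right-hand side, for general $\alpha\in\mathfrak h$. $L_p$: the same maximum when (E) is instead multiplied by $\Delta_{pq}\prod_{j\ne p}\langle(1,x_{pq}),e_j^p\rangle$. Neither depends on $q$. For $d_p\ge2$ and distinct $q,r\in\{1,\dots,d_p\}$: $\langle\mu,\beta\rangle_x=\langle\mu,\beta\rangle|_{x_{pq}=x_{pr}=x}$, $\langle\mu,\beta\rangle'=(\partial_{x_{pq}}\langle\mu,\beta\rangle)|_{x_{pq}=x_{pr}=x}$. Linear (in)dependence is in the field of rational functions in all variables present. If $d_p=2$ and $\langle\mu,\beta\rangle_x,\langle\mu,\beta\rangle'$ are linearly dependent over $\mathbb R(x)$, then $\langle\mu,\beta\rangle=\kappa\,(a+b(x_{p1}+x_{p2})+cx_{p1}x_{p2})$ with $a,b,c\in\mathbb R$ and $\kappa$ independent of $x_{p1},x_{p2}$; with $P(x)=a+2bx+cx^2$ and $\mathcal S(x)=\sum_{j\ne p}d_j\frac{\langle(0,1),e_j^p\rangle}{\langle(1,x),e_j^p\rangle}$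 the ODE is $$(\dagger)\quad A\Big[\mathcal S^2+\mathcal S'-(m+1)\mathcal S\,(\ln P)'+\tfrac{(m+1)(m+2)}4\big((\ln P)'\big)^2\Big]+2A'\Big[\mathcal S-\tfrac{m+1}2(\ln P)'\Big]+A''=0,$$ where $(\ln P)'=P'/P$. $\int\!\int F\,dx\,dx$ denotes some second antiderivative of $F$ (determined up to adding an affine function, whose choice may depend on $(p,q)$). *)

(* Defs.v *)
From HB Require Import structures.
From mathcomp Require Import all_boot all_order all_algebra perm.
From mathcomp Require Import all_classical all_reals all_analysis.

Set Implicit Arguments.
Unset Strict Implicit.
Unset Printing Implicit Defensive.

Import Order.TTheory GRing.Theory Num.Theory.
Import numFieldNormedType.Exports.

Local Open Scope classical_set_scope.
Local Open Scope ring_scope.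

(** Every W_i and W_i^* is identified with R^2, a vector being a pair.  An
    element of the tensor product of copies of R^2 indexed by a finite type S
    is its family of coefficients in the standard basis, whose members are
    indexed by the maps S -> bool: [false] selects the basis vector (1,0) and
    [true] selects (0,1). *)

Definition component (R : realType) (v : R * R) (b : bool) : R :=
  if b then v.2 else v.1.

Notation tensor R S := {ffun {ffun S -> bool} -> R^o}.

Definition ptensor (R : realType) (S : finType) (v : S -> R * R) : tensor R S :=
  [ffun eps : {ffun S -> bool} => \prod_s component (v s) (eps s)].

Definition tpower (R : realType) (S : finType) (v : R * R) : tensor R S :=
  ptensor (fun _ => v).

Definition tpairing (R : realType) (S : finType) (X T : tensor R S) : R :=
  \sum_eps X eps * T eps.

Definition permute (R : realType) (n : nat) (sigma : 'S_n)
    (T : tensor R 'I_n) : tensor R 'I_n :=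
  [ffun eps : {ffun 'I_n -> bool} => T [ffun r => eps (sigma r)]].

Definition permute_sub (R : realType) (n : nat) (sigma : 'S_n)
    (T : tensor R 'I_n) : tensor R 'I_n := permute sigma T - T.

Lemma permute_sub_is_linear (R : realType) (n : nat) (sigma : 'S_n) :
  linear (@permute_sub R n sigma).
Proof.
by move=> a u v; apply/ffunP => eps; rewrite !ffunE scalerBr addrACA opprD.
Qed.

HB.instance Definition _ (R : realType) (n : nat) (sigma : 'S_n) :=
  GRing.isLinear.Build R (tensor R 'I_n) (tensor R 'I_n) _
    (@permute_sub R n sigma) (@permute_sub_is_linear R n sigma).

Definition SymT (R : realType) (n : nat) : {vspace tensor R 'I_n} :=
  (\bigcap_(sigma : 'S_n) lker (linfun (@permute_sub R n sigma)))%VS.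

Lemma SymTP (R : realType) (n : nat) (T : tensor R 'I_n) :
  reflect (forall sigma : 'S_n, permute sigma T = T) (T \in SymT R n).
Proof.
apply: (iffP idP) => [TS sigma|TS].
  have /subvP/(_ T TS) : (SymT R n <= lker (linfun (@permute_sub R n sigma)))%VS.
    exact: (bigcapv_inf sigma).
  by rewrite memv_ker lfunE /= subr_eq0 => /eqP.
rewrite memvE; apply/subv_bigcapP => sigma _.
by rewrite -memvE memv_ker lfunE /= /permute_sub TS subrr.
Qed.

(** [slot d] is the type of all labels (i,r) with r < d i, and [slots P] the
    type of those in the groups selected by [P]. *)

Definition slot (k : nat) (d : 'I_k -> nat) : finType := {i : 'I_k & 'I_(d i)}.

Definition Slot (k : nat) (d : 'I_k -> nat) (i : 'I_k) (r : 'I_(d i)) : slot d :=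
  Tagged (fun i => 'I_(d i)) r.

Definition slots (k : nat) (d : 'I_k -> nat) (P : pred 'I_k) : finType :=
  {s : slot d | P (tag s)}.

Definition without (k : nat) (j : 'I_k) (P : pred 'I_k) : pred 'I_k :=
  fun i => (i != j) && P i.

Definition widen_slot (k : nat) (d : 'I_k -> nat) (P : pred 'I_k) (j : 'I_k)
    (s : slots d (without j P)) : slots d P :=
  exist (fun s : slot d => P (tag s)) (val s) (proj2 (andP (valP s))).

Definition group_slot (k : nat) (d : 'I_k -> nat) (P : pred 'I_k) (j : 'I_k)
    (Pj : P j) (r : 'I_(d j)) : slots d P :=
  exist (fun s : slot d => P (tag s)) (Slot r) Pj.

(** [ins Pj T G] is ins_j (T (x) G), with the groups outside [P] absent. *)
Definition ins (R : realType) (k : nat) (d : 'I_k -> nat) (P : pred 'I_k)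
    (j : 'I_k) (Pj : P j) (T : tensor R 'I_(d j))
    (G : tensor R (slots d (without j P))) : tensor R (slots d P) :=
  [ffun eps : {ffun slots d P -> bool} =>
     T [ffun r => eps (group_slot Pj r)] * G [ffun s => eps (widen_slot s)]].

Definition insr (R : realType) (k : nat) (d : 'I_k -> nat) (P : pred 'I_k)
    (j : 'I_k) (Pj : P j) (G : tensor R (slots d (without j P)))
    (T : tensor R 'I_(d j)) : tensor R (slots d P) := ins Pj T G.

Lemma insr_is_linear (R : realType) (k : nat) (d : 'I_k -> nat)
    (P : pred 'I_k) (j : 'I_k) (Pj : P j)
    (G : tensor R (slots d (without j P))) : linear (insr Pj G).
Proof.
by move=> a u v; apply/ffunP => eps; rewrite !ffunE mulrDl; congr (_ + _); rewrite -mulrA.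
Qed.

HB.instance Definition _ (R : realType) (k : nat) (d : 'I_k -> nat)
    (P : pred 'I_k) (j : 'I_k) (Pj : P j)
    (G : tensor R (slots d (without j P))) :=
  GRing.isLinear.Build R (tensor R 'I_(d j)) (tensor R (slots d P)) _
    (insr Pj G) (insr_is_linear Pj G).

Notation Vdual R d := (tensor R (slots d xpredT)).

Definition gammas (R : realType) (k : nat) (d : 'I_k -> nat) :=
  forall j : 'I_k, tensor R (slots d (without j xpredT)).

Definition msize (k : nat) (d : 'I_k -> nat) : nat := (\sum_i d i)%N.

Definition hspace (R : realType) (k : nat) (d : 'I_k -> nat)
    (Gamma : gammas R d) : {vspace Vdual R d} :=
  (\sum_(j < k)
     linfun (@insr R k d xpredT j (erefl true) (Gamma j)) @: SymT R (d j))%VS.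

Definition segre_veronese (R : realType) (k : nat) (d : 'I_k -> nat)
    (Gamma : gammas R d) : Prop :=
  (forall j, Gamma j != 0) /\ \dim (hspace Gamma) = (msize d).+1.

Definition veronese (R : realType) (k : nat) (d : 'I_k -> nat)
    (Gamma : gammas R d) : Prop :=
  k = 1%N /\ forall j, Gamma j = [ffun=> 1].

(** In the bases of the W_i used for the identification with R^2. *)
Definition product_segre_veronese (R : realType) (k : nat) (d : 'I_k -> nat)
    (Gamma : gammas R d) : Prop :=
  forall j, Gamma j = tpower _ (1, 0).

(** The proof [hp] says that group p is present in Gamma_j, that is, p != j. *)
Definition decomposes (R : realType) (k : nat) (d : 'I_k -> nat)
    (Gamma : gammas R d) (p : 'I_k) (e : 'I_k -> R * R) : Prop :=
  forall (j : 'I_k) (hp : without j xpredT p),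
    exists G : tensor R (slots d (without p (without j xpredT))),
      Gamma j = ins hp (tpower _ (e j)) G.

(** Functions of the real variables x_{ir} are functions of a point
    [x : slot d -> R]. *)

(** The contraction of T with the product of the (1, x_s), s in [slots P]: this
    is <mu,beta> for T = beta and <\hat x_i, Gamma_i> for T = Gamma_i. *)
Definition bracket (R : realType) (k : nat) (d : 'I_k -> nat) (P : pred 'I_k)
    (T : tensor R (slots d P)) (x : slot d -> R) : R :=
  tpairing (ptensor (fun s : slots d P => (1, x (val s)))) T.

Definition line (R : realType) (e : R * R) (t : R) : R := e.1 + t * e.2.

Definition upd (R : realType) (k : nat) (d : 'I_k -> nat) (x : slot d -> R)
    (s : slot d) (t : R) : slot d -> R := [eta x with s |-> t].

Definition partial (R : realType) (k : nat) (d : 'I_k -> nat) (s : slot d)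
    (F : (slot d -> R) -> R) (x : slot d -> R) : R :=
  derive1 (fun t : R => F (upd x s t)) (x s).

Definition Delta (R : realType) (k : nat) (d : 'I_k -> nat) (s : slot d)
    (x : slot d -> R) : R :=
  \prod_(r < d (tag s) | r != tagged s) (x s - x (Slot r)).

Definition hatprod (R : realType) (k : nat) (d : 'I_k -> nat)
    (Gamma : gammas R d) (x : slot d -> R) : R :=
  \prod_(j < k) bracket (Gamma j) x ^+ d j.

Definition nonsingular (R : realType) (k : nat) (d : 'I_k -> nat)
    (Gamma : gammas R d) (beta : Vdual R d) (x : slot d -> R) : Prop :=
  [/\ forall s, Delta s x != 0,
      forall j, bracket (Gamma j) x != 0
    & bracket beta x != 0].

Definition prefactor (R : realType) (k : nat) (d : 'I_k -> nat)
    (Gamma : gammas R d) (beta : Vdual R d) (s : slot d) (x : slot d -> R) : R :=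
  bracket beta x ^+ (msize d + 3)%N
  / (Delta s x * bracket (Gamma (tag s)) x * hatprod Gamma x).

Definition weight (R : realType) (k : nat) (d : 'I_k -> nat)
    (Gamma : gammas R d) (beta : Vdual R d) (x : slot d -> R) : R :=
  hatprod Gamma x / bracket beta x ^+ (msize d + 1)%N.

Definition extremal_lhs (R : realType) (k : nat) (d : 'I_k -> nat)
    (Gamma : gammas R d) (beta : Vdual R d) (A : slot d -> R -> R)
    (x : slot d -> R) : R :=
  \sum_(i < k) \sum_(r < d i)
    prefactor Gamma beta (Slot r) x
    * iter 2 (partial (Slot r))
        (fun y => A (Slot r) (y (Slot r)) * weight Gamma beta y) x.

Definition smooth_on (R : realType) (I : set R) (f : R -> R) : Prop :=
  forall n t, I t -> derivable (derive1n n f) t 1.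

Definition open_interval (R : realType) (I : set R) : Prop :=
  [/\ open I, is_interval I & I !=set0].

Definition extremal_solution (R : realType) (k : nat) (d : 'I_k -> nat)
    (Gamma : gammas R d) (beta : Vdual R d) (I : slot d -> set R)
    (A : slot d -> R -> R) : Prop :=
  [/\ forall s, open_interval (I s),
      forall s, smooth_on (I s) (A s) /\ (forall t, I s t -> A s t != 0),
      forall x, (forall s, I s (x s)) -> nonsingular Gamma beta x
    & exists2 alpha : Vdual R d, alpha \in hspace Gamma &
        forall x, (forall s, I s (x s)) ->
          extremal_lhs Gamma beta A x = bracket alpha x].

(** [F] is a polynomial of degree at most n in the variable x_s.  As [F] is a
    quotient whose denominators vanish only at singular points, its values
    there carry no information. *)
Definition degree_le (R : realType) (k : nat) (d : 'I_k -> nat)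
    (Gamma : gammas R d) (beta : Vdual R d) (s : slot d)
    (F : (slot d -> R) -> R) (n : nat) : Prop :=
  forall x : slot d -> R, exists2 P : {poly R}, (size P <= n.+1)%N &
    forall t : R, nonsingular Gamma beta (upd x s t) -> F (upd x s t) = P.[t].

(** The coefficient at the n-th derivative of A_s, n <= 2, in the extremality
    equation multiplied by [M], by the Leibniz rule. *)
Definition coefficient (R : realType) (k : nat) (d : 'I_k -> nat)
    (Gamma : gammas R d) (beta : Vdual R d) (M : (slot d -> R) -> R)
    (s : slot d) (n : nat) (x : slot d -> R) : R :=
  M x * prefactor Gamma beta s x
  * ('C(2, n)%:R * iter (2 - n)%N (partial s) (weight Gamma beta) x).

(** The right-hand side for a general alpha has the largest degree among all
    the right-hand sides, whence the quantification over all alpha. *)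
Definition degrees_le (R : realType) (k : nat) (d : 'I_k -> nat)
    (Gamma : gammas R d) (beta : Vdual R d) (M : (slot d -> R) -> R)
    (s0 : slot d) (l : nat) : Prop :=
  (forall (s : slot d) (n : nat), s != s0 -> (n <= 2)%N ->
     degree_le Gamma beta s0 (coefficient Gamma beta M s n) l) /\
  (forall alpha : Vdual R d, alpha \in hspace Gamma ->
     degree_le Gamma beta s0 (fun x => M x * bracket alpha x) l).

Definition max_degree (R : realType) (k : nat) (d : 'I_k -> nat)
    (Gamma : gammas R d) (beta : Vdual R d) (M : (slot d -> R) -> R)
    (s0 : slot d) (l : nat) : Prop :=
  degrees_le Gamma beta M s0 l /\
  forall n, degrees_le Gamma beta M s0 n -> (l <= n)%N.

Definition is_ell (R : realType) (k : nat) (d : 'I_k -> nat)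
    (Gamma : gammas R d) (beta : Vdual R d) (s0 : slot d) (l : nat) : Prop :=
  max_degree Gamma beta (fun x => Delta s0 x * hatprod Gamma x) s0 l.

Definition is_L (R : realType) (k : nat) (d : 'I_k -> nat)
    (Gamma : gammas R d) (beta : Vdual R d) (e : 'I_k -> R * R)
    (s0 : slot d) (l : nat) : Prop :=
  max_degree Gamma beta
    (fun x => Delta s0 x * \prod_(j < k | j != tag s0) line (e j) (x s0)) s0 l.

(** e_j^p is in <(1,0)> if and only if its second component vanishes. *)
Definition O_set (R : realType) (k : nat) (p : 'I_k) (e : 'I_k -> R * R) :
    pred 'I_k := fun j => (j != p) && ((e j).2 != 0).

Definition denominator (R : realType) (k : nat) (d : 'I_k -> nat) (p : 'I_k)
    (e : 'I_k -> R * R) (t : R) : R :=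
  \prod_(j < k | j != p) line (e j) t ^+ d j.

Definition fnum (R : realType) (c : {fraction {poly R}}) : {poly R} :=
  (frac (repr c)).1.

Definition fden (R : realType) (c : {fraction {poly R}}) : {poly R} :=
  (frac (repr c)).2.

(** Linear independence over R(x_s) of rational functions defined everywhere;
    the relation is tested at the points where its coefficients are defined. *)
Definition lin_indep (R : realType) (k : nat) (d : 'I_k -> nat) (s : slot d)
    (n : nat) (F : n.-tuple ((slot d -> R) -> R)) : Prop :=
  forall c : 'I_n -> {fraction {poly R}},
    (forall x : slot d -> R,
       (forall i, (fden (c i)).[x s] != 0) ->
       \sum_(i < n) (fnum (c i)).[x s] / (fden (c i)).[x s] * tnth F i x = 0) ->
    forall i, c i = 0.

Definition lin_dep_poly (R : realType) (k : nat) (d : 'I_k -> nat) (s : slot d)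
    (n : nat) (F : n.-tuple ((slot d -> R) -> R)) : Prop :=
  exists2 c : 'I_n -> {poly R}, (exists i, c i != 0) &
    forall x : slot d -> R, \sum_(i < n) (c i).[x s] * tnth F i x = 0.

Definition squares (R : realType) (k : nat) (d : 'I_k -> nat)
    (f g : (slot d -> R) -> R) : 3.-tuple ((slot d -> R) -> R) :=
  [tuple fun x => f x ^+ 2; fun x => f x * g x; fun x => g x ^+ 2].

(** [on_diagonal s s' F] is F restricted to x_s = x_{s'} = x, the variable x
    being x_s. *)
Definition on_diagonal (R : realType) (k : nat) (d : 'I_k -> nat) (s s' : slot d)
    (F : (slot d -> R) -> R) : (slot d -> R) -> R :=
  fun x => F (upd x s' (x s)).

Definition squares_indep (R : realType) (k : nat) (d : 'I_k -> nat)
    (beta : Vdual R d) (s : slot d) : Prop :=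
  lin_indep s (squares (bracket beta) (partial s (bracket beta))).

Definition merged_squares_indep (R : realType) (k : nat) (d : 'I_k -> nat)
    (beta : Vdual R d) (s s' : slot d) : Prop :=
  lin_indep s (squares (on_diagonal s s' (bracket beta))
                       (on_diagonal s s' (partial s (bracket beta)))).

Definition merged_dep (R : realType) (k : nat) (d : 'I_k -> nat)
    (beta : Vdual R d) (s s' : slot d) : Prop :=
  ~ lin_indep s [tuple on_diagonal s s' (bracket beta);
                       on_diagonal s s' (partial s (bracket beta))].

Definition case4 (R : realType) (k : nat) (d : 'I_k -> nat)
    (beta : Vdual R d) (p : 'I_k) (q r : 'I_(d p)) (ell : nat) : Prop :=
  [/\ d p = 2%N, (ell < msize d)%N, squares_indep beta (Slot q)
    & merged_dep beta (Slot q) (Slot r)].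

Definition case5 (R : realType) (k : nat) (d : 'I_k -> nat)
    (beta : Vdual R d) (p : 'I_k) (q r : 'I_(d p)) (ell : nat) : Prop :=
  [/\ d p = 2%N, ell = msize d,
      ~ lin_dep_poly (Slot q)
          [tuple bracket beta; partial (Slot q) (bracket beta)]
    & merged_dep beta (Slot q) (Slot r)].

(** A case occurs for a factorization structure if its conditions are met by
    some nonzero element of h. *)
Definition occurs (R : realType) (k : nat) (d : 'I_k -> nat)
    (Gamma : gammas R d) (p : 'I_k)
    (C : Vdual R d -> 'I_(d p) -> 'I_(d p) -> nat -> Prop) : Prop :=
  exists (beta : Vdual R d) (q r : 'I_(d p)) (ell : nat),
    [/\ beta \in hspace Gamma, beta != 0, q != r,
        is_ell Gamma beta (Slot q) ell & C beta q r ell].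

(** <mu,beta> = kappa (a + b (x_s + x_s') + c x_s x_s'). *)
Definition kappa_form (R : realType) (k : nat) (d : 'I_k -> nat)
    (beta : Vdual R d) (s s' : slot d) (kappa : (slot d -> R) -> R)
    (a b c : R) : Prop :=
  (forall x t, kappa (upd x s t) = kappa x /\ kappa (upd x s' t) = kappa x) /\
  (forall x, bracket beta x =
     kappa x * (a + b * (x s + x s') + c * x s * x s')).

Definition quadratic (R : realType) (a b c : R) (x : R) : R :=
  a + 2 * b * x + c * x ^+ 2.

Definition dlogsum (R : realType) (k : nat) (d : 'I_k -> nat) (p : 'I_k)
    (e : 'I_k -> R * R) (x : R) : R :=
  \sum_(j < k | j != p) (d j)%:R * ((e j).2 / line (e j) x).

(** The equation is an identity in R(x) for a rational function A, that is, an
    identity at all points where no denominator vanishes. *)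
Definition dagger (R : realType) (k : nat) (d : 'I_k -> nat) (p : 'I_k)
    (e : 'I_k -> R * R) (a b c : R) (A : R -> R) : Prop :=
  let m := (msize d)%:R in
  let P := quadratic a b c in
  let S := dlogsum d p e in
  forall x : R, denominator d p e x != 0 -> P x != 0 ->
    let lnP' := derive1 P x / P x in
    A x * (S x ^+ 2 + derive1 S x - (m + 1) * S x * lnP'
           + (m + 1) * (m + 2) / 4 * lnP' ^+ 2)
    + 2 * derive1 A x * (S x - (m + 1) / 2 * lnP')
    + derive1n 2 A x = 0.

Definition second_antiderivative (R : realType) (I : set R) (F G : R -> R) :
    Prop :=
  forall t, I t ->
    [/\ derivable G t 1, derivable (derive1 G) t 1 & derive1n 2 G t = F t].

(** A_{pq} = N_q / prod_{j != p} <(1,x),e_j^p>^{d_j}, deg N_q <= n, q < d_p. *)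
Definition quotient_form (R : realType) (k : nat) (d : 'I_k -> nat)
    (p : 'I_k) (e : 'I_k -> R * R) (I : slot d -> set R) (A : slot d -> R -> R)
    (N : 'I_(d p) -> {poly R}) (n : nat) : Prop :=
  forall q, (size (N q) <= n.+1)%N /\
    forall t, I (Slot q) t -> A (Slot q) t = (N q).[t] / denominator d p e t.

(* Main.v *)
(** Multiplied by its denominators, the extremality equation becomes, in each
    variable [x_q] of the group [p], a second order equation
    [B^2 N'' - 2 (m+1) B B' N' + (m+1)(m+2) B'^2 N = Q] for [N = A_q D], where [B] is
    the bracket of [beta], affine in [x_q], and [Q] is a polynomial in [x_q].  This
    operator is [B^(m+3) (N / B^(m+1))'']; differentiating it lowers [m] by one, so
    that [m+1] differentiations of the equation give [N^(m+3) = 0] when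
    [deg Q <= m].  If [B^2], [B B'] and [B'^2] are independent, varying the other
    variables shows that the coefficients of each of them in the equation have
    degree at most [deg Q].

    As [Q] is defined for all [x_q], it may be evaluated at [x_q = x_r], where all
    terms but those of [A_q] and [A_r] vanish: the difference of the two numerators
    solves the homogeneous equation on the diagonal, which forces it to vanish when
    the merged squares are independent and is the equation (dagger) otherwise.

    For product structures with [d_p = 2] the equation (dagger) alone does not
    exclude a difference of numerators (for [m = 7] and [B = a + b (x_q + x_r)] the
    cube of [a + 2 b x] solves it).  There one uses that the remaining terms are
    symmetric in [x_q] and [x_r]: exchanging the variables and adding gives an
    equation in two variables, whose third derivative in [x_q], taken at the zeros
    of [B], shows that the difference is at most quadratic. *)

Require Import Defs.
From HB Require Import structures.
From mathcomp Require Import all_boot all_order all_algebra perm.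
From mathcomp Require Import all_classical all_reals all_analysis.
From mathcomp Require Import ring lra zify.

Set Implicit Arguments.
Unset Strict Implicit.
Unset Printing Implicit Defensive.

Import Order.TTheory GRing.Theory Num.Theory.
Import numFieldNormedType.Exports.

Local Open Scope classical_set_scope.
Local Open Scope ring_scope.

(** * Tensors and their brackets *)

(** [Delta] vanishes nowhere on the box, so the intervals of one group are pairwise disjoint and no
    diagonal point lies in the box: the diagonal is reached only by continuation in x_q. The
    operator on A_q agrees on its interval with two polynomials, one obtained by clearing
    denominators, whose diagonal values are known ([master]), and one whose degree is bounded
    through the definition of ell or L ([slot_op_degree]). They coincide since an interval is
    infinite.

    The hypotheses on ell, L and independence concern one slot q. Brackets of elements of h are
    symmetric in the variables of group p, because symmetric tensors and the powers of e_j are.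
    Exchanging two slots of the group therefore maps solutions to solutions for the same beta and
    carries results at q to the whole group.

    For a pure tensor beta the bracket is (a + b x_q) times a factor free of x_q, whose square
    divides out: an ordinary differential equation in x_q alone remains, solved by a double
    integration. That its right-hand side is common to all slots is again a diagonal evaluation. *)

Lemma upd_same (R : realType) (k : nat) (d : 'I_k -> nat) (x : slot d -> R) s t :
  upd x s t s = t.
Proof. by rewrite /upd /= eqxx. Qed.

Lemma upd_other (R : realType) (k : nat) (d : 'I_k -> nat) (x : slot d -> R)
    s s' t : s' != s -> upd x s t s' = x s'.
Proof. by rewrite /upd /= => /negPf ->. Qed.

Lemma upd_upd (R : realType) (k : nat) (d : 'I_k -> nat) (x : slot d -> R) s t u :
  upd (upd x s t) s u = upd x s u.
Proof. by apply/funext => s'; rewrite /upd /=; case: eqP. Qed.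

Lemma upd_id (R : realType) (k : nat) (d : 'I_k -> nat) (x : slot d -> R) s :
  upd x s (x s) = x.
Proof. by apply/funext => s'; rewrite /upd /=; case: eqP => // ->. Qed.

Lemma upd_comm (R : realType) (k : nat) (d : 'I_k -> nat) (x : slot d -> R)
    s s' t u : s != s' -> upd (upd x s t) s' u = upd (upd x s' u) s t.
Proof.
move=> ss'; apply/funext => v; rewrite /upd /=.
by case: (v =P s') => // ->; case: eqP => // E; rewrite E eqxx in ss'.
Qed.

Lemma Slot_eq (k : nat) (d : 'I_k -> nat) (p : 'I_k) (q r : 'I_(d p)) :
  (Slot q == Slot r) = (q == r).
Proof. by rewrite /Slot eq_Tagged. Qed.

Lemma slot_in_group (k : nat) (d : 'I_k -> nat) (p : 'I_k) (s : slot d) :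
  tag s = p -> exists r : 'I_(d p), s = Slot r.
Proof. by case: s => i r /= E; subst i; exists r. Qed.

Section SplitSlots.
Variables (R : realType) (k : nat) (d : 'I_k -> nat) (P : pred 'I_k).
Variables (j : 'I_k) (Pj : P j).

Let join_slot (u : 'I_(d j) + slots d (without j P)) : slots d P :=
  match u with inl r => group_slot Pj r | inr s => widen_slot s end.

Let join_slot_bij : bijective join_slot.
Proof.
apply: inj_card_bij.
  move=> [r|s] [r'|s'] /= /(congr1 val) /=.
  - by move=> /eqP; rewrite Slot_eq => /eqP ->.
  - by move=> /(congr1 (@tag _ _)) /= E; case/andP: (valP s') => /negP[]; apply/eqP.
  - by move=> /(congr1 (@tag _ _)) /= E; case/andP: (valP s) => /negP[]; apply/eqP.
  - by move=> /val_inj ->.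
have -> : #|{: slots d P}| = #|codom join_slot|.
  apply: eq_card => s; rewrite inE; apply/esym/codomP.
  case: s => s Ps; have [/slot_in_group[r E]|sj] := tag s =P j.
    by subst s; exists (inl r); apply: val_inj.
  have Ps' : without j P (tag s) by rewrite /without Ps andbT; apply/eqP.
  by exists (inr (exist _ s Ps')); apply: val_inj.
exact: leq_image_card.
Qed.

Lemma prod_slots_split (F : slots d P -> R) :
  \prod_s F s = (\prod_r F (group_slot Pj r)) * \prod_(s : slots d (without j P)) F (widen_slot s).
Proof.
rewrite (reindex join_slot) /=; last exact: onW_bij.
by rewrite big_sumType.
Qed.

Lemma slots_merge : exists merge : {ffun 'I_(d j) -> bool} ->
    {ffun slots d (without j P) -> bool} -> {ffun slots d P -> bool},
  forall eps : {ffun slots d P -> bool},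
    merge [ffun r => eps (group_slot Pj r)]
          [ffun s : slots d (without j P) => eps (widen_slot s)] = eps.
Proof.
case: join_slot_bij => g fg gf.
exists (fun e1 e2 => [ffun s => match g s with inl r => e1 r | inr s => e2 s end]).
move=> eps; apply/ffunP => s; rewrite ffunE.
by have := gf s; case: (g s) => u /= <-; rewrite ffunE.
Qed.

Lemma sum_ffun_slots_split (F : {ffun 'I_(d j) -> bool} ->
    {ffun slots d (without j P) -> bool} -> R) :
  \sum_(eps : {ffun slots d P -> bool})
     F [ffun r => eps (group_slot Pj r)] [ffun s : slots d (without j P) => eps (widen_slot s)]
  = \sum_e1 \sum_e2 F e1 e2.
Proof.
case: join_slot_bij => g fg gf.
rewrite pair_big /=.
pose split (eps : {ffun slots d P -> bool}) :
    {ffun 'I_(d j) -> bool} * {ffun slots d (without j P) -> bool} :=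
  ([ffun r => eps (group_slot Pj r)],
   [ffun s : slots d (without j P) => eps (widen_slot s)]).
pose merge (e : {ffun 'I_(d j) -> bool} * {ffun slots d (without j P) -> bool}) :
  {ffun slots d P -> bool} :=
  [ffun s => match g s with inl r => e.1 r | inr s => e.2 s end].
rewrite (reindex split) //=; apply: onW_bij; exists merge.
  move=> eps; apply/ffunP => s; rewrite ffunE.
  by have := gf s; case: (g s) => u /= <-; rewrite ffunE.
move=> [e1 e2]; congr pair; apply/ffunP => u; rewrite !ffunE.
  by rewrite -[group_slot Pj u]/(join_slot (inl u)) fg.
by rewrite -[widen_slot u]/(join_slot (inr u)) fg.
Qed.

End SplitSlots.

Lemma bracketE (R : realType) (k : nat) (d : 'I_k -> nat) (P : pred 'I_k)
    (T : tensor R (slots d P)) x :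
  bracket T x =
  \sum_(eps : {ffun slots d P -> bool})
    (\prod_(s : slots d P) component (1, x (val s)) (eps s)) * T eps.
Proof. by rewrite /bracket /tpairing; apply: eq_bigr => eps _; rewrite ffunE. Qed.

Lemma bracketD (R : realType) (k : nat) (d : 'I_k -> nat) (P : pred 'I_k)
    (T U : tensor R (slots d P)) x : bracket (T + U) x = bracket T x + bracket U x.
Proof.
rewrite !bracketE -big_split; apply: eq_bigr => eps _.
by rewrite ffunE; exact: mulrDr.
Qed.

Lemma bracketZ (R : realType) (k : nat) (d : 'I_k -> nat) (P : pred 'I_k)
    (c : R) (T : tensor R (slots d P)) x : bracket (c *: T) x = c * bracket T x.
Proof.
rewrite !bracketE mulr_sumr; apply: eq_bigr => eps _.
by rewrite ffunE; exact: mulrCA.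
Qed.

Lemma bracket0 (R : realType) (k : nat) (d : 'I_k -> nat) (P : pred 'I_k) x :
  bracket (0 : tensor R (slots d P)) x = 0.
Proof. by rewrite bracketE big1 // => eps _; rewrite ffunE mulr0. Qed.

Lemma bracketB (R : realType) (k : nat) (d : 'I_k -> nat) (P : pred 'I_k)
    (T U : tensor R (slots d P)) x : bracket (T - U) x = bracket T x - bracket U x.
Proof. by rewrite bracketD -scaleN1r bracketZ mulN1r. Qed.

Lemma bracket_sum (R : realType) (k : nat) (d : 'I_k -> nat) (P : pred 'I_k)
    (J : finType) (T : J -> tensor R (slots d P)) x :
  bracket (\sum_j T j) x = \sum_j bracket (T j) x.
Proof.
by apply: (big_morph (fun U => bracket U x)) => [U V|]; rewrite (bracketD, bracket0).
Qed.

(** A multi-affine function vanishing at the vertices of a cube has zero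
    coefficients: a nonzero coefficient with minimal support is the value at the
    indicator function of this support. *)
Lemma bracket_inj (R : realType) (k : nat) (d : 'I_k -> nat) (P : pred 'I_k)
    (T : tensor R (slots d P)) : (forall x, bracket T x = 0) -> T = 0.
Proof.
move=> T0; apply/ffunP => eps; rewrite [RHS]ffunE.
have [n] := ubnP #|[pred s | eps s]|; elim: n eps => // n IH eps; rewrite ltnS => en.
pose x (s : slot d) : R :=
  if insub s is Some s' then (eps (s' : slots d P))%:R else 0.
have xE (s : slots d P) : x (val s) = (eps s)%:R by rewrite /x valK.
have := T0 x; rewrite bracketE (bigD1 eps) //= [X in _ + X]big1 ?addr0.
  rewrite big1 ?mul1r // => s _; rewrite xE /component.
  by case: (eps s).
move=> e ne; have [/forallP le|] := boolP [forall s, e s ==> eps s].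
  rewrite IH ?mulr0 //; apply: leq_trans en; apply: proper_card.
  apply/properP; split; first by apply/fintype.subsetP => s; rewrite !inE; exact/implyP.
  have [s es] : exists s, e s != eps s.
    apply/existsP; apply: contra_neqT ne => /existsPn h; apply/ffunP => s.
    by have := h s; rewrite negbK => /eqP.
  exists s; rewrite !inE; have := le s; move: es; by case: (e s); case: (eps s).
rewrite negb_forall => /existsP[s]; rewrite negb_imply => /andP[es nes].
by rewrite (bigD1 s) //= xE es /component (negPf nes) mul0r mul0r.
Qed.

Definition contract (R : realType) (n : nat) (T : tensor R 'I_n) (v : 'I_n -> R) : R :=
  tpairing (ptensor (fun r => (1, v r))) T.

Lemma contractE (R : realType) (n : nat) (T : tensor R 'I_n) (v : 'I_n -> R) :
  contract T v =
  \sum_(eps : {ffun 'I_n -> bool}) (\prod_r component (1, v r) (eps r)) * T eps.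
Proof. by rewrite /contract /tpairing; apply: eq_bigr => eps _; rewrite ffunE. Qed.

Lemma bracket_ins (R : realType) (k : nat) (d : 'I_k -> nat) (P : pred 'I_k)
    (j : 'I_k) (Pj : P j) (T : tensor R 'I_(d j))
    (G : tensor R (slots d (without j P))) x :
  bracket (ins Pj T G) x = contract T (fun r => x (Slot r)) * bracket G x.
Proof.
pose F1 (e : {ffun 'I_(d j) -> bool}) : R :=
  (\prod_(r < d j) component (1, x (Slot r)) (e r)) * T e.
pose F2 (e : {ffun slots d (without j P) -> bool}) : R :=
  (\prod_(s : slots d (without j P)) component (1, x (val s)) (e s)) * G e.
have -> : contract T (fun r => x (Slot r)) = \sum_e F1 e by exact: contractE.
have -> : bracket G x = \sum_e F2 e by exact: bracketE.
rewrite big_distrlr /= -(sum_ffun_slots_split Pj (fun e1 e2 => F1 e1 * F2 e2)).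
rewrite bracketE; apply: eq_bigr => eps _.
rewrite ffunE (prod_slots_split Pj) /= mulrACA.
congr (_ * _ * _); first by apply: eq_bigr => r _; rewrite ffunE.
rewrite /F2; congr (_ * _); by apply: eq_bigr => s _; rewrite ffunE.
Qed.

Lemma pairing_tpower (R : realType) (S : finType) (e : R * R) (v : S -> R) :
  tpairing (ptensor (fun s => (1, v s))) (tpower S e) = \prod_s line e (v s).
Proof.
rewrite /tpairing /line; under [RHS]eq_bigr do rewrite -[e.1]mul1r.
transitivity (\prod_(s : S) \sum_(b : bool) component (1, v s) b * component e b).
  rewrite bigA_distr_bigA; apply: eq_bigr => eps _.
  by rewrite !ffunE -big_split.
by apply: eq_bigr => s _; rewrite big_bool /= addrC.
Qed.

Lemma contract_tpower (R : realType) (n : nat) (e : R * R) (v : 'I_n -> R) :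
  contract (tpower _ e) v = \prod_r line e (v r).
Proof. exact: pairing_tpower. Qed.

Lemma contract_sym (R : realType) (n : nat) (T : tensor R 'I_n) (sigma : 'S_n) v :
  T \in SymT R n -> contract T (v \o sigma) = contract T v.
Proof.
move=> /SymTP TS; rewrite !contractE.
rewrite (reindex (fun eps : {ffun 'I_n -> bool} => [ffun r => eps (sigma r)])) /=.
  apply: eq_bigr => eps _; rewrite -{2}(TS sigma) ffunE; congr (_ * _).
  rewrite [RHS](reindex_inj (@perm_inj _ sigma)) /=.
  by apply: eq_bigr => r _; rewrite ffunE.
apply: onW_bij; exists (fun eps : {ffun 'I_n -> bool} => [ffun r => eps (sigma^-1%g r)]).
  by move=> eps; apply/ffunP => r; rewrite !ffunE permKV.
by move=> eps; apply/ffunP => r; rewrite !ffunE permK.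
Qed.

Lemma bracket_upd_absent (R : realType) (k : nat) (d : 'I_k -> nat)
    (P : pred 'I_k) (T : tensor R (slots d P)) x s t :
  ~~ P (tag s) -> bracket T (upd x s t) = bracket T x.
Proof.
move=> nP; rewrite !bracketE; apply: eq_bigr => eps _; congr (_ * _).
apply: eq_bigr => s' _; rewrite upd_other //.
by apply: contraNneq nP; case: s' => s' Ps' /= <-.
Qed.

(** A bracket is affine in each variable, so its partial derivative is a difference of two values
    and is defined at every point. *)
Definition slope (R : realType) (k : nat) (d : 'I_k -> nat)
    (P : pred 'I_k) (T : tensor R (slots d P)) (s : slot d) (x : slot d -> R) : R :=
  bracket T (upd x s 1) - bracket T (upd x s 0).

Lemma bracket_affine (R : realType) (k : nat) (d : 'I_k -> nat)
    (P : pred 'I_k) (T : tensor R (slots d P)) x s t :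
  bracket T (upd x s t) = bracket T (upd x s 0) + t * slope T s x.
Proof.
have [Ps|nPs] := boolP (P (tag s)); last first.
  by rewrite /slope !bracket_upd_absent // subrr mulr0 addr0.
rewrite /slope !bracketE -sumrB mulr_sumr -big_split /=; apply: eq_bigr => eps _.
pose s' : slots d P := exist _ s Ps.
have E u : \prod_s0 component (1, upd x s u (val s0)) (eps s0) =
   component (1, u) (eps s') *
   \prod_(s0 | s0 != s') component (1, x (val s0)) (eps s0).
  rewrite (bigD1 s') //= upd_same; congr (_ * _); apply: eq_bigr => s0 ne.
  rewrite upd_other //; by apply: contra ne => /eqP E; apply/eqP/val_inj.
rewrite !E /component; case: (eps s') => /=; ring.
Qed.

Lemma slope_upd (R : realType) (k : nat) (d : 'I_k -> nat)
    (P : pred 'I_k) (T : tensor R (slots d P)) s x t :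
  slope T s (upd x s t) = slope T s x.
Proof. by rewrite /slope !upd_upd. Qed.

Lemma hspace_bracket (R : realType) (k : nat) (d : 'I_k -> nat)
    (Gamma : gammas R d) (alpha : Vdual R d) : alpha \in hspace Gamma ->
  exists T : forall j, tensor R 'I_(d j), (forall j, T j \in SymT R (d j)) /\
    forall x, bracket alpha x =
      \sum_j contract (T j) (fun r => x (Slot r)) * bracket (Gamma j) x.
Proof.
move=> /memv_sumP[v vP ->].
have TP j : exists U : tensor R 'I_(d j), U \in SymT R (d j) /\
    v j = ins (P := xpredT) (erefl true) U (Gamma j).
  by have /memv_imgP[U US ->] := vP j isT; exists U; rewrite lfunE.
exists (fun j => projT1 (cid (TP j))); split => [j|x].
  by case: cid => U [].
rewrite bracket_sum; apply: eq_bigr => j _; case: cid => U [_ /= ->].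
exact: bracket_ins.
Qed.

Lemma ins_hspace (R : realType) (k : nat) (d : 'I_k -> nat)
    (Gamma : gammas R d) (j : 'I_k) (T : tensor R 'I_(d j)) :
  T \in SymT R (d j) ->
  ins (P := xpredT) (erefl true) T (Gamma j) \in hspace Gamma.
Proof.
move=> TS; apply: (subvP (sumv_sup j isT (subvv _))).
by apply/memv_imgP; exists T => //; rewrite lfunE.
Qed.

(** Freezing the variables of group j leaves a tensor on the other groups; the cofactor of a pure
    tensor is obtained in this way. *)
Lemma contract_exists (R : realType) (k : nat) (d : 'I_k -> nat) (P : pred 'I_k)
    (j : 'I_k) (Pj : P j) (T : tensor R (slots d P)) (v : 'I_(d j) -> R) :
  exists G : tensor R (slots d (without j P)), forall x,
    (forall r, x (Slot r) = v r) -> bracket G x = bracket T x.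
Proof.
have [merge mE] := slots_merge d Pj.
exists [ffun e2 => \sum_(e1 : {ffun 'I_(d j) -> bool})
   (\prod_r component (1, v r) (e1 r)) * T (merge e1 e2)] => x xv.
pose F (e1 : {ffun 'I_(d j) -> bool}) (e2 : {ffun slots d (without j P) -> bool}) : R :=
  (\prod_(r < d j) component (1, v r) (e1 r)) *
  ((\prod_(s : slots d (without j P)) component (1, x (val s)) (e2 s)) * T (merge e1 e2)).
have -> : bracket T x = \sum_e1 \sum_e2 F e1 e2.
  rewrite -(sum_ffun_slots_split Pj F) bracketE; apply: eq_bigr => eps _.
  rewrite (prod_slots_split Pj) /F mE -mulrA; congr (_ * (_ * _)).
    by apply: eq_bigr => r _; rewrite ffunE /= xv.
  by apply: eq_bigr => s _; rewrite ffunE.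
rewrite exchange_big bracketE; apply: eq_bigr => e2 _.
rewrite ffunE mulr_sumr; apply: eq_bigr => e1 _.
by rewrite /F mulrCA.
Qed.

(** * Exchange of two variables of a group *)

Definition swap (k : nat) (d : 'I_k -> nat) (p : 'I_k) (q r : 'I_(d p)) (s : slot d) :
  slot d := tperm (Slot q) (Slot r) s.

Lemma swapK (k : nat) (d : 'I_k -> nat) (p : 'I_k) (q r : 'I_(d p)) :
  involutive (swap q r).
Proof. by move=> s; rewrite /swap tpermK. Qed.

Lemma tag_swap (k : nat) (d : 'I_k -> nat) (p : 'I_k) (q r : 'I_(d p)) s :
  tag (swap q r s) = tag s.
Proof. by rewrite /swap; case: tpermP => [->|->|]. Qed.

Lemma swap_other (k : nat) (d : 'I_k -> nat) (p : 'I_k) (q r : 'I_(d p)) s :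
  s != Slot q -> s != Slot r -> swap q r s = s.
Proof. by move=> sq sr; rewrite /swap tpermD // eq_sym. Qed.

Lemma swap_Slot (k : nat) (d : 'I_k -> nat) (p : 'I_k) (q r s : 'I_(d p)) :
  swap q r (Slot s) = Slot (tperm q r s).
Proof.
rewrite /swap; case: (tpermP q r s) => [->|->|/eqP sq /eqP sr].
- by rewrite tpermL.
- by rewrite tpermR.
by rewrite tpermD // eq_sym Slot_eq.
Qed.

Lemma upd_swap (R : realType) (k : nat) (d : 'I_k -> nat) (p : 'I_k)
    (q r : 'I_(d p)) (x : slot d -> R) s t :
  upd (x \o swap q r) s t = upd x (swap q r s) t \o swap q r.
Proof. by apply/funext => u; rewrite /upd /= (inv_eq (swapK q r)) swapK. Qed.

Lemma contract_group_upd (R : realType) (k : nat) (d : 'I_k -> nat) (j : 'I_k)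
    (T : tensor R 'I_(d j)) (x : slot d -> R) s t :
  tag s != j ->
  contract T (fun r => upd x s t (Slot r)) = contract T (fun r => x (Slot r)).
Proof.
move=> sj; congr contract; apply/funext => r; rewrite upd_other //.
by apply: contra sj => /eqP <-.
Qed.

Section Symmetry.
Variables (R : realType) (k : nat) (d : 'I_k -> nat) (Gamma : gammas R d).
Variables (p : 'I_k) (e : 'I_k -> R * R) (hp : decomposes Gamma p e).

(** The variables of group p enter only through the symmetric product of the lines of e_j. *)
Lemma gamma_factor (j : 'I_k) : j != p ->
  exists2 G : (slot d -> R) -> R,
    forall x, bracket (Gamma j) x = (\prod_r line (e j) (x (@Slot k d p r))) * G x &
    forall x y, (forall s, tag s != p -> x s = y s) -> G x = G y.
Proof.
move=> jp; have hj : without j xpredT p by rewrite /without andbT eq_sym.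
have [G GE] := hp hj; exists (bracket G).
  by move=> x; rewrite GE bracket_ins contract_tpower.
move=> x y xy; rewrite !bracketE; apply: eq_bigr => eps _; congr (_ * _).
apply: eq_bigr => s _; rewrite xy //.
by case: s => s Ps; case/andP: (Ps).
Qed.

Lemma gamma_p_absent x y : (forall s, tag s != p -> x s = y s) ->
  bracket (Gamma p) x = bracket (Gamma p) y.
Proof.
move=> xy; rewrite !bracketE; apply: eq_bigr => eps _; congr (_ * _).
apply: eq_bigr => s _; rewrite xy //.
by case: s => s Ps; case/andP: (Ps).
Qed.

Lemma gamma_swap (q r : 'I_(d p)) j x :
  bracket (Gamma j) (x \o swap q r) = bracket (Gamma j) x.
Proof.
have ne s : tag s != p -> (x \o swap q r) s = x s.
  move=> sp; rewrite /= swap_other //; by apply: contraNneq sp => ->.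
have [->|/gamma_factor[G GE Gy]] := eqVneq j p; first exact: gamma_p_absent.
rewrite !GE (Gy _ _ ne); congr (_ * _).
rewrite [RHS](reindex_inj (@perm_inj _ (tperm q r))) /=.
by apply: eq_bigr => i _; rewrite swap_Slot.
Qed.

Lemma hspace_swap (q r : 'I_(d p)) alpha x : alpha \in hspace Gamma ->
  bracket alpha (x \o swap q r) = bracket alpha x.
Proof.
move=> /hspace_bracket[T [TS TE]]; rewrite !TE; apply: eq_bigr => j _.
rewrite gamma_swap; congr (_ * _).
have [->|jp] := eqVneq j p.
  rewrite -[RHS](contract_sym (tperm q r) _ (TS p)); congr contract.
  by apply/funext => i; rewrite /= swap_Slot.
congr contract; apply/funext => i /=; rewrite swap_other //.
  by apply: contra jp => /eqP/(congr1 (@tag _ _)) /= ->.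
by apply: contra jp => /eqP/(congr1 (@tag _ _)) /= ->.
Qed.

End Symmetry.

(** As a product over all slots, [Delta] is transformed by an exchange of slots through plain
    reindexing. *)
Lemma DeltaE (R : realType) (k : nat) (d : 'I_k -> nat) (s : slot d) (x : slot d -> R) :
  Delta s x = \prod_(s' : slot d | (tag s' == tag s) && (s' != s)) (x s - x s').
Proof.
case: s => i r; rewrite /Delta /=.
rewrite (reindex (fun r' : 'I_(d i) => Slot r')) /=.
  apply: eq_bigl => r'; rewrite eqxx /=; exact/esym/(congr1 negb)/Slot_eq.
(* The inverse has to be total; [r] is a default value that matters only outside the group. *)
exists (fun s : slot d => if insub (nat_of_ord (tagged s)) is Some r' then r' else r).
  by move=> r' _; rewrite /= valK.
move=> [i' r']; rewrite inE /= => /andP[/eqP E _]; subst i'.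
by rewrite valK.
Qed.

Section Relabel.
Variables (R : realType) (k : nat) (d : 'I_k -> nat) (Gamma : gammas R d).
Variables (p : 'I_k) (e : 'I_k -> R * R) (hp : decomposes Gamma p e).
Variables (beta : Vdual R d) (beta_h : beta \in hspace Gamma) (q r : 'I_(d p)).

Lemma Delta_swap s (x : slot d -> R) :
  Delta (swap q r s) (x \o swap q r) = Delta s x.
Proof.
rewrite !DeltaE [RHS](reindex_inj (can_inj (swapK q r))) /=.
rewrite swapK; apply: eq_bigl => s'.
by rewrite !tag_swap (inv_eq (swapK q r)).
Qed.

Lemma hatprod_swap x : hatprod Gamma (x \o swap q r) = hatprod Gamma x.
Proof. by apply: eq_bigr => j _; rewrite (gamma_swap hp). Qed.

Lemma weight_swap x : weight Gamma beta (x \o swap q r) = weight Gamma beta x.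
Proof. by rewrite /weight hatprod_swap (hspace_swap hp). Qed.

Lemma prefactor_swap s x :
  prefactor Gamma beta (swap q r s) (x \o swap q r) = prefactor Gamma beta s x.
Proof.
rewrite /prefactor hatprod_swap (hspace_swap hp) // Delta_swap.
by rewrite (gamma_swap hp) tag_swap.
Qed.

Lemma nonsingular_swap x :
  nonsingular Gamma beta (x \o swap q r) <-> nonsingular Gamma beta x.
Proof.
rewrite /nonsingular (hspace_swap hp) //; split=> -[h1 h2 h3]; split => // [s|j].
- by rewrite -Delta_swap.
- by rewrite -(gamma_swap hp q r).
- by rewrite -(swapK q r s) Delta_swap.
- by rewrite (gamma_swap hp q r).
Qed.

End Relabel.

Lemma iter_partial (R : realType) (k : nat) (d : 'I_k -> nat) (s : slot d) n
    (F : (slot d -> R) -> R) x :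
  iter n (partial s) F x = derive1n n (fun t => F (upd x s t)) (x s).
Proof.
elim: n x => [|n IH] x; first by rewrite /= upd_id.
rewrite iterS derive1nS /partial; congr (derive1 _ _); apply/funext => t.
rewrite IH upd_same; congr (derive1n _ _ _).
by apply/funext => u; rewrite upd_upd.
Qed.

Lemma sum_slots (R : realType) (k : nat) (d : 'I_k -> nat) (F : slot d -> R) :
  \sum_(i < k) \sum_(r < d i) F (Slot r) = \sum_s F s.
Proof.
rewrite (sig_big_dep (fun=> true) (fun _ _ => true) (fun i r => F (@Slot k d i r))) /=.
by apply: eq_bigr => -[i r] _.
Qed.

Lemma extremal_lhsE (R : realType) (k : nat) (d : 'I_k -> nat)
    (Gamma : gammas R d) (beta : Vdual R d) (A : slot d -> R -> R) x :
  extremal_lhs Gamma beta A x = \sum_s prefactor Gamma beta s x *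
    derive1n 2 (fun t => A s t * weight Gamma beta (upd x s t)) (x s).
Proof.
rewrite -(sum_slots (fun s => prefactor Gamma beta s x *
  derive1n 2 (fun t => A s t * weight Gamma beta (upd x s t)) (x s))).
apply: eq_bigr => i _.
apply: eq_bigr => r _.
rewrite (iter_partial (Slot r) 2).
apply: (congr1 (fun f => prefactor Gamma beta (Slot r) x * derive1n 2 f (x (Slot r)))).
apply/funext => t.
by rewrite upd_same.
Qed.

(** Turns a result at the distinguished slot into one at any slot of its group: beta and Gamma are
    unchanged, so the hypotheses on them still apply. *)
Lemma extremal_swap (R : realType) (k : nat) (d : 'I_k -> nat)
    (Gamma : gammas R d) (p : 'I_k) (e : 'I_k -> R * R) (beta : Vdual R d)
    (I : slot d -> set R) (A : slot d -> R -> R) (q r : 'I_(d p)) :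
  decomposes Gamma p e -> beta \in hspace Gamma ->
  extremal_solution Gamma beta I A ->
  extremal_solution Gamma beta (I \o swap q r) (A \o swap q r).
Proof.
move=> hp beta_h [hI hA hN [alpha alpha_h hE]].
have box x : (forall s, (I \o swap q r) s (x s)) -> forall s, I s ((x \o swap q r) s).
  by move=> h s; have := h (swap q r s); rewrite /= swapK.
split=> [s|s|x /box/hN|]; first exact: hI; first exact: hA.
  by rewrite (nonsingular_swap hp).
exists alpha; first exact: alpha_h.
move=> x bx; rewrite -(hspace_swap hp q r x alpha_h) -(hE _ (box x bx)).
rewrite !extremal_lhsE [RHS](reindex_inj (can_inj (swapK q r))) /=.
apply: eq_bigr => s _; rewrite (prefactor_swap hp beta_h) swapK.
apply: (congr1 (fun f => prefactor Gamma beta s x * derive1n 2 f (x s))).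
by apply/funext => t; rewrite upd_swap swapK (weight_swap hp beta_h).
Qed.

(** * Functions of one variable *)

(** The derivative is an explicit function, so that derivatives of compound expressions are
    assembled by rules and compared through [deriv_on_uniq]. *)
Definition deriv_on (R : realType) (I : set R) (f f' : R -> R) : Prop :=
  forall t, I t -> is_derive t 1 f (f' t).

Lemma deriv_onE (R : realType) (I : set R) (f f' : R -> R) t :
  deriv_on I f f' -> I t -> derive1 f t = f' t.
Proof. by move=> ff' It; have [_ <-] := ff' t It; rewrite derive1E. Qed.

Lemma deriv_on_eq (R : realType) (I : set R) (f g f' : R -> R) :
  open I -> (forall t, I t -> f t = g t) -> deriv_on I f f' -> deriv_on I g f'.
Proof.
move=> oI fg ff' t It; apply: near_eq_is_derive (ff' t It).
by near=> u; apply: fg; near: u; apply: open_nbhs_nbhs.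
Unshelve. all: by end_near. Qed.

Lemma deriv_on_eqr (R : realType) (I : set R) (f f' g' : R -> R) :
  (forall t, I t -> f' t = g' t) -> deriv_on I f f' -> deriv_on I f g'.
Proof. by move=> fg ff' t It; rewrite -fg //; exact: ff'. Qed.

Lemma derive1n2_on (R : realType) (I : set R) (f f' f'' : R -> R) t :
  open I -> deriv_on I f f' -> deriv_on I f' f'' -> I t -> derive1n 2 f t = f'' t.
Proof.
move=> oI ff' ff'' It; rewrite /derive1n /=.
apply: (deriv_onE (I := I)) => //; apply: deriv_on_eq ff'' => // u Iu.
by rewrite (deriv_onE ff').
Qed.

Lemma deriv_on_uniq (R : realType) (I : set R) (f f' g' : R -> R) t :
  deriv_on I f f' -> deriv_on I f g' -> I t -> f' t = g' t.
Proof. by move=> H1 H2 It; rewrite -(deriv_onE H1 It) (deriv_onE H2 It). Qed.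

Section DerivOn.
Variables (R : realType) (I : set R).
Implicit Types (f g : R -> R).

Lemma deriv_onD f g f' g' : deriv_on I f f' -> deriv_on I g g' ->
  deriv_on I (fun t => f t + g t) (fun t => f' t + g' t).
Proof. by move=> ff' gg' t It; exact: is_deriveD (ff' t It) (gg' t It). Qed.

Lemma deriv_onN f f' : deriv_on I f f' ->
  deriv_on I (fun t => - f t) (fun t => - f' t).
Proof. by move=> ff' t It; exact: is_deriveN (ff' t It). Qed.

Lemma deriv_onB f g f' g' : deriv_on I f f' -> deriv_on I g g' ->
  deriv_on I (fun t => f t - g t) (fun t => f' t - g' t).
Proof. by move=> ff' gg'; exact: deriv_onD ff' (deriv_onN gg'). Qed.

Lemma deriv_onM f g f' g' : deriv_on I f f' -> deriv_on I g g' ->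
  deriv_on I (fun t => f t * g t) (fun t => f' t * g t + f t * g' t).
Proof.
move=> ff' gg' t It.
have := is_deriveM (ff' t It) (gg' t It).
move=> /trigger_derive; apply.
by rewrite addrC [g t *: _]mulrC.
Qed.

Lemma deriv_onC (c : R) : deriv_on I (fun=> c) (fun=> 0).
Proof. by move=> t It; exact: is_derive_cst. Qed.

Lemma deriv_on_horner (p : {poly R}) : deriv_on I (horner p) (horner p^`()).
Proof. by move=> t It; exact: is_derive_poly. Qed.

Lemma deriv_on_affine (b0 b1 : R) : deriv_on I (fun t => b0 + b1 * t) (fun=> b1).
Proof.
move=> t It; have := is_derive_poly (b1 *: 'X + b0%:P) t.
have -> : horner (b1 *: 'X + b0%:P) = (fun t => b0 + b1 * t).
  by apply/funext => u; rewrite !hornerE addrC.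
by rewrite derivD derivZ derivX derivC !hornerE.
Qed.

Lemma deriv_on_affineXV (b0 b1 : R) (n : nat) :
  (forall t, I t -> b0 + b1 * t != 0) ->
  deriv_on I (fun t => ((b0 + b1 * t) ^+ n)^-1)
             (fun t => - n%:R * b1 * ((b0 + b1 * t) ^+ n.+1)^-1).
Proof.
move=> b0n t It; have bt := b0n t It.
have H : is_derive t 1 ((fun t => b0 + b1 * t) ^+ n)
    ((n%:R * (b0 + b1 * t) ^+ n.-1) *: b1).
  exact: is_deriveX (deriv_on_affine b0 b1 It).
have -> : (fun t => ((b0 + b1 * t) ^+ n)^-1) =
   (fun y => (((fun t => b0 + b1 * t) ^+ n) y)^-1).
  by apply/funext => u; rewrite exprfctE.
have bn : ((fun t => b0 + b1 * t) ^+ n) t != 0 by rewrite exprfctE expf_neq0.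
have := is_deriveV bn H; move=> /trigger_derive; apply.
rewrite exprfctE /GRing.scale /=; case: n {H bn} => [|n]; first by rewrite !mul0r oppr0 !mul0r mulr0.
by rewrite /= !exprS; field; rewrite bt expf_neq0.
Qed.

(** Differentiability of finite order with the successive derivatives as witnesses, a form in which
    stability under sums and products is a short induction. *)
Fixpoint Cn_on (n : nat) f : Prop :=
  if n is n'.+1 then exists2 f', deriv_on I f f' & Cn_on n' f' else True.

Lemma Cn_onS n f : Cn_on n.+1 f -> Cn_on n f.
Proof. by elim: n f => // n IH f [f' ff' /IH]; exists f'. Qed.

Lemma Cn_onD n f g : Cn_on n f -> Cn_on n g -> Cn_on n (fun t => f t + g t).
Proof.
elim: n f g => // n IH f g [f' ff' f'n] [g' gg' g'n].
by exists (fun t => f' t + g' t); [exact: deriv_onD|exact: IH].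
Qed.

Lemma Cn_onM n f g : Cn_on n f -> Cn_on n g -> Cn_on n (fun t => f t * g t).
Proof.
elim: n f g => // n IH f g [f' ff' f'n] [g' gg' g'n].
exists (fun t => f' t * g t + f t * g' t); first exact: deriv_onM.
by apply: Cn_onD; apply: IH => //; apply: Cn_onS; [exists g'|exists f'].
Qed.

Lemma Cn_on_horner n (p : {poly R}) : Cn_on n (horner p).
Proof.
by elim: n p => // n IH p; exists (horner p^`()); [exact: deriv_on_horner|].
Qed.

Lemma smooth_Cn f i n : smooth_on I f -> Cn_on n (derive1n i f).
Proof.
move=> sf; elim: n i => // n IH i; exists (derive1n i.+1 f); last exact: IH.
move=> t It; have := sf i t It; rewrite derive1nS derive1E => /derivableP.
exact.
Qed.

Lemma smooth_deriv_on f i : smooth_on I f ->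
  deriv_on I (derive1n i f) (derive1n i.+1 f).
Proof.
by move=> sf t It; have := sf i t It; rewrite derive1nS derive1E => /derivableP.
Qed.

End DerivOn.

Lemma deriv_on0_cst (R : realType) (I : set R) (f : R -> R) :
  is_interval I -> deriv_on I f (fun=> 0) ->
  forall t u, I t -> I u -> f t = f u.
Proof.
move=> iI df t u It Iu; wlog tu : t u It Iu / t <= u.
  by move=> H; case: (leP t u) => [/H->|/ltW /H->].
have sub x : x \in `[t, u]%R -> I x.
  by rewrite in_itv /= => /andP[? ?]; apply: (iI t u) => //; apply/andP.
have [||c _] := @MVT_segment R f (fun=> 0) t u tu.
- by move=> x xtu; apply: df; apply: sub; apply: subset_itv_oo_cc.
- apply: derivable_within_continuous => x xtu.
  by have [] := df x (sub x xtu).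
by rewrite mul0r => /eqP; rewrite subr_eq0 => /eqP ->.
Qed.

Definition antideriv (R : realType) (p : {poly R}) : {poly R} :=
  \poly_(i < (size p).+1) (if i is i'.+1 then p`_i' / i%:R else 0).

Lemma deriv_antideriv (R : realType) (p : {poly R}) : (antideriv p)^`() = p.
Proof.
apply/polyP => i; rewrite coef_deriv coef_poly ltnS.
case: ltnP => [_|pi]; last by rewrite mul0rn nth_default.
by rewrite -[(_ / _) *+ _]mulr_natr mulfVK // pnatr_eq0.
Qed.

Lemma size_antideriv (R : realType) (p : {poly R}) n :
  (size p <= n)%N -> (size (antideriv p) <= n.+1)%N.
Proof. by move=> pn; apply: leq_trans (size_poly _ _) _. Qed.

Lemma poly_primitive (R : realType) (I : set R) (f : R -> R) (p : {poly R}) n :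
  open_interval I -> deriv_on I f (horner p) -> (size p <= n)%N ->
  exists2 P : {poly R}, (size P <= n.+1)%N & forall t, I t -> f t = P.[t].
Proof.
move=> [oI iI [t0 It0]] df pn.
exists (antideriv p + (f t0 - (antideriv p).[t0])%:P).
  rewrite (leq_trans (size_polyD _ _)) // geq_max size_antideriv //=.
  by rewrite (leq_trans (size_polyC_leq1 _)).
move=> t It; rewrite hornerD hornerC.
have dg : deriv_on I (fun t => f t - (antideriv p).[t]) (fun=> 0).
  apply: (deriv_on_eqr _ (deriv_onB df (deriv_on_horner (I:=I) (antideriv p)))) => u Iu.
  by rewrite deriv_antideriv subrr.
by rewrite -(deriv_on0_cst iI dg It It0) addrC subrK.
Qed.

(** [weighted_op b b1 M f0 f1 f2] is $b^{M+2} (f / b^M)''$ for an affine function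
    [b] of slope [b1]. *)
Definition weighted_op (R : realType) (b b1 M f0 f1 f2 : R) : R :=
  b ^+ 2 * f2 - 2 * M * b * b1 * f1 + M * (M + 1) * b1 ^+ 2 * f0.

(** Differentiating the operator of weight [j + 1] yields that of weight [j]
    applied to the derivative; at weight 0 only [b^2 f''] is left. *)
Lemma weighted_op_polynomial (R : realType) (I : set R) (b0 b1 : R) (j : nat)
    (f f' f'' : R -> R) (Q : {poly R}) :
  open_interval I -> (forall t, I t -> b0 + b1 * t != 0) ->
  deriv_on I f f' -> deriv_on I f' f'' -> Cn_on I j f'' ->
  (size Q <= j)%N ->
  (forall t, I t -> weighted_op (b0 + b1 * t) b1 j%:R (f t) (f' t) (f'' t) = Q.[t]) ->
  exists2 P : {poly R}, (size P <= j.+2)%N & forall t, I t -> f t = P.[t].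
Proof.
move=> II bn; elim: j f f' f'' Q => [|j IH] f f' f'' Q ff' ff'' Cf Qj E.
  have f0 t : I t -> f'' t = (0 : {poly R}).[t].
    move=> It; have := E t It; move: Qj; rewrite size_poly_leq0 => /eqP ->.
    rewrite /weighted_op horner0 mulr0 !mul0r subr0 addr0 => /eqP.
    by rewrite mulf_eq0 expf_eq0 (negPf (bn t It)) andbF /= => /eqP.
  have [|P1 P1s f1E] := poly_primitive II (deriv_on_eqr f0 ff'') (n := 0).
    by rewrite size_poly0.
  exact: (poly_primitive II (deriv_on_eqr f1E ff') P1s).
have [f3 ff3 Cf3] := Cf.
have [P Ps f'E] : exists2 P : {poly R}, (size P <= j.+2)%N & forall t, I t -> f' t = P.[t].
  apply: (IH f' f'' f3 Q^`()) => //.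
    by rewrite (leq_trans (size_poly _ _)) //; case: (size Q) Qj.
  move=> t It.
  have db := deriv_on_affine (I:=I) b0 b1.
  (* The coefficient of b b1 f'' becomes 2 - 2(j+1) = -2j, that of b1^2 f' becomes (j+1)(j+2) -
     2(j+1) = j(j+1). *)
  have dE := deriv_onD (deriv_onB (deriv_onM (deriv_onM db db) ff3)
     (deriv_onM (deriv_onM (deriv_onC (I:=I) (2 * j.+1%:R * b1)) db) ff''))
     (deriv_onM (deriv_onC (I:=I) (j.+1%:R * (j.+1%:R + 1) * b1 ^+ 2)) ff').
  have [oI _ _] := II.
  have dQ := deriv_on_horner (I:=I) Q.
  have := deriv_on_uniq (deriv_on_eq oI _ dE) dQ It => /(_ _)<-; last first.
    move=> u Iu; rewrite -E // /weighted_op; ring.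
  rewrite /weighted_op -natr1; ring.
exact: (poly_primitive II (deriv_on_eqr f'E ff') Ps).
Qed.

Lemma weighted_deriv (R : realType) (I : set R) (b0 b1 : R) (M : nat)
    (V V1 V2 : R -> R) :
  (forall t, I t -> b0 + b1 * t != 0) ->
  deriv_on I V V1 -> deriv_on I V1 V2 ->
  exists2 G1, deriv_on I (fun u => V u / (b0 + b1 * u) ^+ M) G1 &
    deriv_on I G1 (fun t =>
      weighted_op (b0 + b1 * t) b1 M%:R (V t) (V1 t) (V2 t) / (b0 + b1 * t) ^+ M.+2).
Proof.
move=> bn VV1 VV2; have dw n := deriv_on_affineXV n bn.
have d2 := deriv_onD (deriv_onM VV2 (dw M))
  (deriv_onM VV1 (deriv_onM (deriv_onC (I:=I) (- M%:R * b1)) (dw M.+1))).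
eexists; first exact: deriv_onM VV1 (dw M).
apply: deriv_on_eqr d2 => t It; have bt := bn t It.
by rewrite /weighted_op !exprS -natr1; field; rewrite bt expf_neq0.
Qed.

Lemma derive1n2_weighted (R : realType) (I : set R) (b0 b1 : R) (M : nat)
    (V V1 V2 : R -> R) t :
  open I -> (forall t, I t -> b0 + b1 * t != 0) ->
  deriv_on I V V1 -> deriv_on I V1 V2 -> I t ->
  derive1n 2 (fun u => V u / (b0 + b1 * u) ^+ M) t =
  weighted_op (b0 + b1 * t) b1 M%:R (V t) (V1 t) (V2 t) / (b0 + b1 * t) ^+ M.+2.
Proof.
move=> oI bn VV1 VV2 It; have [G1 d1 d2] := weighted_deriv M bn VV1 VV2.
exact: (derive1n2_on oI d1 d2 It).
Qed.

Lemma second_antiderivative_on (R : realType) (I : set R) (F G G1 G2 : R -> R) :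
  open I -> deriv_on I G G1 -> deriv_on I G1 G2 -> (forall t, I t -> G2 t = F t) ->
  second_antiderivative I F G.
Proof.
move=> oI d1 d2 GF t It; split.
- by case: (d1 t It).
- have : deriv_on I (derive1 G) G2.
    by apply: deriv_on_eq d2 => // u Iu; rewrite (deriv_onE d1).
  by move=> /(_ t It)[].
by rewrite (derive1n2_on oI d1 d2 It) GF.
Qed.

(** * Polynomial functions and linear independence *)

Definition polyfun (R : realType) (F : R -> R) : Prop :=
  exists P : {poly R}, forall t, F t = P.[t].

Section PolyFun.
Variable R : realType.
Implicit Types F G : R -> R.

Lemma polyfun_horner (P : {poly R}) : polyfun (fun t => P.[t]).
Proof. by exists P. Qed.

Lemma polyfunC (c : R) : polyfun (fun=> c).
Proof. by exists c%:P => t; rewrite hornerC. Qed.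

Lemma polyfun_id : polyfun (fun t : R => t).
Proof. by exists 'X => t; rewrite hornerX. Qed.

Lemma polyfunD F G : polyfun F -> polyfun G -> polyfun (fun t => F t + G t).
Proof. by move=> [P FP] [Q GQ]; exists (P + Q) => t; rewrite hornerD FP GQ. Qed.

Lemma polyfunM F G : polyfun F -> polyfun G -> polyfun (fun t => F t * G t).
Proof. by move=> [P FP] [Q GQ]; exists (P * Q) => t; rewrite hornerM FP GQ. Qed.

Lemma polyfunN F : polyfun F -> polyfun (fun t => - F t).
Proof. by move=> [P FP]; exists (- P) => t; rewrite hornerN FP. Qed.

Lemma polyfunB F G : polyfun F -> polyfun G -> polyfun (fun t => F t - G t).
Proof. by move=> FP GP; apply/polyfunD/polyfunN. Qed.

Lemma polyfunX F n : polyfun F -> polyfun (fun t => F t ^+ n).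
Proof. by move=> [P FP]; exists (P ^+ n) => t; rewrite horner_exp FP. Qed.

Lemma polyfun_sum (J : finType) (A : pred J) (F : J -> R -> R) :
  (forall j, A j -> polyfun (F j)) -> polyfun (fun t => \sum_(j | A j) F j t).
Proof.
move=> FP.
have /choice[P PE] j : exists P : {poly R}, A j -> forall t, F j t = P.[t].
  by have [/FP[P PE]|] := boolP (A j); [exists P|exists 0].
exists (\sum_(j | A j) P j) => t; rewrite horner_sum.
by apply: eq_bigr => j Aj; rewrite PE.
Qed.

Lemma polyfun_prod (J : finType) (A : pred J) (F : J -> R -> R) :
  (forall j, A j -> polyfun (F j)) -> polyfun (fun t => \prod_(j | A j) F j t).
Proof.
move=> FP.
have /choice[P PE] j : exists P : {poly R}, A j -> forall t, F j t = P.[t].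
  by have [/FP[P PE]|] := boolP (A j); [exists P|exists 0].
exists (\prod_(j | A j) P j) => t; rewrite horner_prod.
by apply: eq_bigr => j Aj; rewrite PE.
Qed.

Lemma polyfun_eq F G : (forall t, F t = G t) -> polyfun F -> polyfun G.
Proof. by move=> FG [P FP]; exists P => t; rewrite -FG. Qed.

End PolyFun.

(** Stated through polynomials, so that it also covers sets that are not intervals, such as the
    nonsingular points of a line. *)
Definition infinite_many (R : realType) (I : set R) : Prop :=
  forall P : {poly R}, (forall t, I t -> P.[t] = 0) -> P = 0.

Lemma open_interval_infinite (R : realType) (I : set R) :
  open_interval I -> infinite_many I.
Proof.
move=> [oI _ [t It]] P P0; apply/eqP; apply: contraT => Pn0.
have [e /= e0 eI] : exists2 e : R, 0 < e & forall u, `|t - u| < e -> I u.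
  have /nbhs_ballP[e e0 eI] : nbhs t I by apply: open_nbhs_nbhs.
  by exists e => // u; exact: eI.
(* As many distinct roots as [size P], one more than the degree; the denominators start at 2 to stay
   at distance less than [e] from [t]. *)
pose s := [seq t + e / (i.+2)%:R | i <- iota 0 (size P)].
suff /(max_poly_roots Pn0) : all (root P) s.
  rewrite size_map size_iota ltnn => -> //.
  rewrite map_inj_in_uniq ?iota_uniq // => i j _ _ /addrI.
  move=> /(mulfI (lt0r_neq0 e0)) /invr_inj /eqP.
  by rewrite eqr_nat => /eqP[].
apply/allP => _ /mapP[i _ ->]; rewrite /root P0 //; apply: eI.
rewrite opprD addNKr normrN ger0_norm; last by rewrite divr_ge0 // ltW.
by rewrite ltr_pdivrMr // ltr_pMr // ltr1n.
Qed.

Lemma infinite_polyfun_eq (R : realType) (I : set R) (F G : R -> R) :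
  infinite_many I -> polyfun F -> polyfun G -> (forall t, I t -> F t = G t) ->
  forall t, F t = G t.
Proof.
move=> II [P FP] [Q GQ] FG t; rewrite FP GQ; congr (_.[_]).
apply/eqP; rewrite -subr_eq0; apply/eqP/II => u Iu.
by rewrite hornerD hornerN -FP -GQ FG // subrr.
Qed.

Lemma infinite_poly_eq (R : realType) (I : set R) (P Q : {poly R}) :
  infinite_many I -> (forall t, I t -> P.[t] = Q.[t]) -> P = Q.
Proof.
move=> II PQ; apply/eqP; rewrite -subr_eq0; apply/eqP/II => u Iu.
by rewrite hornerD hornerN PQ // subrr.
Qed.

(** Polynomiality in each variable separately is enough to leave a box, since the variables are
    released one at a time. *)
Definition coord_polyfun (R : realType) (k : nat) (d : 'I_k -> nat)
    (F : (slot d -> R) -> R) : Prop :=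
  forall x s, polyfun (fun t => F (upd x s t)).

Section CoordPoly.
Variables (R : realType) (k : nat) (d : 'I_k -> nat).
Implicit Types F G : (slot d -> R) -> R.

Lemma box_extension F (I : slot d -> set R) :
  coord_polyfun F -> (forall s, infinite_many (I s)) ->
  (forall x, (forall s, I s (x s)) -> F x = 0) -> forall x, F x = 0.
Proof.
move=> FP II F0 x.
(* [l] lists the variables already released from their intervals. *)
suff H (l : seq (slot d)) : forall x, (forall s, s \notin l -> I s (x s)) -> F x = 0.
  by apply: (H (enum (slot d))) => s; rewrite mem_enum.
elim: l => [|s l IH] {}x hx; first by apply: F0 => s; exact: hx.
rewrite -(upd_id x s).
apply: (infinite_polyfun_eq (II s) (FP x s) (polyfunC 0)) => t It.
apply: IH => s' s'l; have [->|s's] := eqVneq s' s; first by rewrite upd_same.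
by rewrite upd_other //; apply: hx; rewrite inE negb_or s's.
Qed.

Lemma coord_polyfunC (c : R) : coord_polyfun (fun _ : slot d -> R => c).
Proof. by move=> x s; exact: polyfunC. Qed.

Lemma coord_polyfunD F G : coord_polyfun F -> coord_polyfun G ->
  coord_polyfun (fun x => F x + G x).
Proof. by move=> FP GP x s; apply: polyfunD; [exact: FP|exact: GP]. Qed.

Lemma coord_polyfunM F G : coord_polyfun F -> coord_polyfun G ->
  coord_polyfun (fun x => F x * G x).
Proof. by move=> FP GP x s; apply: polyfunM; [exact: FP|exact: GP]. Qed.

Lemma coord_polyfunX F n : coord_polyfun F -> coord_polyfun (fun x => F x ^+ n).
Proof. by move=> FP x s; apply: polyfunX; exact: FP. Qed.

Lemma coord_polyfunB F G : coord_polyfun F -> coord_polyfun G ->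
  coord_polyfun (fun x => F x - G x).
Proof. by move=> FP GP x s; apply: polyfunB; [exact: FP|exact: GP]. Qed.

Lemma coord_polyfun_horner (P : {poly R}) s : coord_polyfun (fun x : slot d -> R => P.[x s]).
Proof.
move=> x s'; have [->|ne] := eqVneq s s'.
  by apply: (polyfun_eq _ (polyfun_horner P)) => t; rewrite upd_same.
by apply: (polyfun_eq _ (polyfunC P.[x s])) => t; rewrite upd_other.
Qed.

Lemma coord_polyfun_bracket (P : pred 'I_k) (T : tensor R (slots d P)) :
  coord_polyfun (bracket T).
Proof.
move=> x s.
apply: (@polyfun_eq _ (fun t => bracket T (upd x s 0) + t * slope T s x)).
  by move=> t; rewrite -bracket_affine.
by apply: polyfunD; [exact: polyfunC|apply: polyfunM; [exact: polyfun_id|exact: polyfunC]].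
Qed.

Lemma coord_polyfun_slope (P : pred 'I_k) (T : tensor R (slots d P)) s :
  coord_polyfun (slope T s).
Proof.
move=> x s'; have [->|ne] := eqVneq s' s.
  by apply: (polyfun_eq _ (polyfunC (slope T s x))) => t; rewrite slope_upd.
apply: (@polyfun_eq _ (fun t => bracket T (upd (upd x s 1) s' t)
    - bracket T (upd (upd x s 0) s' t))).
  by move=> t; rewrite /slope !(upd_comm _ _ _ ne).
by apply: polyfunB; exact: coord_polyfun_bracket.
Qed.

End CoordPoly.

Lemma fden_neq0 (R : realType) (c : {fraction {poly R}}) : fden c != 0.
Proof. exact: denom_ratioP. Qed.

Lemma fnum_eq0 (R : realType) (c : {fraction {poly R}}) : fnum c = 0 -> c = 0.
Proof.
rewrite /fnum => n0; rewrite -[c]reprK -[RHS]tofrac0; unlock FracField.tofrac.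
apply/eqP; rewrite FracField.equivf_def.
by rewrite !numden_Ratio ?oner_neq0 // mulr1 mulr0 n0.
Qed.

(** The chosen representative of a polynomial need not have denominator 1; only this relation is
    available. *)
Lemma fnum_tofrac (R : realType) (P : {poly R}) :
  fnum (FracField.tofrac P) = P * fden (FracField.tofrac P).
Proof.
rewrite /fnum /fden; unlock FracField.tofrac.
have := FracField.equivf_l (Ratio P 1); rewrite !numden_Ratio ?oner_neq0 // mulr1.
by move=> ->; rewrite mulrC.
Qed.

Definition lin_indep_poly (R : realType) (k : nat) (d : 'I_k -> nat) (s : slot d)
    (n : nat) (F : n.-tuple ((slot d -> R) -> R)) : Prop :=
  forall c : 'I_n -> {poly R},
    (forall x : slot d -> R, \sum_(i < n) (c i).[x s] * tnth F i x = 0) ->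
    forall i, c i = 0.

(** Clearing denominators. *)
Lemma lin_indepP (R : realType) (k : nat) (d : 'I_k -> nat) (s : slot d)
    (n : nat) (F : n.-tuple ((slot d -> R) -> R)) :
  lin_indep s F <-> lin_indep_poly s F.
Proof.
split=> [H c c0 i|H c c0 i].
  have := H (fun i => FracField.tofrac (c i)) => /(_ _ i) H'.
  apply/eqP; rewrite -tofrac_eq0; apply/eqP/H' => x dn; rewrite -[RHS](c0 x).
  by apply: eq_bigr => j _; rewrite fnum_tofrac hornerM mulfK.
(* The product of all denominators is an additional factor: it makes the cleared relation trivial
   where a denominator vanishes, since nothing is assumed there. *)
pose c' i := fnum (c i) * (\prod_(j | j != i) fden (c j)) * \prod_j fden (c j).
suff /H/(_ i) : forall x, \sum_(i < n) (c' i).[x s] * tnth F i x = 0.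
  move=> /eqP; rewrite !mulf_eq0 => /orP[/orP[/eqP/fnum_eq0 //|]|].
    by move=> /prodf_eq0[j _]; rewrite (negPf (fden_neq0 _)).
  by move=> /prodf_eq0[j _]; rewrite (negPf (fden_neq0 _)).
move=> x; have [/forallP dn|] := boolP [forall i, (fden (c i)).[x s] != 0].
  rewrite -[RHS](mulr0 ((\prod_j (fden (c j)).[x s]) * (\prod_j (fden (c j)).[x s]))).
  rewrite -[X in _ = _ * X](c0 x dn) mulr_sumr; apply: eq_bigr => j _.
  rewrite !hornerM !horner_prod; set W := \prod_j0 _; set Wj := \prod_(j0 | _) _.
  have -> : W = (fden (c j)).[x s] * Wj by rewrite /W (bigD1 j).
  by field; exact: dn.
rewrite negb_forall => /existsP[j]; rewrite negbK => /eqP j0.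
rewrite big1 // => l _; rewrite !hornerM !horner_prod; set W := \prod_j0 _.
have -> : W = 0 by rewrite /W (bigD1 j) //= j0 mul0r.
by rewrite mulr0 mul0r.
Qed.

(** * The extremality equation in one variable *)

(** The jets are the product [f * P] and its first two derivatives by the Leibniz rule. At a fixed
    point they are constants, so that [jet_op] is quadratic in the bracket and its slope. *)
Definition jet0 (R : realType) (f : R -> R) (P : {poly R}) (t : R) : R := f t * P.[t].

Definition jet1 (R : realType) (f : R -> R) (P : {poly R}) (t : R) : R :=
  derive1 f t * P.[t] + f t * P^`().[t].

Definition jet2 (R : realType) (f : R -> R) (P : {poly R}) (t : R) : R :=
  derive1n 2 f t * P.[t] + 2 * derive1 f t * P^`().[t] + f t * P^`()^`().[t].

Definition jet_op (R : realType) (b b1 M : R) (f : R -> R) (P : {poly R}) (t : R) : R :=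
  weighted_op b b1 M (jet0 f P t) (jet1 f P t) (jet2 f P t).

Section Jets.
Variables (R : realType) (I : set R) (f : R -> R) (f_smooth : smooth_on I f).
Variable P : {poly R}.

Lemma jet0_deriv : deriv_on I (jet0 f P) (jet1 f P).
Proof. exact: deriv_onM (smooth_deriv_on 0 f_smooth) (deriv_on_horner (I:=I) P). Qed.

Lemma jet1_deriv : deriv_on I (jet1 f P) (jet2 f P).
Proof.
have d0 := smooth_deriv_on 0 f_smooth.
have d1 := smooth_deriv_on 1 f_smooth.
have := deriv_onD (deriv_onM d1 (deriv_on_horner (I:=I) P))
  (deriv_onM d0 (deriv_on_horner (I:=I) P^`())).
apply: deriv_on_eqr => t It; rewrite /jet2 /=; ring.
Qed.

Lemma jet2_Cn n : Cn_on I n (jet2 f P).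
Proof.
apply: Cn_onD; last by apply: Cn_onM; [exact: (smooth_Cn 0)|exact: Cn_on_horner].
apply: Cn_onD; first by apply: Cn_onM; [exact: (smooth_Cn 2)|exact: Cn_on_horner].
apply: Cn_onM; last exact: Cn_on_horner.
apply: Cn_onM; last exact: (smooth_Cn 1).
have := Cn_on_horner I n (2%:P : {poly R}).
by have -> : horner (2%:P : {poly R}) = (fun=> 2) by apply/funext => t; rewrite hornerC.
Qed.

End Jets.

Lemma jet_opZ (R : realType) (b b1 M : R) (f : R -> R) (c : R) (P : {poly R}) t :
  jet_op b b1 M f (c *: P) t = c * jet_op b b1 M f P t.
Proof. by rewrite /jet_op /weighted_op /jet0 /jet1 /jet2 !derivZ !hornerZ; ring. Qed.

Lemma polyfun_jet_op (R : realType) (b b1 : R -> R) (M : R) (f : R -> R) (P : {poly R}) u :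
  polyfun b -> polyfun b1 -> polyfun (fun t => jet_op (b t) (b1 t) M f P u).
Proof.
move=> bP b1P; rewrite /jet_op /weighted_op.
apply: polyfunD; first apply: polyfunB.
- by apply: polyfunM; [exact: polyfunX|exact: polyfunC].
- apply: polyfunM; last exact: polyfunC.
  apply: polyfunM => //; apply: polyfunM => //; exact: polyfunC.
- apply: polyfunM; last exact: polyfunC.
  by apply: polyfunM; [exact: polyfunC|exact: polyfunX].
Qed.

Lemma sum_slots_at (R : realType) (k : nat) (d : 'I_k -> nat) (p : 'I_k) (q : 'I_(d p))
    (F : slot d -> R) :
  \sum_s F s = F (Slot q) + \sum_(r < d p | r != q) F (Slot r)
               + \sum_(s | tag s != p) F s.
Proof.
rewrite (bigID (fun s : slot d => tag s == p)) /=; congr (_ + _).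
rewrite (reindex (fun r : 'I_(d p) => Slot r)) /=.
  by under eq_bigl do rewrite eqxx; rewrite (bigD1 q).
exists (fun s : slot d => if insub (nat_of_ord (tagged s)) is Some r' then r' else q).
  by move=> r' _; rewrite /= valK.
move=> [i' r']; rewrite inE /= => /eqP E; subst i'.
by rewrite valK.
Qed.

Definition denom_poly (R : realType) (k : nat) (d : 'I_k -> nat) (p : 'I_k)
    (e : 'I_k -> R * R) : {poly R} :=
  \prod_(j < k | j != p) ((e j).2 *: 'X + (e j).1%:P) ^+ d j.

Lemma horner_line (R : realType) (e : R * R) t : (e.2 *: 'X + e.1%:P).[t] = line e t.
Proof. by rewrite /line !hornerE addrC mulrC. Qed.

Lemma horner_denom_poly (R : realType) (k : nat) (d : 'I_k -> nat) (p : 'I_k)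
    (e : 'I_k -> R * R) t : (denom_poly d p e).[t] = denominator d p e t.
Proof.
rewrite /denom_poly /denominator horner_prod; apply: eq_bigr => j _.
by rewrite horner_exp horner_line.
Qed.

Section Equation.
Variables (R : realType) (k : nat) (d : 'I_k -> nat) (d_gt0 : forall j, (0 < d j)%N).
Variables (Gamma : gammas R d) (p : 'I_k) (e : 'I_k -> R * R).
Variables (hp : decomposes Gamma p e) (beta : Vdual R d).
Variables (beta_h : beta \in hspace Gamma).

Definition hat_poly (s : slot d) (x : slot d -> R) : {poly R} :=
  \prod_(j < k) (slope (Gamma j) s x *: 'X + (bracket (Gamma j) (upd x s 0))%:P) ^+ d j.

Lemma horner_hat_poly s x u : (hat_poly s x).[u] = hatprod Gamma (upd x s u).
Proof.
rewrite /hat_poly /hatprod horner_prod; apply: eq_bigr => j _.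
by rewrite horner_exp [in RHS]bracket_affine !hornerE addrC [u * _]mulrC.
Qed.

(** [hatprod] is the denominator at x_q times a factor free of x_q. Dividing by the value at [x]
    cancels the former, so for a slot other than q this polynomial does not depend on x_q. *)
Definition hat_ratio (s : slot d) (x : slot d -> R) : {poly R} :=
  (hatprod Gamma x)^-1 *: hat_poly s x.

Lemma hatprod_neq0 x : nonsingular Gamma beta x -> hatprod Gamma x != 0.
Proof. by move=> [_ g0 _]; apply/prodf_neq0 => j _; rewrite expf_neq0. Qed.

Lemma gamma_factor_at (q : 'I_(d p)) j : j != p ->
  exists2 g : (slot d -> R) -> R,
    forall x, bracket (Gamma j) x = line (e j) (x (Slot q)) * g x &
    forall x t, g (upd x (Slot q) t) = g x.
Proof.
move=> jp; have [G GE Gy] := gamma_factor hp jp.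
exists (fun x => (\prod_(r | r != q) line (e j) (x (Slot r))) * G x) => [x|x t].
  by rewrite GE (bigD1 q) //= mulrA.
rewrite (Gy _ x); first congr (_ * _).
  by apply: eq_bigr => r rq; rewrite upd_other // Slot_eq.
by move=> s sp; rewrite upd_other //; apply: contraNneq sp => ->.
Qed.

Lemma gamma_p_upd (q : 'I_(d p)) x t :
  bracket (Gamma p) (upd x (Slot q) t) = bracket (Gamma p) x.
Proof.
apply: gamma_p_absent => s sp; rewrite upd_other //.
by apply: contraNneq sp => ->.
Qed.

Lemma hatprod_factor_at (q : 'I_(d p)) :
  exists2 h : (slot d -> R) -> R,
    forall x, hatprod Gamma x = denominator d p e (x (Slot q)) * h x &
    forall x t, h (upd x (Slot q) t) = h x.
Proof.
have /choice[g gP] j : exists g : (slot d -> R) -> R, j != p ->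
    (forall x, bracket (Gamma j) x = line (e j) (x (Slot q)) * g x) /\
    (forall x t, g (upd x (Slot q) t) = g x).
  have [->|/(gamma_factor_at q)[g gE gy]] := eqVneq j p; first by exists (fun=> 0).
  by exists g.
exists (fun x => bracket (Gamma p) x ^+ d p * \prod_(j | j != p) g j x ^+ d j) => [x|x t].
  rewrite /hatprod (bigD1 p) //= mulrCA; congr (_ * _).
  rewrite /denominator -big_split /=; apply: eq_bigr => j jp.
  by rewrite -exprMn -(gP j jp).1.
rewrite gamma_p_upd; congr (_ * _); apply: eq_bigr => j jp.
by rewrite (gP j jp).2.
Qed.

Lemma hat_ratio_upd (q : 'I_(d p)) s x t : s != Slot q ->
  hatprod Gamma x != 0 -> hatprod Gamma (upd x (Slot q) t) != 0 ->
  hat_ratio s (upd x (Slot q) t) = hat_ratio s x.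
Proof.
move=> sq; have [h hE hy] := hatprod_factor_at q.
have h0 y : hatprod Gamma y != 0 -> denominator d p e (y (Slot q)) != 0 /\ h y != 0.
  by rewrite hE mulf_eq0 negb_or => /andP.
move=> /h0[Dx hx] /h0[Dt _]; rewrite upd_same in Dt.
apply: (infinite_poly_eq (I := setT)).
  by apply: open_interval_infinite; split; [exact: openT| |exists 0].
move=> u _; rewrite /hat_ratio !hornerZ !horner_hat_poly !hE.
rewrite (upd_comm x t u) 1?eq_sym // !upd_same !hy.
by rewrite (@upd_other _ _ _ _ s) 1?eq_sym //; field; rewrite Dx Dt hx.
Qed.

Lemma hat_ratio_Slot (q : 'I_(d p)) x : hatprod Gamma x != 0 ->
  hat_ratio (Slot q) x = (denominator d p e (x (Slot q)))^-1 *: denom_poly d p e.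
Proof.
have [h hE hy] := hatprod_factor_at q; rewrite hE mulf_eq0 negb_or => /andP[Dx hx].
apply: (infinite_poly_eq (I := setT)).
  by apply: open_interval_infinite; split; [exact: openT| |exists 0].
move=> u _; rewrite /hat_ratio !hornerZ horner_hat_poly horner_denom_poly !hE.
by rewrite upd_same hy; field; rewrite Dx hx.
Qed.

Variables (I : slot d -> set R) (A : slot d -> R -> R).
Hypothesis hA : extremal_solution Gamma beta I A.

Let M : R := (msize d + 1)%:R.

Lemma box_upd x s t : (forall s, I s (x s)) -> I s t ->
  forall s', I s' (upd x s t s').
Proof.
move=> bx It s'; have [->|ne] := eqVneq s' s; first by rewrite upd_same.
by rewrite upd_other.
Qed.

(** Two derivatives of A H / B^(m+1) produce the denominator B^(m+3), which the prefactor cancels;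
    its factor 1 / H turns [hat_poly] into [hat_ratio]. *)
Lemma weighted_term s x : (forall s, I s (x s)) ->
  prefactor Gamma beta s x *
    derive1n 2 (fun t => A s t * weight Gamma beta (upd x s t)) (x s) =
  jet_op (bracket beta x) (slope beta s x) M (A s) (hat_ratio s x) (x s)
  / (Delta s x * bracket (Gamma (tag s)) x).
Proof.
case: hA => hI hsm hN _ bx; have [oI _ _] := hI s; have [sA _] := hsm s.
have Nx := hN x bx; have H0 := hatprod_neq0 Nx; have [D0 g0 b0] := Nx.
have -> : (fun t => A s t * weight Gamma beta (upd x s t)) =
   (fun t => jet0 (A s) (hat_poly s x) t
             / (bracket beta (upd x s 0) + slope beta s x * t) ^+ (msize d + 1)).
  apply/funext => t; rewrite /weight /jet0 horner_hat_poly bracket_affine.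
  by rewrite mulrA [t * _]mulrC.
rewrite (derive1n2_weighted (msize d + 1) oI _ (jet0_deriv sA _) (jet1_deriv sA _) (bx s)); last first.
  move=> t It; rewrite [_ * t]mulrC -bracket_affine.
  by have [_ _] := hN _ (box_upd bx It).
rewrite [_ * x s]mulrC -bracket_affine upd_id -/M.
rewrite -/(jet_op (bracket beta x) (slope beta s x) M (A s) (hat_poly s x) (x s)).
rewrite /prefactor /hat_ratio jet_opZ; set J := jet_op _ _ _ _ _ _.
have -> : (msize d + 3 = (msize d + 1).+2)%N by rewrite !addnS.
field; rewrite ?H0 ?D0 ?g0 ?expf_neq0 ?b0 //.
Qed.

End Equation.

Section Master.
Variables (R : realType) (k : nat) (d : 'I_k -> nat) (d_gt0 : forall j, (0 < d j)%N).
Variables (Gamma : gammas R d) (p : 'I_k) (e : 'I_k -> R * R).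
Variables (hp : decomposes Gamma p e) (beta : Vdual R d).
Variables (beta_h : beta \in hspace Gamma).
Variables (I : slot d -> set R) (A : slot d -> R -> R).
Hypothesis hA : extremal_solution Gamma beta I A.

Let M : R := (msize d + 1)%:R.

Definition slot_op (q : 'I_(d p)) (x : slot d -> R) (t : R) : R :=
  jet_op (bracket beta (upd x (Slot q) t)) (slope beta (Slot q) x) M
    (A (Slot q)) (denom_poly d p e) t.

(** The term of slot [s] at x_q = t. Only the bracket and the slope of beta involve [t]; the jets of
    A_s stay frozen at [x]. *)
Let other_op (q : 'I_(d p)) (s : slot d) (x : slot d -> R) (t : R) : R :=
  jet_op (bracket beta (upd x (Slot q) t)) (slope beta s (upd x (Slot q) t)) M
    (A s) (hat_ratio Gamma s x) (x s).

Lemma polyfun_other_op q s x : polyfun (other_op q s x).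
Proof.
apply: polyfun_jet_op; first exact: coord_polyfun_bracket.
exact: coord_polyfun_slope.
Qed.

Lemma denominator_neq0 (q : 'I_(d p)) x : (forall s, I s (x s)) ->
  denominator d p e (x (Slot q)) != 0.
Proof.
case: hA => _ _ hN _ /hN/hatprod_neq0.
by have [h -> _] := hatprod_factor_at hp q; rewrite mulf_eq0 negb_or => /andP[].
Qed.

Lemma jet_op_Slot (q : 'I_(d p)) x t : (forall s, I s (x s)) -> I (Slot q) t ->
  jet_op (bracket beta (upd x (Slot q) t)) (slope beta (Slot q) (upd x (Slot q) t)) M
    (A (Slot q)) (hat_ratio Gamma (Slot q) (upd x (Slot q) t)) t =
  slot_op q x t / denominator d p e t.
Proof.
case: hA => hI hsm hN _ bx It; have bt := box_upd bx It.
rewrite (hat_ratio_Slot hp) ?(hatprod_neq0 (hN _ bt)) //.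
by rewrite jet_opZ upd_same slope_upd mulrC.
Qed.

(** Isolates the dependence on [t]: the bracket of Gamma_p, the [Delta] of slots outside the group
    and the ratios [hat_ratio] of the other slots do not involve x_q. *)
Lemma equation_at (q : 'I_(d p)) : exists2 alpha : Vdual R d, alpha \in hspace Gamma &
  forall x t, (forall s, I s (x s)) -> I (Slot q) t ->
  let y := upd x (Slot q) t in
  slot_op q x t / (denominator d p e t * Delta (Slot q) y * bracket (Gamma p) x)
  + \sum_(r < d p | r != q)
      other_op q (Slot r) x t / (Delta (Slot r) y * bracket (Gamma p) x)
  + \sum_(s | tag s != p) other_op q s x t / (Delta s x * bracket (Gamma (tag s)) y)
  = bracket alpha y.
Proof.
have [hI hsm hN [alpha alpha_h hE]] := hA; exists alpha => // x t bx It y.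
have bt : forall s, I s (y s) by exact: box_upd.
have Nx := hN x bx; have Ny := hN y bt.
rewrite -(hE y bt) extremal_lhsE (sum_slots_at q); congr (_ + _ + _).
- rewrite (weighted_term hA) // [y (Slot q)]upd_same jet_op_Slot // /= gamma_p_upd.
  by rewrite -[RHS]mulrA -invfM mulrA.
- apply: eq_bigr => r rq; rewrite (weighted_term hA) // /= gamma_p_upd.
  rewrite (hat_ratio_upd hp) ?Slot_eq ?hatprod_neq0 //; [|exact: hatprod_neq0 Nx|exact: hatprod_neq0 Ny].
  by rewrite [y (Slot r)]upd_other ?Slot_eq.
apply: eq_bigr => s sp; rewrite (weighted_term hA) //.
have sq : s != Slot q by apply: contraNneq sp => ->.
rewrite (hat_ratio_upd hp) //; [|exact: hatprod_neq0 Nx|exact: hatprod_neq0 Ny].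
rewrite [y s]upd_other //; congr (_ / (_ * _)).
rewrite !DeltaE [y s]upd_other //; apply: eq_bigr => s' /andP[/eqP ss' _].
by rewrite [y s']upd_other //; apply: contraNneq sp => E; rewrite -ss' E.
Qed.

Lemma slope_diag (q r : 'I_(d p)) y : y (Slot q) = y (Slot r) ->
  slope beta (Slot r) y = slope beta (Slot q) y.
Proof.
move=> yqr; rewrite /slope; suff E u : bracket beta (upd y (Slot r) u) =
  bracket beta (upd y (Slot q) u) by rewrite !E.
have ys : y \o swap q r = y.
  by apply/funext => s; rewrite /= /swap; case: tpermP => [->|->|].
by rewrite -[RHS](hspace_swap hp q r _ beta_h) -[in LHS]ys upd_swap swap_Slot tpermR.
Qed.

(** Multiplying by all factors of the denominators that contain x_q leaves polynomials in x_q. At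
    x_q = x_r the term of slot r is the only one without a vanishing factor, and the symmetry of
    beta identifies its slope with that of q. *)
Lemma master (q : 'I_(d p)) x : (forall s, I s (x s)) ->
  exists2 Q : {poly R},
    forall t, I (Slot q) t -> slot_op q x t = Q.[t] &
    forall r, r != q -> Q.[x (Slot r)] =
      jet_op (bracket beta (upd x (Slot q) (x (Slot r)))) (slope beta (Slot q) x) M
        (A (Slot r)) (denom_poly d p e) (x (Slot r)).
Proof.
move=> bx; have [alpha _ hE] := equation_at q.
have [hI hsm hN _] := hA.
have /choice[g gP] j : exists g : (slot d -> R) -> R, j != p ->
    (forall x, bracket (Gamma j) x = line (e j) (x (Slot q)) * g x) /\
    (forall x t, g (upd x (Slot q) t) = g x).
  have [->|/(gamma_factor_at hp q)[g gE gy]] := eqVneq j p; first by exists (fun=> 0).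
  by exists g.
(* [Dr r] is [Delta] of slot r without the factor from q; [Dl j] is the denominator divided by one
   line of e_j, which is possible as d_j > 0. *)
pose Dr r t := \prod_(r' < d p | (r' != q) && (r' != r)) (t - x (Slot r')).
pose Dl j t := line (e j) t ^+ (d j - 1) * \prod_(l | (l != p) && (l != j)) line (e l) t ^+ d l.
have DlE j t : j != p -> denominator d p e t = line (e j) t * Dl j t.
  by move=> jp; rewrite /denominator (bigD1 j) //= mulrA -exprS subn1 prednK.
pose gp := bracket (Gamma p) x.
pose Dq t := \prod_(r < d p | r != q) (t - x (Slot r)).
have DqE r t : r != q -> Dq t = (t - x (Slot r)) * Dr r t.
  by move=> rq; rewrite /Dq (bigD1 r).
(* The equation solved for [slot_op]. The second sum has a plus sign because (t - x_r) / (x_r - t) =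
   -1. *)
pose F t := gp * Dq t * denominator d p e t * bracket alpha (upd x (Slot q) t)
   + \sum_(r < d p | r != q)
        denominator d p e t * Dr r t / Dr r (x (Slot r)) * other_op q (Slot r) x t
   - \sum_(s | tag s != p) gp * Dq t * Dl (tag s) t / (Delta s x * g (tag s) x)
        * other_op q s x t.
have lineP j : polyfun (line (e j)).
  by apply: polyfunD; [exact: polyfunC|apply: polyfunM; [exact: polyfun_id|exact: polyfunC]].
have denP : polyfun (denominator d p e).
  by apply: polyfun_prod => j _; exact: polyfunX.
have DqP : polyfun Dq.
  by apply: polyfun_prod => r _; apply: polyfunB; [exact: polyfun_id|exact: polyfunC].
have [Q QE] : polyfun F.
  apply: polyfunB; first apply: polyfunD.
  - apply: polyfunM; last exact: coord_polyfun_bracket.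
    by apply: polyfunM => //; apply: polyfunM => //; exact: polyfunC.
  - apply: polyfun_sum => r _; apply: polyfunM; last exact: polyfun_other_op.
    apply: polyfunM; last exact: polyfunC.
    apply: polyfunM => //; apply: polyfun_prod => r' _.
    by apply: polyfunB; [exact: polyfun_id|exact: polyfunC].
  apply: polyfun_sum => s _; apply: polyfunM; last exact: polyfun_other_op.
  apply: polyfunM; last exact: polyfunC.
  apply: polyfunM; first by apply: polyfunM => //; exact: polyfunC.
  apply: polyfunM; first exact: polyfunX.
  by apply: polyfun_prod => j _; exact: polyfunX.
have [D0 g0 b0] := hN x bx.
have Drx r : r != q -> Dr r (x (Slot r)) != 0.
  move=> rq; have qr : q != r by rewrite eq_sym.
  have := D0 (Slot r); rewrite /Delta /= (bigD1 q) //=.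
  rewrite mulf_eq0 negb_or => /andP[_]; apply: contra => /eqP E; apply/eqP; rewrite -[RHS]E.
  by apply: eq_bigl => r'; rewrite andbC.
exists Q => [t It|r rq]; rewrite -QE /F.
  have bt := box_upd bx It; have [Dt gt bb] := hN _ bt.
  have Dn : denominator d p e t != 0.
    by have := denominator_neq0 q bt; rewrite upd_same.
  have DqyE : Delta (Slot q) (upd x (Slot q) t) = Dq t.
    rewrite /Delta /Dq /= upd_same; apply: eq_bigr => r rq.
    by rewrite upd_other // Slot_eq.
  have Dq0 : Dq t != 0 by rewrite -DqyE.
  have DryE r : r != q -> Delta (Slot r) (upd x (Slot q) t) =
      (x (Slot r) - t) * Dr r (x (Slot r)).
    move=> rq; have qr : q != r by rewrite eq_sym.
    rewrite /Delta /= (bigD1 q) //= upd_same upd_other ?Slot_eq //.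
    congr (_ * _); apply: eq_big => [r'|r' /andP[_ r'q]]; first by rewrite andbC.
    by rewrite upd_other // Slot_eq.
  have := hE x t bx It; rewrite /= DqyE -/gp.
  set S1 := \sum_(r < d p | _) _; set S2 := \sum_(s | _) _ => E.
  have gp0 : gp != 0 by exact: g0.
  have -> : slot_op q x t = gp * Dq t * denominator d p e t *
      (bracket alpha (upd x (Slot q) t) - S1 - S2).
    by rewrite -E; field; rewrite Dn Dq0 gp0.
  rewrite !mulrBr; congr (_ + _ - _).
    rewrite /S1 mulr_sumr -sumrN; apply: eq_bigr => r rq.
    have : Delta (Slot r) (upd x (Slot q) t) != 0 by [].
    rewrite DryE // mulf_eq0 negb_or => /andP[xt _].
    by rewrite (DqE r) //; field; rewrite gp0 Drx.
  rewrite /S2 mulr_sumr; apply: eq_bigr => s sp.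
  have [gE gy] := gP _ sp.
  have := gt (tag s); rewrite gE gy upd_same mulf_eq0 negb_or => /andP[l0 gs0].
  by rewrite (DlE (tag s)) //; field; rewrite gs0 l0 D0.
(* [Dq] removes the right-hand side and the other groups; among the slots r' of the group, [Dr r']
   contains t - x_r unless r' = r. *)
have Dq0 : Dq (x (Slot r)) = 0 by rewrite (DqE r) // subrr mul0r.
rewrite Dq0 mulr0 !mul0r add0r [X in _ - X]big1 ?subr0 => [|s _]; last by rewrite !mul0r.
rewrite (bigD1 r) //= big1 ?addr0 => [|r' /andP[r'q r'r]]; last first.
  have rr' : r != r' by rewrite eq_sym.
  by rewrite [Dr r' _](bigD1 r) /= ?rq // subrr mul0r mulr0 !mul0r.
rewrite -mulrA mulrA mulfK ?Drx //.
rewrite /other_op (hat_ratio_Slot hp) ?(hatprod_neq0 (hN _ bx)) // jet_opZ mulrA.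
rewrite mulfV ?(denominator_neq0 r bx) // mul1r (slope_diag (q := q)) ?slope_upd //.
by rewrite upd_same upd_other // Slot_eq.
Qed.

End Master.

(** * Degree in x_q of the multiplied equation *)

Lemma leibniz2 (R : realType) (I : set R) (f w : R -> R) t :
  open I -> smooth_on I f -> Cn_on I 2 w -> I t ->
  derive1n 2 (fun u => f u * w u) t =
  derive1n 2 f t * w t + derive1 f t * (2 * derive1 w t) + f t * derive1n 2 w t.
Proof.
move=> oI sf [w1 ww1 [w2 ww2 _]] It.
have d0 := smooth_deriv_on 0 sf; have d1 := smooth_deriv_on 1 sf.
rewrite (derive1n2_on oI (deriv_onM d0 ww1)
  (deriv_onD (deriv_onM d1 ww1) (deriv_onM d0 ww2)) It).
by rewrite (deriv_onE ww1) // (derive1n2_on oI ww1 ww2 It) /=; ring.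
Qed.

Section Degree.
Variables (R : realType) (k : nat) (d : 'I_k -> nat).
Variables (Gamma : gammas R d) (p : 'I_k) (e : 'I_k -> R * R).
Variables (hp : decomposes Gamma p e) (beta : Vdual R d).
Variables (I : slot d -> set R) (A : slot d -> R -> R).
Hypothesis hA : extremal_solution Gamma beta I A.

Lemma weight_Cn s x n : (forall s, I s (x s)) ->
  Cn_on (I s) n (fun t => weight Gamma beta (upd x s t)).
Proof.
case: hA => hI hsm hN _ bx.
have -> : (fun t => weight Gamma beta (upd x s t)) =
   (fun t => (hat_poly Gamma s x).[t] *
     ((bracket beta (upd x s 0) + slope beta s x * t) ^+ (msize d + 1))^-1).
  apply/funext => t; rewrite /weight horner_hat_poly bracket_affine.
  by rewrite [t * _]mulrC.
apply: Cn_onM; first exact: Cn_on_horner.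
have bn t : I s t -> bracket beta (upd x s 0) + slope beta s x * t != 0.
  by move=> It; rewrite mulrC -bracket_affine; have [] := hN _ (box_upd bx It).
move: (msize d + 1)%N; elim: n => // n IH N.
eexists; first exact: deriv_on_affineXV.
apply: Cn_onM; last exact: IH.
by have := Cn_on_horner (I s) n (- N%:R * slope beta s x)%:P; rewrite hornerC_ext.
Qed.

Lemma slot_op_degree Mf (q : 'I_(d p)) l x : degrees_le Gamma beta Mf (Slot q) l ->
  (forall s, I s (x s)) ->
  exists2 P : {poly R}, (size P <= l.+1)%N & forall t, I (Slot q) t ->
    let y := upd x (Slot q) t in
    Mf y * (slot_op e beta A q x t /
            (denominator d p e t * Delta (Slot q) y * bracket (Gamma p) x)) = P.[t].
Proof.
move=> [hc hr] bx; have [hI hsm hN [alpha alpha_h hE]] := hA.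
have [Pa Pas PaE] := hr alpha alpha_h x.
have /choice[Pc PcP] (sn : slot d * 'I_3) : exists P : {poly R}, sn.1 != Slot q ->
    (size P <= l.+1)%N /\ forall t, nonsingular Gamma beta (upd x (Slot q) t) ->
      coefficient Gamma beta Mf sn.1 sn.2 (upd x (Slot q) t) = P.[t].
  have [->|sq] := eqVneq sn.1 (Slot q); first by exists 0.
  by have [P Ps PE] := hc sn.1 sn.2 sq (ltn_ord sn.2) x; exists P.
exists (Pa - \sum_(s | s != Slot q) \sum_(n < 3) derive1n n (A s) (x s) *: Pc (s, n)).
  rewrite (leq_trans (size_polyD _ _)) // geq_max Pas size_polyN /=.
  apply: (leq_trans (size_sum _ _ _)); apply/bigmax_leqP => s sq.
  apply: (leq_trans (size_sum _ _ _)); apply/bigmax_leqP => n _.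
  by have [Ps _] := PcP (s, n) sq; exact: leq_trans (size_scale_leq _ _) Ps.
move=> t It y; have bt : forall s, I s (y s) by exact: box_upd.
have Ny := hN y bt.
rewrite hornerD hornerN -PaE // -/y -hE // extremal_lhsE (bigD1 (Slot q)) //= mulrDr.
have -> : Mf y * (prefactor Gamma beta (Slot q) y *
   derive1n 2 (fun u => A (Slot q) u * weight Gamma beta (upd y (Slot q) u)) (y (Slot q))) =
   Mf y * (slot_op e beta A q x t /
            (denominator d p e t * Delta (Slot q) y * bracket (Gamma p) x)).
  rewrite (weighted_term hA) // [y (Slot q)]upd_same (jet_op_Slot hp hA) //= gamma_p_upd.
  by apply: (congr1 (fun z => Mf y * z)); rewrite !invfM !mulrA.
rewrite -[LHS]addr0 -addrA; congr (_ + _); apply/esym/eqP; rewrite subr_eq0; apply/eqP.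
rewrite horner_sum mulr_sumr; apply: eq_bigr => s sq.
have [oI _ _] := hI s; have [sA _] := hsm s.
have ys : y s = x s by rewrite /y upd_other.
have := leibniz2 oI sA (weight_Cn s 2 bt) (bt s); rewrite /derive1n /= => ->.
rewrite horner_sum.
rewrite !big_ord_recl big_ord0 addr0 !hornerZ.
have PE (n : 'I_3) := (PcP (s, n) sq).2 t Ny.
rewrite -!PE -/y /coefficient !(iter_partial s) !ys /derive1n /= /bump /=.
rewrite -ys upd_id ys !addn0 bin0 bin1 binn.
set c0 := prefactor _ _ _ _; set c1 := weight _ _ y.
set c2 := derive1 _ (x s); set c3 := derive1 _ (x s); set c4 := derive1 _ (x s).
set c5 := derive1 _ (x s); rewrite -/c0; clearbody c0 c1 c2 c3 c4 c5; ring.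
Qed.

End Degree.

(** * Numerators of the solutions *)

Definition poly_op (R : realType) (b b1 M : R) (N : {poly R}) (t : R) : R :=
  weighted_op b b1 M N.[t] N^`().[t] N^`()^`().[t].

Lemma poly_opB (R : realType) (b b1 M : R) (N N' : {poly R}) t :
  poly_op b b1 M (N - N') t = poly_op b b1 M N t - poly_op b b1 M N' t.
Proof. by rewrite /poly_op /weighted_op !derivB !hornerD !hornerN; ring. Qed.

Lemma jet_op_poly (R : realType) (I : set R) (f : R -> R) (P N : {poly R}) b b1 M t :
  open I -> smooth_on I f -> (forall t, I t -> f t * P.[t] = N.[t]) -> I t ->
  jet_op b b1 M f P t = poly_op b b1 M N t.
Proof.
move=> oI sf fN It; rewrite /jet_op /poly_op.
have E1 u : I u -> jet1 f P u = N^`().[u].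
  move=> Iu; apply: (deriv_on_uniq (I := I) (f := horner N)) => //.
    exact: deriv_on_eq fN (jet0_deriv sf P).
  exact: deriv_on_horner.
have E2 u : I u -> jet2 f P u = N^`()^`().[u].
  move=> Iu; apply: (deriv_on_uniq (I := I) (f := horner N^`())) => //.
    exact: deriv_on_eq E1 (jet1_deriv sf P).
  exact: deriv_on_horner.
by rewrite /jet0 fN // E1 // E2.
Qed.

Lemma partial_bracket (R : realType) (k : nat) (d : 'I_k -> nat) (P : pred 'I_k)
    (T : tensor R (slots d P)) s : partial s (bracket T) = slope T s.
Proof.
apply/funext => x; rewrite /partial.
have -> : (fun t => bracket T (upd x s t)) =
    (fun t => bracket T (upd x s 0) + slope T s x * t).
  by apply/funext => t; rewrite bracket_affine mulrC.
exact: (deriv_onE (I := setT) (@deriv_on_affine _ _ _ _)).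
Qed.

(** The coefficients of [b0^2], [b0 b1] and [b1^2] in [poly_op] for the affine
    function [b0 + b1 t]. *)
Definition op_coef (R : realType) (M : R) (N : {poly R}) (i : 'I_3) : {poly R} :=
  match val i with
  | 0%N => N^`()^`()
  | 1%N => 2 *: ('X * N^`()^`()) - (2 * M) *: N^`()
  | _ => 'X * ('X * N^`()^`()) - (2 * M) *: ('X * N^`()) + (M * (M + 1)) *: N
  end.

Lemma poly_op_coef (R : realType) (b0 b1 M : R) (N : {poly R}) t :
  poly_op (b0 + t * b1) b1 M N t =
  (b0 ^+ 2 *: op_coef M N (@Ordinal 3 0 isT) + (b0 * b1) *: op_coef M N (@Ordinal 3 1 isT)
   + b1 ^+ 2 *: op_coef M N (@Ordinal 3 2 isT)).[t].
Proof. by rewrite /poly_op /weighted_op /op_coef /= !hornerE /=; ring. Qed.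

(** The coefficient of b1^2 acts diagonally on powers of t, with eigenvalue n(n-1) - 2Mn + M(M+1) =
    (n-M)(n-M-1). *)
Lemma coef_op_coef (R : realType) (M : R) (N : {poly R}) n :
  [/\ (op_coef M N (@Ordinal 3 0 isT))`_n = N`_n.+2 *+ n.+2 *+ n.+1,
      (op_coef M N (@Ordinal 3 1 isT))`_n = 2 * (n%:R - M) * (N`_n.+1 *+ n.+1) &
      (op_coef M N (@Ordinal 3 2 isT))`_n = (n%:R - M) * (n%:R - M - 1) * N`_n].
Proof.
rewrite /op_coef /=; split.
- by rewrite !coef_deriv.
- rewrite coefB !coefZ coefXM !coef_deriv; case: n => [|n] /=; first by ring.
  ring.
rewrite coefD coefB !coefZ !coefXM !coef_deriv; case: n => [|[|n]] /=; rewrite ?coef_deriv; ring.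
Qed.

(** The operator kills only the powers [M] and [M + 1] of [t], and for these the
    coefficients of [b0 b1] and [b0^2] are not killed. *)
Lemma size_from_op_coef (R : realType) (m l : nat) (N : {poly R}) : (l < m)%N ->
  (forall i, (size (op_coef m.+1%:R N i) <= l.+1)%N) -> (size N <= l.+1)%N.
Proof.
move=> lm H; rewrite leqNgt; apply/negP => lN.
have [n nE] : exists n, size N = n.+1 by exists (size N).-1; rewrite prednK // (leq_trans _ lN).
have ln : (l < n)%N by rewrite nE in lN.
have Nn : N`_n != 0 by have := lead_coef_eq0 N; rewrite /lead_coef nE => ->; rewrite -size_poly_eq0 nE.
have c0 (i : 'I_3) a : (l < a)%N -> (op_coef m.+1%:R N i)`_a = 0.
  by move=> la; rewrite nth_default // (leq_trans (H i)).
have := c0 (@Ordinal 3 2 isT) n ln; have [_ _ ->] := coef_op_coef m.+1%:R N n.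
have -> : n%:R - m.+1%:R - 1 = n%:R - m.+2%:R :> R by rewrite -[m.+2%:R]natr1; ring.
(* Each exceptional degree, m + 1 or m + 2, leaves a nonzero coefficient at index [m]; this
   contradicts the bounds because [l < m]. *)
move=> /eqP; rewrite !mulf_eq0 (negPf Nn) orbF !subr_eq0 !eqr_nat => /orP[/eqP nm|/eqP nm].
  have := c0 (@Ordinal 3 1 isT) m lm; have [_ -> _] := coef_op_coef m.+1%:R N m.
  move=> /eqP; rewrite nm in Nn; rewrite !mulf_eq0 !mulrn_eq0 oner_eq0 (negPf Nn) /=.
  by rewrite orbF subr_eq0 eqr_nat eq_sym (gtn_eqF (ltnSn m)).
have := c0 (@Ordinal 3 0 isT) m lm; have [-> _ _] := coef_op_coef m.+1%:R N m.
by move=> /eqP; rewrite nm in Nn; rewrite !mulrn_eq0 (negPf Nn).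
Qed.

Section Solutions.
Variables (R : realType) (k : nat) (d : 'I_k -> nat) (d_gt0 : forall j, (0 < d j)%N).
Variables (Gamma : gammas R d) (p : 'I_k) (e : 'I_k -> R * R).
Variables (hp : decomposes Gamma p e) (beta : Vdual R d).
Variables (beta_h : beta \in hspace Gamma).

Let M : R := (msize d).+1%:R.

Definition slot_numerator (I : slot d -> set R) (A : slot d -> R -> R) (q : 'I_(d p))
    (N : {poly R}) : Prop :=
  forall t, I (Slot q) t -> A (Slot q) t * denominator d p e t = N.[t].

Section OneSolution.
Variables (I : slot d -> set R) (A : slot d -> R -> R).
Hypothesis hA : extremal_solution Gamma beta I A.

Lemma box_point : exists x, forall s, I s (x s).
Proof.
case: hA => hI _ _ _.
have /choice[x hx] s : exists t, I s t by have [_ _] := hI s.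
by exists x.
Qed.

Lemma box_infinite s : infinite_many (I s).
Proof. by case: hA => hI _ _ _; exact: open_interval_infinite. Qed.
Arguments box_infinite s : clear implicits.

Lemma slot_op_ell (q : 'I_(d p)) l x :
  is_ell Gamma beta (Slot q) l -> (forall s, I s (x s)) ->
  exists2 P : {poly R}, (size P <= l.+1)%N & forall t, I (Slot q) t ->
    slot_op e beta A q x t = P.[t].
Proof.
move=> [hl _] bx; have [P Ps PE] := slot_op_degree hp hA hl bx.
have [h hE hy] := hatprod_factor_at hp q.
have [_ _ hN _] := hA.
exists ((bracket (Gamma p) x / h x) *: P); first exact: leq_trans (size_scale_leq _ _) Ps.
move=> t It; have bt := box_upd bx It; rewrite hornerZ -PE // hE hy upd_same.
have [D0 _ _] := hN _ bt; have [_ g0 _] := hN _ bx.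
have := hatprod_neq0 (hN _ bt); rewrite hE hy upd_same mulf_eq0 negb_or => /andP[? ?].
by field; apply/and4P; split.
Qed.

Lemma slot_numeratorP q N : slot_numerator I A q N -> forall x t,
  (forall s, I s (x s)) -> I (Slot q) t ->
  slot_op e beta A q x t =
  poly_op (bracket beta (upd x (Slot q) t)) (slope beta (Slot q) x) M N t.
Proof.
move=> hN x t bx It; case: hA => hI hsm _ _; have [oI _ _] := hI (Slot q).
have [sA _] := hsm (Slot q).
rewrite /slot_op addn1; apply: (jet_op_poly _ _ _ oI sA _ It) => u Iu.
by rewrite horner_denom_poly hN.
Qed.

(** The operator has weight m + 1 and its value has degree at most m; the resulting degree m + 2 is
    the bound of the cases with ell = m. *)
Lemma slot_numerator_exists q l : is_ell Gamma beta (Slot q) l -> (l <= msize d)%N ->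
  exists2 N : {poly R}, (size N <= (msize d).+3)%N & slot_numerator I A q N.
Proof.
move=> hl lm; have [x bx] := box_point; have [Q Qs QE] := slot_op_ell hl bx.
have [hI hsm hN _] := hA; have [sA _] := hsm (Slot q).
have bE t : bracket beta (upd x (Slot q) 0) + slope beta (Slot q) x * t =
   bracket beta (upd x (Slot q) t) by rewrite [RHS]bracket_affine mulrC.
have [|||N Ns NE] := weighted_op_polynomial (j := (msize d).+1)
  (b0 := bracket beta (upd x (Slot q) 0)) (b1 := slope beta (Slot q) x) (Q := Q) (hI (Slot q))
  _ (jet0_deriv sA (denom_poly d p e)) (jet1_deriv sA (denom_poly d p e)) (jet2_Cn sA _ _).
- by move=> t It; rewrite bE; have [_ _] := hN _ (box_upd bx It).
- exact: leq_trans Qs _.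
- by move=> t It; rewrite bE -QE // /slot_op /jet_op addn1.
by exists N => // t It; rewrite -NE // /jet0 horner_denom_poly.
Qed.

Lemma slot_numerator_size q l N : is_ell Gamma beta (Slot q) l -> (l < msize d)%N ->
  squares_indep beta (Slot q) -> slot_numerator I A q N -> (size N <= l.+1)%N.
Proof.
move=> hl lm /lin_indepP hi hN; apply: (size_from_op_coef lm) => i.
apply/leq_sizeP => n ln.
pose c (j : 'I_3) := (op_coef M N j)`_n.
pose c0 := c (@Ordinal 3 0 isT); pose c1 := c (@Ordinal 3 1 isT).
pose c2 := c (@Ordinal 3 2 isT).
have H x : (forall s, I s (x s)) ->
   c0 * bracket beta (upd x (Slot q) 0) ^+ 2
   + c1 * (bracket beta (upd x (Slot q) 0) * slope beta (Slot q) x)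
   + c2 * slope beta (Slot q) x ^+ 2 = 0.
  move=> bx; have [P Ps PE] := slot_op_ell hl bx.
  set b0 := bracket _ _; set b1 := slope _ _ _.
  have /(congr1 (fun Q : {poly R} => Q`_n)) : b0 ^+ 2 *: op_coef M N (@Ordinal 3 0 isT)
     + (b0 * b1) *: op_coef M N (@Ordinal 3 1 isT)
     + b1 ^+ 2 *: op_coef M N (@Ordinal 3 2 isT) = P.
    apply: (infinite_poly_eq (box_infinite (Slot q))) => t It.
    by rewrite -poly_op_coef -PE // (slot_numeratorP hN) // bracket_affine.
  rewrite [P`_n]nth_default ?(leq_trans Ps) // !coefD !coefZ => E.
  by rewrite -[RHS]E /c0 /c1 /c2 /c; ring.
have cb0 : coord_polyfun (fun x : slot d -> R => bracket beta (upd x (Slot q) 0)).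
  move=> x s; have [->|sq] := eqVneq s (Slot q).
    by apply: polyfun_eq (polyfunC (bracket beta (upd x (Slot q) 0))) => t; rewrite upd_upd.
  apply: polyfun_eq (coord_polyfun_bracket beta (upd x (Slot q) 0) s) => t.
  by rewrite [in RHS](upd_comm _ _ _ sq).
have cb1 := coord_polyfun_slope beta (Slot q).
have {}H x := box_extension (coord_polyfunD (coord_polyfunD
  (coord_polyfunM (@coord_polyfunC R k d c0) (coord_polyfunX 2 cb0))
  (coord_polyfunM (@coord_polyfunC R k d c1) (coord_polyfunM cb0 cb1)))
  (coord_polyfunM (@coord_polyfunC R k d c2) (coord_polyfunX 2 cb1))) box_infinite H x.
(* Substituting b0 = B - x_q b1 gives a relation between B^2, B b1 and b1^2 over the polynomials in
   x_q. *)
pose C (j : 'I_3) : {poly R} :=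
  match val j with
  | 0%N => c0%:P
  | 1%N => c1%:P - (2 * c0) *: 'X
  | _ => c2%:P - c1 *: 'X + c0 *: 'X^2
  end.
have C0 : forall j, C j = 0.
  apply: hi => x; rewrite !big_ord_recl big_ord0 /tnth /= partial_bracket /C /=.
  rewrite !hornerE /= -[RHS](H x).
  have -> : bracket beta x = bracket beta (upd x (Slot q) 0) + x (Slot q) * slope beta (Slot q) x.
    by rewrite -bracket_affine upd_id.
  ring.
have z0 : c0 = 0 by have /polyC_inj := C0 (@Ordinal 3 0 isT).
have z1 : c1 = 0.
  by have := C0 (@Ordinal 3 1 isT); rewrite /C /= z0 mulr0 scale0r subr0 => /polyC_inj.
have z2 : c2 = 0.
  by have := C0 (@Ordinal 3 2 isT); rewrite /C /= z0 z1 !scale0r subr0 addr0 => /polyC_inj.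
have [i0|i1|i2] : [\/ i = @Ordinal 3 0 isT, i = @Ordinal 3 1 isT | i = @Ordinal 3 2 isT].
  by case: i => [[|[|[|//]]] ?]; [constructor 1|constructor 2|constructor 3]; exact: val_inj.
- by rewrite i0.
- by rewrite i1.
by rewrite i2.
Qed.

(** The polynomial of [master] takes at x_r the value of the operator on N', while by continuation
    it is the operator on N; the difference is then extended from the box to all points. *)
Lemma numerators_diag (q r : 'I_(d p)) N N' : q != r ->
  slot_numerator I A q N -> slot_numerator I A r N' -> forall x,
  poly_op (on_diagonal (Slot q) (Slot r) (bracket beta) x)
    (on_diagonal (Slot q) (Slot r) (slope beta (Slot q)) x) M (N - N') (x (Slot q)) = 0.
Proof.
move=> qr hN hN'; have rq : r != q by rewrite eq_sym.
have Srq : Slot r != Slot q :> slot d by rewrite Slot_eq.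
have cb : coord_polyfun (fun x : slot d -> R => bracket beta (upd x (Slot q) (x (Slot r)))).
  move=> x s; have [->|sq] := eqVneq s (Slot q).
    apply: polyfun_eq (polyfunC (bracket beta (upd x (Slot q) (x (Slot r))))) => t.
    by rewrite upd_upd upd_other.
  apply: (@polyfun_eq _ (fun t => bracket beta (upd (upd x (Slot q) 0) s t)
      + (upd x s t (Slot r)) * slope beta (Slot q) (upd x s t))).
    by move=> t; rewrite [RHS]bracket_affine (upd_comm _ _ _ sq).
  apply: polyfunD; first exact: coord_polyfun_bracket.
  apply: polyfunM; last exact: coord_polyfun_slope.
  have [->|sr] := eqVneq s (Slot r).
    by apply: polyfun_eq (@polyfun_id R) => t; rewrite upd_same.
  by apply: polyfun_eq (polyfunC (x (Slot r))) => t; rewrite upd_other // eq_sym.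
have cb1 := coord_polyfun_slope beta (Slot q).
have H x : (forall s, I s (x s)) ->
    poly_op (bracket beta (upd x (Slot q) (x (Slot r)))) (slope beta (Slot q) x) M
      (N - N') (x (Slot r)) = 0.
  move=> bx; have [Q QE Qr] := master d_gt0 hp beta_h hA q bx.
  have Irx := bx (Slot r); have [hI hsm _ _] := hA.
  rewrite poly_opB; apply/eqP; rewrite subr_eq0; apply/eqP.
  transitivity Q.[x (Slot r)].
    (* Equality on the interval of q continues to x_r, which lies outside it. *)
    apply: (infinite_polyfun_eq (box_infinite (Slot q)) _ (polyfun_horner Q)
      (F := fun t => poly_op (bracket beta (upd x (Slot q) t)) (slope beta (Slot q) x) M N t)).
      eexists=> t; rewrite bracket_affine; exact: poly_op_coef.
    by move=> t It; rewrite -(slot_numeratorP hN) ?QE.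
  rewrite Qr // addn1; have [oI _ _] := hI (Slot r); have [sA _] := hsm (Slot r).
  apply: (jet_op_poly _ _ _ oI sA _ Irx) => u Iu.
  by rewrite horner_denom_poly hN'.
move=> x; pose x' := upd x (Slot r) (x (Slot q)).
have cpoly (P : {poly R}) := coord_polyfun_horner P (Slot r : slot d).
have := box_extension (coord_polyfunD (coord_polyfunB
   (coord_polyfunM (coord_polyfunX 2 cb) (cpoly (N - N')^`()^`()))
   (coord_polyfunM (coord_polyfunM (coord_polyfunM (@coord_polyfunC R k d (2 * M)) cb) cb1) (cpoly (N - N')^`())))
   (coord_polyfunM (coord_polyfunM (@coord_polyfunC R k d (M * (M + 1))) (coord_polyfunX 2 cb1)) (cpoly (N - N'))))
   box_infinite H x'.
have xq : x' (Slot q) = x (Slot q) by rewrite /x' upd_other // Slot_eq.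
rewrite [x' (Slot r)]upd_same /on_diagonal -/x'.
by have -> : upd x' (Slot q) (x (Slot q)) = x' by rewrite -xq upd_id.
Qed.

(** With E = N - N' the diagonal equation is a relation with coefficients E'', -2M E' and M(M+1) E;
    the last one already determines E. *)
Lemma numerators_eq (q r : 'I_(d p)) N N' : q != r ->
  merged_squares_indep beta (Slot q) (Slot r) ->
  slot_numerator I A q N -> slot_numerator I A r N' -> N = N'.
Proof.
move=> qr /lin_indepP hi hN hN'; apply/eqP; rewrite -subr_eq0; apply/eqP.
pose E := N - N'.
pose C (j : 'I_3) : {poly R} :=
  match val j with
  | 0%N => E^`()^`()
  | 1%N => - (2 * M) *: E^`()
  | _ => (M * (M + 1)) *: E
  end.
have : C (@Ordinal 3 2 isT) = 0.
  apply: hi => x; rewrite !big_ord_recl big_ord0 /tnth /= partial_bracket /C /=.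
  rewrite -[RHS](numerators_diag qr hN hN' x) /poly_op /weighted_op -/E !hornerE /=.
  ring.
move=> /eqP; rewrite /C /= scale_poly_eq0 mulf_eq0 /M natr1 !pnatr_eq0 /=.
by move=> /eqP.
Qed.

End OneSolution.

Section AllSlots.
Variables (I : slot d -> set R) (A : slot d -> R -> R).
Hypothesis hA : extremal_solution Gamma beta I A.
Variables (q : 'I_(d p)) (l : nat).
Hypothesis hl : is_ell Gamma beta (Slot q) l.

Lemma slot_numerator_swap (s : 'I_(d p)) N :
  slot_numerator (I \o swap q s) (A \o swap q s) q N -> slot_numerator I A s N.
Proof. by rewrite /slot_numerator /= swap_Slot tpermL. Qed.

Lemma slot_numerators : (l <= msize d)%N ->
  exists2 N : 'I_(d p) -> {poly R},
    forall s, (size (N s) <= (msize d).+3)%N & forall s, slot_numerator I A s (N s).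
Proof.
move=> lm.
have /choice[N NP] s : exists N : {poly R}, (size N <= (msize d).+3)%N /\
    slot_numerator I A s N.
  have [N Ns /slot_numerator_swap NE] :=
    slot_numerator_exists (extremal_swap q s hp beta_h hA) hl lm.
  by exists N.
by exists N => s; case: (NP s).
Qed.

Lemma slot_numerators_ell : (l < msize d)%N -> squares_indep beta (Slot q) ->
  exists2 N : 'I_(d p) -> {poly R},
    forall s, (size (N s) <= l.+1)%N & forall s, slot_numerator I A s (N s).
Proof.
move=> lm hi.
have /choice[N NP] s : exists N : {poly R}, (size N <= l.+1)%N /\
    slot_numerator I A s N.
  have hs := extremal_swap q s hp beta_h hA.
  have [N _ NE] := slot_numerator_exists hs hl (ltnW lm).
  exists N; split; first exact: (slot_numerator_size hs hl lm hi NE).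
  exact: slot_numerator_swap.
by exists N => s; case: (NP s).
Qed.

(** Independence is assumed for the pair (q, r) only; the exchange of r and s fixes q and reduces
    the pair (q, s) to it. *)
Lemma slot_numerators_eq (r : 'I_(d p)) (N : 'I_(d p) -> {poly R}) : q != r ->
  merged_squares_indep beta (Slot q) (Slot r) ->
  (forall s, slot_numerator I A s (N s)) -> forall s, N s = N q.
Proof.
move=> qr hi hN s; have [->//|sq] := eqVneq s q.
have hs := extremal_swap r s hp beta_h hA.
apply/esym/(numerators_eq hs qr hi).
  by have := hN q; rewrite /slot_numerator /= swap_Slot tpermD // eq_sym.
by have := hN s; rewrite /slot_numerator /= swap_Slot tpermL.
Qed.

Lemma slot_numerator_form (N : 'I_(d p) -> {poly R}) n :
  (forall s, (size (N s) <= n.+1)%N) -> (forall s, slot_numerator I A s (N s)) ->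
  quotient_form e I A N n.
Proof.
move=> Ns NE s; split=> // t It; rewrite -NE // mulfK //.
have [x bx] := box_point hA.
by have := denominator_neq0 hp hA s (box_upd bx It); rewrite upd_same.
Qed.

End AllSlots.
End Solutions.
Arguments box_infinite {R k d Gamma beta I A} hA s.

(** * Pure tensors *)

Section ProportionalCase.
Variables (R : realType) (k : nat) (d : 'I_k -> nat) (d_gt0 : forall j, (0 < d j)%N).
Variables (Gamma : gammas R d) (p : 'I_k) (e : 'I_k -> R * R).
Variables (hp : decomposes Gamma p e) (beta : Vdual R d).
Variables (beta_h : beta \in hspace Gamma) (beta_neq0 : beta != 0).

Lemma bracket_pure (a b : R) (beta' : tensor R (slots d (without p xpredT))) (x : slot d -> R) :
  bracket (ins (P := xpredT) (j := p) (erefl true) (tpower _ (a, b)) beta') x =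
  (\prod_(r < d p) line (a, b) (x (Slot r))) * bracket beta' x.
Proof. by rewrite bracket_ins contract_tpower. Qed.

Lemma bracket_absent_group (T : tensor R (slots d (without p xpredT))) x s t :
  tag s = p -> bracket T (upd x s t) = bracket T x.
Proof. by move=> sp; apply: bracket_upd_absent; rewrite /without sp eqxx. Qed.

Lemma pure_at (q : 'I_(d p)) (a b : R) (beta' : tensor R (slots d (without p xpredT))) x t :
  beta = ins (P := xpredT) (j := p) (erefl true) (tpower _ (a, b)) beta' ->
  bracket beta (upd x (Slot q) t) =
  (a + b * t) * ((\prod_(r | r != q) line (a, b) (x (Slot r))) * bracket beta' x).
Proof.
move=> ->; rewrite bracket_pure (bigD1 q) //= upd_same bracket_absent_group //.
rewrite -mulrA; congr (_ * (_ * _)); first by rewrite /line /= mulrC.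
by apply: eq_bigr => r rq; rewrite upd_other // Slot_eq.
Qed.

Lemma pure_slope (q : 'I_(d p)) (a b : R) (beta' : tensor R (slots d (without p xpredT))) x :
  beta = ins (P := xpredT) (j := p) (erefl true) (tpower _ (a, b)) beta' ->
  slope beta (Slot q) x =
  b * ((\prod_(r | r != q) line (a, b) (x (Slot r))) * bracket beta' x).
Proof. by move=> E; rewrite /slope !(pure_at _ _ _ E); ring. Qed.

Lemma pure_neq0 (q : 'I_(d p)) (a b : R) (beta' : tensor R (slots d (without p xpredT))) :
  beta = ins (P := xpredT) (j := p) (erefl true) (tpower _ (a, b)) beta' ->
  (a != 0) || (b != 0).
Proof.
move=> E; rewrite -negb_and; apply: contra beta_neq0 => /andP[/eqP a0 /eqP b0].
apply/eqP/bracket_inj => x; rewrite -(upd_id x (Slot q)) (pure_at _ _ _ E) a0 b0.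
by rewrite mul0r addr0 mul0r.
Qed.

(** Neither coefficient of the affine bracket involves x_q, so the polynomial relation may be
    specialised at a value [t0] where some coefficient is nonzero. *)
Lemma lin_dep_real (q : 'I_(d p)) :
  lin_dep_poly (Slot q) [tuple bracket beta; partial (Slot q) (bracket beta)] ->
  exists a b : R, ((a != 0) || (b != 0)) /\ forall x,
    a * slope beta (Slot q) x = b * bracket beta (upd x (Slot q) 0).
Proof.
move=> [c [i ci] cE].
have [t0 t0P] : exists t, (c i).[t] != 0.
  apply: contrapT => h; move: ci => /eqP; apply.
  apply: (infinite_poly_eq (I := setT)).
    by apply: open_interval_infinite; split; [exact: openT| |exists 0].
  move=> t _; rewrite horner0; apply/eqP; apply: contraT => ct.
  by case: h; exists t.
pose c0 := (c ord0).[t0]; pose c1 := (c (lift ord0 ord0)).[t0].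
exists (- (t0 * c0 + c1)), c0; split.
  rewrite -negb_and; apply: contra t0P => /andP[/eqP h1 /eqP h0].
  have c10 : c1 = 0 by rewrite -[c1]opprK; apply/eqP; rewrite oppr_eq0 -h1 h0 mulr0 add0r.
  have [->|->] : i = ord0 \/ i = lift ord0 ord0.
    by case: i {ci} => [[|[|//]] ?]; [left|right]; apply: val_inj.
    by apply/eqP.
  by apply/eqP.
move=> x; have := cE (upd x (Slot q) t0).
rewrite !big_ord_recl big_ord0 /tnth /= partial_bracket upd_same slope_upd.
rewrite bracket_affine -/c0 -/c1 addr0 => E.
apply/eqP; rewrite -subr_eq0; apply/eqP; rewrite -[RHS]oppr0 -[in RHS]E; ring.
Qed.

(** The relation says that B is proportional to a + b x_q in x_q, hence by symmetry in every
    variable of the group. Moving these variables to [t0] one by one extracts the product of the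
    lines; the cofactor is the contraction at [t0] divided by a power of a + b t0. *)
Lemma pure_of_relation (q : 'I_(d p)) (a b : R) : (a != 0) || (b != 0) ->
  (forall x, a * slope beta (Slot q) x = b * bracket beta (upd x (Slot q) 0)) ->
  exists beta' : tensor R (slots d (without p xpredT)),
    beta = ins (P := xpredT) (j := p) (erefl true) (tpower _ (a, b)) beta'.
Proof.
move=> ab0 H.
have [t0 w0] : exists t0, line (a, b) t0 != 0.
  have [a0|a0] := eqVneq a 0; last by exists 0; rewrite /line /= mul0r addr0.
  by exists 1; rewrite /line a0 add0r mul1r; move: ab0; rewrite a0 eqxx.
have Hq x u : line (a, b) t0 * bracket beta (upd x (Slot q) u) =
    line (a, b) u * bracket beta (upd x (Slot q) t0).
  rewrite /line /= [bracket beta (upd x _ u)]bracket_affine.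
  rewrite [bracket beta (upd x _ t0)]bracket_affine; apply/eqP; rewrite -subr_eq0.
  apply/eqP; transitivity ((u - t0) * (a * slope beta (Slot q) x
    - b * bracket beta (upd x (Slot q) 0))); first by ring.
  by rewrite H subrr mulr0.
have Hr (r : 'I_(d p)) x : line (a, b) t0 * bracket beta x =
    line (a, b) (x (Slot r)) * bracket beta (upd x (Slot r) t0).
  have E u : bracket beta (upd x (Slot r) u) =
      bracket beta (upd (x \o swap q r) (Slot q) u).
    by rewrite upd_swap swap_Slot tpermL (hspace_swap hp).
  by rewrite -[in LHS](upd_id x (Slot r)) !E Hq.
pose x0 x (s : slot d) : R := if tag s == p then t0 else x s.
have Hl (l : seq 'I_(d p)) x : uniq l -> line (a, b) t0 ^+ size l * bracket beta x =
    (\prod_(r <- l) line (a, b) (x (Slot r))) *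
    bracket beta (foldr (fun r y => upd y (Slot r) t0) x l).
  elim: l => [|r l IH] /=; first by rewrite big_nil.
  move=> /andP[rl ul]; rewrite exprS -mulrA IH // big_cons mulrCA (Hr r).
  have -> : foldr (fun r y => upd y (Slot r) t0) x l (Slot r) = x (Slot r).
    elim: l rl {IH ul} => //= r' l IH; rewrite inE negb_or => /andP[rr' /IH <-].
    by rewrite upd_other // Slot_eq.
  by rewrite mulrA [X in X * _]mulrC.
have x0E x : foldr (fun r y => upd y (Slot r) t0) x (enum 'I_(d p)) = x0 x.
  have F (l : seq 'I_(d p)) s : foldr (fun r y => upd y (Slot r) t0) x l s =
      if [exists r in l, s == Slot r] then t0 else x s.
    elim: l => [|r l IH] /=; first by case: existsP => // -[].
    have [->|sr] := eqVneq s (Slot r).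
      by rewrite upd_same; case: existsP => // -[]; exists r; rewrite mem_head eqxx.
    rewrite upd_other // IH; congr (if _ then _ else _); apply: eq_existsb => r'.
    by rewrite inE; case: (r' =P r) => [->|//]; rewrite (negPf sr) !andbF.
  apply/funext => s; rewrite F /x0; congr (if _ then _ else _).
  apply/existsP/eqP => [[r /andP[_ /eqP ->]] //|/slot_in_group[r ->]].
  by exists r; rewrite mem_enum eqxx.
have [G GE] := contract_exists (j := p) (erefl true) beta (fun=> t0).
have Gx x : bracket G x = bracket beta (x0 x).
  rewrite -GE; last by move=> r; rewrite /x0 /= eqxx.
  rewrite !bracketE; apply: eq_bigr => eps _; congr (_ * _).
  apply: eq_bigr => s _; rewrite /x0; case: s => s Ps /=.
  by case/andP: (Ps) => /negPf ->.
exists ((line (a, b) t0 ^+ d p)^-1 *: G); apply/eqP; rewrite -subr_eq0; apply/eqP.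
apply: bracket_inj => x; rewrite bracketB bracket_pure bracketZ Gx.
have := Hl (enum 'I_(d p)) x (enum_uniq _); rewrite x0E size_enum_ord big_enum /= => E.
rewrite mulrCA -E mulrA mulVf ?expf_neq0 // mul1r subrr.
by [].
Qed.

Lemma lin_dep_polyP (q : 'I_(d p)) :
  lin_dep_poly (Slot q) [tuple bracket beta; partial (Slot q) (bracket beta)] <->
  exists (a b : R) (beta' : tensor R (slots d (without p xpredT))),
    beta = ins (P := xpredT) (j := p) (erefl true) (tpower _ (a, b)) beta'.
Proof.
split=> [/lin_dep_real[a [b [ab0 H]]]|[a [b [beta' E]]]].
  by have [beta' E] := pure_of_relation ab0 H; exists a, b, beta'.
have ab0 := pure_neq0 q E.
pose c (i : 'I_2) : {poly R} := if val i == 0%N then b%:P else - (a%:P + b *: 'X).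
exists c.
  have [b0|b0] := eqVneq b 0.
    exists (lift ord0 ord0); rewrite /c /= b0 scale0r addr0 oppr_eq0 polyC_eq0.
    by move: ab0; rewrite b0 eqxx orbF.
  by exists ord0; rewrite /c /= polyC_eq0.
move=> x; rewrite !big_ord_recl big_ord0 /tnth /= partial_bracket /c /= !hornerE.
rewrite -[in bracket beta x](upd_id x (Slot q)) (pure_at _ _ _ E) (pure_slope _ _ E).
rewrite /=; ring.
Qed.

Variables (I : slot d -> set R) (A : slot d -> R -> R).
Hypothesis hA : extremal_solution Gamma beta I A.

Let M : R := (msize d + 1)%:R.

Lemma slot_op_L (q : 'I_(d p)) L x :
  is_L Gamma beta e (Slot q) L -> (forall s, I s (x s)) ->
  exists2 P : {poly R}, (size P <= L.+1)%N & forall t, I (Slot q) t ->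
    slot_op e beta A q x t * \prod_(j | j != p) line (e j) t =
    denominator d p e t * P.[t].
Proof.
move=> [hl _] bx; have [P Ps PE] := slot_op_degree hp hA hl bx.
have [_ _ hN _] := hA.
exists (bracket (Gamma p) x *: P); first exact: leq_trans (size_scale_leq _ _) Ps.
move=> t It; have bt := box_upd bx It; rewrite hornerZ -PE // upd_same /=.
have [D0 _ _] := hN _ bt; have [_ g0 _] := hN _ bx.
have := denominator_neq0 hp hA q bt; rewrite upd_same => Dn.
by field; rewrite D0 g0 Dn.
Qed.

Lemma line_neq0 (q : 'I_(d p)) x : (forall s, I s (x s)) ->
  forall j, j != p -> line (e j) (x (Slot q)) != 0.
Proof.
move=> bx j jp; have [_ _ hN _] := hA; have [_ /(_ j) g0 _] := hN _ bx.
have [g gE _] := gamma_factor_at hp q jp.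
by move: g0; rewrite gE mulf_eq0 negb_or => /andP[].
Qed.

Section Pure.
Variables (a b : R) (beta' : tensor R (slots d (without p xpredT))).
Hypothesis betaE :
  beta = ins (P := xpredT) (j := p) (erefl true) (tpower _ (a, b)) beta'.

Let cofactor q x : R :=
  (\prod_(r : 'I_(d p) | r != q) line (a, b) (x (Slot r))) * bracket beta' x.

Lemma pure_factors (q : 'I_(d p)) x : (forall s, I s (x s)) ->
  a + b * x (Slot q) != 0 /\ cofactor q x != 0.
Proof.
move=> bx; have [_ _ hN _] := hA; have [_ _] := hN _ bx.
by rewrite -(upd_id x (Slot q)) (pure_at _ _ _ betaE) mulf_eq0 negb_or upd_id => /andP.
Qed.

Lemma pure_jet_op (q : 'I_(d p)) x t f :
  jet_op (bracket beta (upd x (Slot q) t)) (slope beta (Slot q) x) M f (denom_poly d p e) t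
  = cofactor q x ^+ 2 * jet_op (a + b * t) b M f (denom_poly d p e) t.
Proof.
rewrite (pure_at _ _ _ betaE) (pure_slope _ _ betaE) -/(cofactor q x).
by rewrite /jet_op /weighted_op; ring.
Qed.

Lemma pure_upsilon (q : 'I_(d p)) L : is_L Gamma beta e (Slot q) L ->
  exists2 Y : {poly R}, (size Y <= L.+1)%N & forall (s : 'I_(d p)) t, I (Slot s) t ->
    jet_op (a + b * t) b M (A (Slot s)) (denom_poly d p e) t
      * \prod_(j | j != p) line (e j) t = denominator d p e t * Y.[t].
Proof.
move=> hL; have [x0 bx0] := box_point hA.
have H x (bx : forall s, I s (x s)) : exists2 Y : {poly R}, (size Y <= L.+1)%N &
    (forall t, I (Slot q) t ->
    jet_op (a + b * t) b M (A (Slot q)) (denom_poly d p e) t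
      * \prod_(j | j != p) line (e j) t = denominator d p e t * Y.[t]) /\
    forall s, s != q -> jet_op (a + b * x (Slot s)) b M (A (Slot s)) (denom_poly d p e) (x (Slot s))
      * \prod_(j | j != p) line (e j) (x (Slot s))
      = denominator d p e (x (Slot s)) * Y.[x (Slot s)].
  have [P Ps PE] := slot_op_L hL bx; have [_ K0] := pure_factors q bx.
  exists ((cofactor q x ^- 2) *: P); first exact: leq_trans (size_scale_leq _ _) Ps.
  split=> [t It|s sq].
    have := PE t It; rewrite /slot_op pure_jet_op hornerZ => E.
    apply: (mulfI (expf_neq0 2 K0)); rewrite mulrA E; field; exact: K0.
  have [Q QE Qr] := master d_gt0 hp beta_h hA q bx.
  have := Qr s sq; rewrite pure_jet_op hornerZ => E.
  have lineP j : polyfun (line (e j)).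
    by apply: polyfunD; [exact: polyfunC|apply: polyfunM; [exact: polyfun_id|exact: polyfunC]].
  have F := infinite_polyfun_eq (box_infinite hA (Slot q))
    (F := fun t => Q.[t] * \prod_(j | j != p) line (e j) t)
    (G := fun t => denominator d p e t * P.[t]).
  have {F} : Q.[x (Slot s)] * \prod_(j | j != p) line (e j) (x (Slot s)) =
      denominator d p e (x (Slot s)) * P.[x (Slot s)].
    apply: F => [||t It]; last by rewrite -QE ?PE.
      by apply: polyfunM; [exact: polyfun_horner|apply: polyfun_prod => j _].
    apply: polyfunM; last exact: polyfun_horner.
    by apply: polyfun_prod => j _; exact: polyfunX.
  rewrite E => {}E; apply: (mulfI (expf_neq0 2 K0)); rewrite mulrA E.
  by field; exact: K0.
have [Y Ys [YE _]] := H x0 bx0; exists Y => // s t It.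
have [sq|sq] := eqVneq s q; first by rewrite sq in It *; exact: YE.
have bx := box_upd bx0 It; have [Y' _ [Y'E /(_ s sq)]] := H _ bx.
rewrite upd_same => ->; congr (_ * _.[_]).
apply: (infinite_poly_eq (box_infinite hA (Slot q))) => u Iu.
have := denominator_neq0 hp hA q (box_upd bx0 Iu); rewrite upd_same => Dn.
by apply: (mulfI Dn); rewrite -Y'E // YE.
Qed.

Lemma O_set_split (f g : 'I_k -> R) :
  (forall j, j != p -> ~~ O_set p e j -> f j = g j) ->
  \prod_(j | j != p) f j =
  (\prod_(j | O_set p e j) f j) * \prod_(j | (j != p) && ~~ O_set p e j) g j.
Proof.
move=> fg; rewrite (bigID (O_set p e)) /=; congr (_ * _).
  by apply: eq_bigl => j; rewrite /O_set; case: (j != p).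
by apply: eq_bigr => j /andP[jp jO]; exact: fg.
Qed.

(** The scaling [c] prepares the case b = 0, where the constant power of a is to be absorbed into
    Upsilon. *)
Lemma pure_solution (q : 'I_(d p)) L : is_L Gamma beta e (Slot q) L ->
  exists2 Y : {poly R}, (size Y <= L.+1)%N & forall (c : R) (s : 'I_(d p)),
    exists2 G : R -> R,
      second_antiderivative (I (Slot s))
        (fun t => c * Y.[t] * \prod_(j < k | O_set p e j) line (e j) t ^+ (d j - 1)
                  / (a + b * t) ^+ (msize d + 3)%N) G &
      forall t, I (Slot s) t -> c * A (Slot s) t =
        (a + b * t) ^+ (msize d + 1)%N / \prod_(j < k | O_set p e j) line (e j) t ^+ d j * G t.
Proof.
move=> /pure_upsilon[Y Ys YE].
(* Outside [O_set] the lines are constants; their powers [c1] and [c2] move into [Y]. *)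
pose c1 := \prod_(j | (j != p) && ~~ O_set p e j) (e j).1 ^+ (d j - 1).
pose c2 := \prod_(j | (j != p) && ~~ O_set p e j) (e j).1 ^+ d j.
have lineO j t : j != p -> ~~ O_set p e j -> line (e j) t = (e j).1.
  by rewrite /O_set => -> /=; rewrite negbK /line => /eqP ->; rewrite mulr0 addr0.
have DE t : denominator d p e t = (\prod_(j | O_set p e j) line (e j) t ^+ d j) * c2.
  by rewrite /denominator; apply: O_set_split => j jp jO; rewrite lineO.
have D1E t : \prod_(j | j != p) line (e j) t ^+ (d j - 1) =
    (\prod_(j | O_set p e j) line (e j) t ^+ (d j - 1)) * c1.
  by apply: O_set_split => j jp jO; rewrite lineO.
have [x0 bx0] := box_point hA.
exists ((c1 / c2) *: Y); first exact: leq_trans (size_scale_leq _ _) Ys.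
move=> c s.
have boxs t : I (Slot s) t -> exists2 x, forall s, I s (x s) & x (Slot s) = t.
  by move=> It; exists (upd x0 (Slot s) t); [exact: box_upd|rewrite upd_same].
have bn t : I (Slot s) t -> a + b * t != 0.
  by move=> /boxs[x bx <-]; have [] := pure_factors s bx.
have Dn t : I (Slot s) t -> denominator d p e t != 0.
  by move=> /boxs[x bx <-]; exact: (denominator_neq0 hp hA s bx).
have ln t : I (Slot s) t -> \prod_(j | j != p) line (e j) t != 0.
  by move=> /boxs[x bx <-]; apply/prodf_neq0 => j jp; exact: line_neq0.
have c20 : c2 != 0.
  by have := Dn _ (bx0 (Slot s)); rewrite DE mulf_eq0 negb_or => /andP[].
have [hI hsm _ _] := hA; have [oI _ _] := hI (Slot s); have [sA _] := hsm (Slot s).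
pose P := (c / c2) *: denom_poly d p e.
have [G1 d1 d2] := weighted_deriv (msize d + 1) bn (jet0_deriv sA P) (jet1_deriv sA P).
exists (fun t => jet0 (A (Slot s)) P t / (a + b * t) ^+ (msize d + 1)).
  apply: (second_antiderivative_on oI d1 d2) => t It.
  rewrite -/(jet_op (a + b * t) b M (A (Slot s)) P t) jet_opZ.
  have -> : jet_op (a + b * t) b M (A (Slot s)) (denom_poly d p e) t =
      (\prod_(j | O_set p e j) line (e j) t ^+ (d j - 1)) * c1 * Y.[t].
    apply: (mulIf (ln t It)); rewrite YE // -D1E.
    rewrite [in RHS]mulrAC; congr (_ * _); rewrite /denominator -big_split /=.
    apply: eq_bigr => j _; rewrite -exprSr subn1 prednK //.
  have -> : (msize d + 3 = (msize d + 1).+2)%N by rewrite !addnS.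
  by rewrite hornerZ; field; rewrite c20 expf_neq0 // bn.
move=> t It; rewrite /jet0 /P hornerZ horner_denom_poly DE.
have := Dn t It; rewrite DE mulf_eq0 negb_or => /andP[DO _].
by field; rewrite c20 DO expf_neq0 // bn.
Qed.

End Pure.
End ProportionalCase.

(** * Linear dependence on the diagonal *)

Section Kappa.
Variables (R : realType) (k : nat) (d : 'I_k -> nat).
Variables (Gamma : gammas R d) (p : 'I_k) (e : 'I_k -> R * R).
Variables (hp : decomposes Gamma p e) (beta : Vdual R d).
Variables (beta_h : beta \in hspace Gamma) (beta_neq0 : beta != 0).
Variables (q r : 'I_(d p)) (qr : q != r).

(** [u0 + u1 (x_q + x_r) + u2 x_q x_r] is the bracket of [beta]. *)
Definition pair_coef (x : slot d -> R) : R * R * R :=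
  let u1 := slope beta (Slot q) (upd x (Slot r) 0) in
  (bracket beta (upd (upd x (Slot q) 0) (Slot r) 0), u1,
   slope beta (Slot q) (upd x (Slot r) 1) - u1).

Let Sqr : Slot q != Slot r :> slot d. Proof. by rewrite Slot_eq. Qed.

Lemma bracket_pair_sym x u v :
  bracket beta (upd (upd x (Slot q) u) (Slot r) v) =
  bracket beta (upd (upd x (Slot q) v) (Slot r) u).
Proof.
rewrite -(hspace_swap hp q r _ beta_h); congr bracket; apply/funext => s.
rewrite /= /swap; case: tpermP => [->|->|/eqP sq /eqP sr].
- by rewrite upd_same upd_other // upd_same.
- by rewrite upd_same upd_other // upd_same.
by rewrite !upd_other.
Qed.

Lemma slope_pair x u :
  slope beta (Slot q) (upd x (Slot r) u) = (pair_coef x).1.2 + (pair_coef x).2 * u.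
Proof.
rewrite /pair_coef /= /slope -!(upd_comm _ _ _ Sqr).
rewrite [bracket beta (upd (upd x (Slot q) 1) (Slot r) u)]bracket_affine.
rewrite [bracket beta (upd (upd x (Slot q) 0) (Slot r) u)]bracket_affine /slope.
ring.
Qed.

Lemma bracket_pair x u v :
  bracket beta (upd (upd x (Slot q) u) (Slot r) v) =
  (pair_coef x).1.1 + (pair_coef x).1.2 * (u + v) + (pair_coef x).2 * u * v.
Proof.
rewrite (upd_comm _ _ _ Sqr) bracket_affine slope_pair.
have -> : bracket beta (upd (upd x (Slot r) v) (Slot q) 0) =
   (pair_coef x).1.1 + (pair_coef x).1.2 * v.
  rewrite -(upd_comm _ _ _ Sqr) bracket_pair_sym (upd_comm _ _ _ Sqr) bracket_affine.
  rewrite slope_pair mulr0 addr0 mulrC /pair_coef /=.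
  by rewrite -(upd_comm _ _ _ Sqr).
ring.
Qed.

Lemma pair_coef_upd x t s : (s == Slot q) || (s == Slot r) ->
  pair_coef (upd x s t) = pair_coef x.
Proof.
move=> /orP[/eqP ->|/eqP ->]; rewrite /pair_coef ?upd_upd //.
  by rewrite !(upd_comm _ _ _ Sqr) !slope_upd.
by rewrite !(upd_comm _ _ _ Sqr) !upd_upd.
Qed.

Lemma bracket_pairE x : bracket beta x =
  (pair_coef x).1.1 + (pair_coef x).1.2 * (x (Slot q) + x (Slot r))
  + (pair_coef x).2 * x (Slot q) * x (Slot r).
Proof. by rewrite -bracket_pair upd_id upd_id. Qed.

Let quad (u : R * R * R) : {poly R} := u.1.1%:P + (2 * u.1.2) *: 'X + u.2 *: 'X^2.
Let lin (u : R * R * R) : {poly R} := u.1.2%:P + u.2 *: 'X.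

(** The coefficients of the relation depend on x_q alone and [pair_coef] is free of x_q and x_r: one
    polynomial relation is shared by all positions of the other variables. *)
Lemma merged_dep_polys : merged_dep beta (Slot q) (Slot r) ->
  exists c0 c1 : {poly R}, ((c0 != 0) || (c1 != 0)) /\
    forall x, c0 * quad (pair_coef x) + c1 * lin (pair_coef x) = 0.
Proof.
move=> nI; have : ~ lin_indep_poly (Slot q)
   [tuple on_diagonal (Slot q) (Slot r) (bracket beta);
          on_diagonal (Slot q) (Slot r) (partial (Slot q) (bracket beta))].
  by move=> H; apply: nI; apply/lin_indepP.
move=> /existsNP[c /not_implyP[cE /existsNP[i /eqP ci]]].
exists (c ord0), (c (lift ord0 ord0)); split.
  have [E|E] : i = ord0 \/ i = lift ord0 ord0.
    by case: i {ci} => [[|[|//]] ?]; [left|right]; apply: val_inj.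
    by rewrite -E ci.
  by rewrite -E ci orbT.
move=> x; apply: (infinite_poly_eq (I := setT)).
  by apply: open_interval_infinite; split; [exact: openT| |exists 0].
move=> t _; rewrite horner0 -[RHS](cE (upd x (Slot q) t)).
rewrite !big_ord_recl big_ord0 /tnth /= partial_bracket /on_diagonal upd_same.
rewrite bracket_pair slope_pair pair_coef_upd ?eqxx //.
by rewrite /quad /lin !hornerE /=; ring.
Qed.

(** The pairs (quad, lin) at x and y are annihilated by the same nonzero (c0, c1), so their
    determinant vanishes; its coefficients give the 2 x 2 minors. Hence all vectors [pair_coef x]
    lie on one line. *)
Lemma pair_coef_minors x y : merged_dep beta (Slot q) (Slot r) ->
  [/\ (pair_coef x).1.1 * (pair_coef y).1.2 = (pair_coef y).1.1 * (pair_coef x).1.2,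
      (pair_coef x).1.1 * (pair_coef y).2 = (pair_coef y).1.1 * (pair_coef x).2 &
      (pair_coef x).1.2 * (pair_coef y).2 = (pair_coef y).1.2 * (pair_coef x).2].
Proof.
move=> /merged_dep_polys[c0 [c1 [c0n H]]].
move: (H x) (H y); move: (pair_coef x) (pair_coef y) => u v Hu Hv {H}.
have E : quad u * lin v = quad v * lin u.
  apply/eqP; rewrite -subr_eq0.
  have E0 : c0 * (quad u * lin v - quad v * lin u) = 0.
    transitivity ((c0 * quad u + c1 * lin u) * lin v - (c0 * quad v + c1 * lin v) * lin u).
      ring.
    by rewrite Hu Hv !mul0r subr0.
  have [c00|c00] := eqVneq c0 0; last by move/eqP: E0; rewrite mulf_eq0 (negPf c00).
  move: c0n Hu Hv; rewrite c00 eqxx /= !mul0r !add0r => c1n /eqP Hu /eqP Hv.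
  move: Hu Hv; rewrite !mulf_eq0 (negPf c1n) /= => /eqP -> /eqP ->.
  by rewrite !mulr0 subrr.
have C n := congr1 (fun P : {poly R} => P`_n) E.
(* The last branch is a tautology: the three lowest coefficients suffice. *)
have F w z n : (quad w * lin z)`_n = if n is 0%N then w.1.1 * z.1.2 else
   if n is 1%N then w.1.1 * z.2 + 2 * w.1.2 * z.1.2 else
   if n is 2%N then 2 * w.1.2 * z.2 + w.2 * z.1.2 else (quad w * lin z)`_n.
  have -> : quad w * lin z = (w.1.1 * z.1.2)%:P + (w.1.1 * z.2 + 2 * w.1.2 * z.1.2) *: 'X
     + (2 * w.1.2 * z.2 + w.2 * z.1.2) *: 'X^2 + (w.2 * z.2) *: 'X^3.
    by rewrite /quad /lin -!mul_polyC !polyCD !polyCM; ring.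
  case: n => [|[|[|n]]] //; rewrite !coefD !coefZ !coefC !coefX !coefXn /=; ring.
have C0 := C 0%N; have C1 := C 1%N; have C2 := C 2%N.
rewrite /= !F in C0 C1 C2; split; first exact: C0.
- by lra.
- by lra.
Qed.

(** At a point where the bracket is nonzero the vector (a, b, c) = [pair_coef y] spans the common
    line; kappa is the coordinate along it, a scalar product divided by the squared length [n]. *)
Lemma kappa_form_exists : merged_dep beta (Slot q) (Slot r) ->
  exists (kappa : (slot d -> R) -> R) (a b c : R),
    kappa_form beta (Slot q) (Slot r) kappa a b c.
Proof.
move=> mD.
have [y y0] : exists y, bracket beta y != 0.
  apply: contrapT => h; move/eqP: beta_neq0; apply; apply: bracket_inj => x.
  by apply/eqP; apply: contraT => bx; case: h; exists x.
pose a := (pair_coef y).1.1; pose b := (pair_coef y).1.2; pose c := (pair_coef y).2.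
pose n := a ^+ 2 + b ^+ 2 + c ^+ 2.
have n0 : n != 0.
  apply: contra y0 => /eqP n0; rewrite bracket_pairE -/a -/b -/c.
  have a0 : a = 0 by apply/eqP; rewrite -sqrf_eq0; apply/eqP; rewrite /n in n0; nra.
  have b0 : b = 0 by apply/eqP; rewrite -sqrf_eq0; apply/eqP; rewrite /n in n0; nra.
  have c0 : c = 0 by apply/eqP; rewrite -sqrf_eq0; apply/eqP; rewrite /n in n0; nra.
  by rewrite a0 b0 c0 !mul0r !addr0.
exists (fun x => ((pair_coef x).1.1 * a + (pair_coef x).1.2 * b + (pair_coef x).2 * c) / n).
exists a, b, c; split=> [x t|x]; first by rewrite !pair_coef_upd ?eqxx ?orbT.
rewrite bracket_pairE; have [E1 E2 E3] := pair_coef_minors x y mD.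
move: E1 E2 E3; rewrite -/a -/b -/c.
move: (pair_coef x) => [[u0 u1] u2] /= E1 E2 E3.
have E s t : s - t = 0 -> s = t :> R by move=> /eqP; rewrite subr_eq0 => /eqP.
have F0 : u0 * n = (u0 * a + u1 * b + u2 * c) * a.
  apply: E; transitivity (b * (u0 * b - a * u1) + c * (u0 * c - a * u2)).
    by rewrite /n; ring.
  by rewrite E1 E2 !subrr !mulr0 addr0.
have F1 : u1 * n = (u0 * a + u1 * b + u2 * c) * b.
  apply: E; transitivity (- a * (u0 * b - a * u1) + c * (u1 * c - b * u2)).
    by rewrite /n; ring.
  by rewrite E1 E3 !subrr !mulr0 addr0.
have F2 : u2 * n = (u0 * a + u1 * b + u2 * c) * c.
  apply: E; transitivity (- a * (u0 * c - a * u2) - b * (u1 * c - b * u2)).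
    by rewrite /n; ring.
  by rewrite E2 E3 !subrr !mulr0 subr0.
rewrite -[u0 in LHS](mulfK n0) -[u1 in LHS](mulfK n0) -[u2 in LHS](mulfK n0) F0 F1 F2.
ring.
Qed.

End Kappa.

Lemma kappa_upd (R : realType) (k : nat) (d : 'I_k -> nat) (beta : Vdual R d)
    (s s' : slot d) kappa (a b c : R) x u v : s != s' ->
  kappa_form beta s s' kappa a b c ->
  bracket beta (upd (upd x s u) s' v) = kappa x * (a + b * (u + v) + c * u * v).
Proof.
move=> ss' [k1 k2]; rewrite k2 (k1 _ _).2 (k1 _ _).1.
by rewrite upd_same upd_other // upd_same.
Qed.

Lemma kappa_slope (R : realType) (k : nat) (d : 'I_k -> nat) (beta : Vdual R d)
    (s s' : slot d) kappa (a b c : R) x : s != s' ->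
  kappa_form beta s s' kappa a b c ->
  slope beta s x = kappa x * (b + c * x s').
Proof.
move=> ss' [k1 k2]; rewrite /slope !k2 !(k1 _ _).1 !upd_same !upd_other 1?eq_sym //.
ring.
Qed.

Lemma numerators_kappa (R : realType) (k : nat) (d : 'I_k -> nat)
    (d_gt0 : forall j, (0 < d j)%N) (Gamma : gammas R d) (p : 'I_k) (e : 'I_k -> R * R)
    (beta : Vdual R d) (I : slot d -> set R) (A : slot d -> R -> R) (q r : 'I_(d p))
    (N N' : {poly R}) kappa (a b c : R) :
  decomposes Gamma p e -> beta \in hspace Gamma -> extremal_solution Gamma beta I A ->
  q != r -> slot_numerator e I A q N -> slot_numerator e I A r N' ->
  kappa_form beta (Slot q) (Slot r) kappa a b c ->
  forall v, poly_op (quadratic a b c v) (b + c * v) (msize d).+1%:R (N - N') v = 0.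
Proof.
move=> hp beta_h hA qr hN hN' hk v; have [x bx] := box_point hA.
have Sqr : Slot q != Slot r :> slot d by rewrite Slot_eq.
have kx : kappa x != 0.
  have [_ _ hNs _] := hA; have [_ _] := hNs x bx.
  by have [_ ->] := hk; rewrite mulf_eq0 negb_or => /andP[].
have := numerators_diag d_gt0 hp beta_h hA qr hN hN' (upd x (Slot q) v).
rewrite /on_diagonal upd_same (kappa_upd _ _ _ Sqr hk) (kappa_slope _ Sqr hk).
rewrite upd_same !(proj1 hk _ _).2 !(proj1 hk _ _).1 => E.
apply: (mulfI (expf_neq0 2 kx)); rewrite mulr0 -[RHS]E.
by rewrite /poly_op /weighted_op /quadratic; ring.
Qed.

(** * The equation (dagger) *)

Lemma deriv_onV (R : realType) (I : set R) (f f' : R -> R) :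
  (forall t, I t -> f t != 0) -> deriv_on I f f' ->
  deriv_on I (fun t => (f t)^-1) (fun t => - (f t) ^- 2 * f' t).
Proof. by move=> fn ff' t It; exact: is_deriveV (fn t It) (ff' t It). Qed.

Lemma Cn_onV (R : realType) (I : set R) (n : nat) (f : R -> R) :
  (forall t, I t -> f t != 0) -> Cn_on I n f -> Cn_on I n (fun t => (f t)^-1).
Proof.
move=> fn; elim: n => // n IH Cf; have Cf' := Cn_onS Cf; have [f' ff' Cf''] := Cf.
exists (fun t => - (f t) ^- 2 * f' t); first exact: deriv_onV.
apply: Cn_onM => //.
have -> : (fun t => - (f t) ^- 2) = (fun t => (-1 *: (1%:P : {poly R})).[t] * ((f t)^-1 * (f t)^-1)).
  by apply/funext => t; rewrite hornerZ hornerC mulr1 expr2 invfM mulN1r.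
by apply: Cn_onM; [exact: Cn_on_horner|apply: Cn_onM; exact: IH].
Qed.

(** [dlogsum] is the logarithmic derivative of the denominator. *)
Lemma denom_poly_deriv (R : realType) (k : nat) (d : 'I_k -> nat) (p : 'I_k)
    (e : 'I_k -> R * R) x : (forall j, j != p -> line (e j) x != 0) ->
  (denom_poly d p e)^`().[x] = dlogsum d p e x * denominator d p e x.
Proof.
move=> l0; rewrite -horner_denom_poly /denom_poly /dlogsum.
pose K (F : {poly R}) (s : R) := F^`().[x] = s * F.[x].
apply: (big_rec2 (K : {poly R} -> R -> Prop)); rewrite /K.
  by rewrite derivC horner0 mul0r.
move=> j s F jp E; rewrite derivM hornerD !hornerM E deriv_exp hornerMn hornerM.
rewrite derivD derivZ derivX derivC addr0 hornerZ hornerC !horner_exp horner_line.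
rewrite -mulr_natr; case: (d j) => [|n] /=; first by rewrite !expr0; ring.
by rewrite exprS; field; exact: l0.
Qed.

Lemma open_denominator_neq0 (R : realType) (P : {poly R}) :
  open [set t : R | P.[t] != 0].
Proof.
have -> : [set t : R | P.[t] != 0] = horner P @^-1` [set~ 0].
  by apply/seteqP; split=> t /= /eqP.
apply: open_comp; first by move=> t _; exact: continuous_horner.
by rewrite openC; exact: closed_eq.
Qed.

(** With [E = f D] and [D' = S D], the operator applied to [E] is [P^2 D] times
    the left-hand side of the equation satisfied by [f]. *)
Lemma dagger_of_op (R : realType) (k : nat) (d : 'I_k -> nat)
    (d_gt0 : forall j, (0 < d j)%N) (p : 'I_k) (e : 'I_k -> R * R) (a b c : R)
    (E : {poly R}) :
  (forall v, poly_op (quadratic a b c v) (b + c * v) (msize d).+1%:R E v = 0) ->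
  dagger d p e a b c (fun x => E.[x] / denominator d p e x).
Proof.
move=> H m P S x Dx Px lnP'.
pose U := [set t : R | (denom_poly d p e).[t] != 0].
have oU : open U by exact: open_denominator_neq0.
have Ux : U x by rewrite /U /= horner_denom_poly.
have UD t : U t -> denominator d p e t != 0 by rewrite /U /= horner_denom_poly.
have Ul t : U t -> forall j, j != p -> line (e j) t != 0.
  move=> /UD /prodf_neq0 h j jp; have := h j jp.
  by rewrite expf_eq0 d_gt0.
have Dfun : horner (denom_poly d p e) = denominator d p e.
  by apply/funext => t; rewrite horner_denom_poly.
have CD n (F : {poly R}) : Cn_on U n (fun t => F.[t] / denominator d p e t).
  apply: Cn_onM; first exact: Cn_on_horner.
  by apply: Cn_onV => //; rewrite -Dfun; exact: Cn_on_horner.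
have [f1 df1 [f2 df2 _]] := CD 2%N E.
have [S1 dS1 _] := CD 1%N (denom_poly d p e)^`().
have DS t : U t -> (denom_poly d p e)^`().[t] = S t * denominator d p e t.
  by move=> Ut; rewrite denom_poly_deriv //; exact: Ul.
have dS : deriv_on U S S1.
  by apply: deriv_on_eq dS1 => // t Ut; rewrite DS // mulfK // UD.
have dD := deriv_on_horner (I := U) (denom_poly d p e).
have dD1 := deriv_on_horner (I := U) (denom_poly d p e)^`().
have dE := deriv_on_horner (I := U) E; have dE1 := deriv_on_horner (I := U) E^`().
have D2 t : U t -> (denom_poly d p e)^`()^`().[t] =
    S1 t * denominator d p e t + S t * (S t * denominator d p e t).
  move=> Ut; have dSD := deriv_onM dS dD.
  rewrite -(deriv_on_uniq (deriv_on_eq oU _ dSD) dD1 Ut) ?horner_denom_poly ?DS //.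
  by move=> u Uu; rewrite DS // horner_denom_poly.
have E1 t : U t -> E^`().[t] = f1 t * denominator d p e t
   + E.[t] / denominator d p e t * (S t * denominator d p e t).
  move=> Ut; have dfD := deriv_onM df1 dD.
  rewrite -(deriv_on_uniq (deriv_on_eq oU _ dfD) dE Ut) ?horner_denom_poly ?DS //.
  by move=> u Uu; rewrite horner_denom_poly mulfVK // UD.
have E2 t : U t -> E^`()^`().[t] = f2 t * denominator d p e t
   + 2 * f1 t * (S t * denominator d p e t)
   + E.[t] / denominator d p e t * (S1 t * denominator d p e t + S t * (S t * denominator d p e t)).
  move=> Ut; have dfD := deriv_onD (deriv_onM df2 dD) (deriv_onM df1 dD1).
  rewrite -(deriv_on_uniq (deriv_on_eq oU _ dfD) dE1 Ut) ?horner_denom_poly ?DS ?D2 //.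
    by ring.
  by move=> u Uu; rewrite horner_denom_poly E1 // DS.
rewrite (derive1n2_on oU df1 df2 Ux) (deriv_onE df1 Ux) (deriv_onE dS Ux) /lnP'.
(* The slope on the diagonal is half of P', which is the origin of the factors 1/2 and 1/4 in
   (dagger). *)
have -> : derive1 P x = 2 * (b + c * x).
  have -> : P = horner (a%:P + (2 * b) *: 'X + c *: 'X^2).
    by apply/funext => t; rewrite /P /quadratic !hornerE.
  rewrite -(derivE (a%:P + (2 * b) *: 'X + c *: 'X^2)) !derivD !derivZ derivX derivXn derivC.
  by rewrite !hornerE /=; ring.
have := H x; rewrite /poly_op /weighted_op (E1 x Ux) (E2 x Ux) -/(P x) -natr1 -/m.
move=> HH; apply: (mulfI (mulf_neq0 (expf_neq0 2 Px) Dx)); rewrite mulr0 -[RHS]HH.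
by field; rewrite Px Dx.
Qed.

(** * Solutions of the equations on the diagonal *)

Lemma setT_infinite (R : realType) : infinite_many [set: R].
Proof. by apply: open_interval_infinite; split; [exact: openT| |exists 0]. Qed.

Lemma quartic_coef0 (R : realType) (k0 k1 k2 k3 k4 : R) :
  (forall v, k0 + k1 * v + k2 * v ^+ 2 + k3 * v ^+ 3 + k4 * v ^+ 4 = 0) ->
  [/\ k0 = 0, k1 = 0, k2 = 0, k3 = 0 & k4 = 0].
Proof.
move=> H; have P0 : Poly [:: k0; k1; k2; k3; k4] = 0.
  apply: (infinite_poly_eq (@setT_infinite R)) => v _.
  by rewrite horner0 horner_Poly -[RHS](H v) /=; ring.
have C n := congr1 (fun P : {poly R} => P`_n) P0.
split; [have := C 0%N|have := C 1%N|have := C 2%N|have := C 3%N|have := C 4%N];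
  by rewrite coef_Poly coef0.
Qed.

Lemma size3_poly (R : realType) (E : {poly R}) : (size E <= 3)%N ->
  E = (E`_0)%:P + E`_1 *: 'X + E`_2 *: 'X^2.
Proof.
move=> sE; apply/polyP => n; rewrite !coefD !coefZ coefC coefX coefXn.
case: n => [|[|[|n]]] /=; rewrite ?mulr0 ?mulr1 ?addr0 ?add0r //.
by rewrite nth_default // (leq_trans sE).
Qed.

Lemma horner_size3 (R : realType) (E : {poly R}) v : (size E <= 3)%N ->
  [/\ E.[v] = E`_0 + E`_1 * v + E`_2 * v ^+ 2,
      E^`().[v] = E`_1 + 2 * E`_2 * v & E^`()^`().[v] = 2 * E`_2].
Proof.
move=> /size3_poly; move: (E`_0) (E`_1) (E`_2) => e0 e1 e2 ->.
by rewrite !(derivD, derivZ, derivC, derivX, derivXn, derivMn) !hornerE /=; split; ring.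
Qed.

(** For a quadratic solution [E] of the equation on the diagonal, the highest
    power of [v] gives the top coefficient of [E]. *)
Lemma diag_quadratic0 (R : realType) (a b c M : R) (E : {poly R}) :
  (size E <= 3)%N -> c != 0 -> M != 0 -> M - 1 != 0 -> M - 2 != 0 -> M + 1 != 0 ->
  (forall v, poly_op (quadratic a b c v) (b + c * v) M E v = 0) -> E = 0.
Proof.
move=> sE c0 M0 M1 M2 M3 H.
have c2 : c ^+ 2 != 0 by rewrite expf_neq0.
have HE v : poly_op (quadratic a b c v) (b + c * v) M E v =
   weighted_op (quadratic a b c v) (b + c * v) M (E`_0 + E`_1 * v + E`_2 * v ^+ 2)
     (E`_1 + 2 * E`_2 * v) (2 * E`_2).
  by have [h0 h1 h2] := horner_size3 v sE; rewrite /poly_op h0 h1 h2.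
rewrite (size3_poly sE); set e0 := E`_0 in HE *; set e1 := E`_1 in HE *; set e2 := E`_2 in HE *.
have [] := quartic_coef0 (k0 := a ^+ 2 * 2 * e2 - 2 * M * a * b * e1 + M * (M + 1) * b ^+ 2 * e0)
  (k1 := 8 * a * b * e2 - 2 * M * (2 * b ^+ 2 * e1 + a * c * e1 + 2 * a * b * e2)
         + M * (M + 1) * (2 * b * c * e0 + b ^+ 2 * e1))
  (k2 := 2 * e2 * (4 * b ^+ 2 + 2 * a * c) - 2 * M * (3 * b * c * e1 + 2 * e2 * (2 * b ^+ 2 + a * c))
         + M * (M + 1) * (c ^+ 2 * e0 + 2 * b * c * e1 + b ^+ 2 * e2))
  (k3 := 8 * b * c * e2 - 2 * M * (c ^+ 2 * e1 + 6 * b * c * e2)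
         + M * (M + 1) * (c ^+ 2 * e1 + 2 * b * c * e2))
  (k4 := c ^+ 2 * ((M - 1) * (M - 2)) * e2).
  by move=> v; rewrite -[RHS](H v) HE /weighted_op /quadratic; ring.
move=> _ _ k2 k3 /eqP; rewrite !mulf_eq0 (negPf c0) (negPf M1) (negPf M2) /= => /eqP e20.
have /eqP : c ^+ 2 * (M * (M - 1)) * e1 = 0 by rewrite -[RHS]k3 e20; ring.
rewrite !mulf_eq0 (negPf c0) (negPf M1) (negPf M0) /= => /eqP e10.
have /eqP : c ^+ 2 * (M * (M + 1)) * e0 = 0 by rewrite -[RHS]k2 e20 e10; ring.
rewrite !mulf_eq0 (negPf c0) (negPf M3) (negPf M0) /= => /eqP e00.
by rewrite e00 e10 e20 !scale0r !addr0.
Qed.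

(** For c = 0 the equation has degree two in v and is triangular in the coefficients of E; the top
    one is multiplied by 8 - 8M + M(M+1) = M^2 - 7M + 8. *)
Lemma diag_quadratic0_affine (R : realType) (a b M : R) (E : {poly R}) :
  (size E <= 3)%N -> b != 0 -> M != 0 -> M - 3 != 0 -> M + 1 != 0 ->
  M ^+ 2 - 7 * M + 8 != 0 ->
  (forall v, poly_op (quadratic a b 0 v) b M E v = 0) -> E = 0.
Proof.
move=> sE b0 M0 M3 M1 M7 H.
have b2 : b ^+ 2 != 0 by rewrite expf_neq0.
have HE v : poly_op (quadratic a b 0 v) b M E v =
   weighted_op (quadratic a b 0 v) b M (E`_0 + E`_1 * v + E`_2 * v ^+ 2)
     (E`_1 + 2 * E`_2 * v) (2 * E`_2).
  by have [h0 h1 h2] := horner_size3 v sE; rewrite /poly_op h0 h1 h2.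
rewrite (size3_poly sE); set e0 := E`_0 in HE *; set e1 := E`_1 in HE *; set e2 := E`_2 in HE *.
have [] := quartic_coef0
  (k0 := a ^+ 2 * 2 * e2 - 2 * M * a * b * e1 + M * (M + 1) * b ^+ 2 * e0)
  (k1 := 8 * a * b * e2 - 2 * M * (2 * b ^+ 2 * e1 + 2 * a * b * e2)
         + M * (M + 1) * (b ^+ 2 * e1))
  (k2 := b ^+ 2 * (M ^+ 2 - 7 * M + 8) * e2) (k3 := 0) (k4 := 0).
  by move=> v; rewrite -[RHS](H v) HE /weighted_op /quadratic; ring.
move=> k0 k1 /eqP; rewrite !mulf_eq0 (negPf b0) (negPf M7) /= => /eqP e20 _ _.
have /eqP : b ^+ 2 * (M * (M - 3)) * e1 = 0 by rewrite -[RHS]k1 e20; ring.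
rewrite !mulf_eq0 (negPf b0) (negPf M3) (negPf M0) /= => /eqP e10.
have /eqP : b ^+ 2 * (M * (M + 1)) * e0 = 0 by rewrite -[RHS]k0 e20 e10; ring.
rewrite !mulf_eq0 (negPf b0) (negPf M1) (negPf M0) /= => /eqP e00.
by rewrite e00 e10 e20 !scale0r !addr0.
Qed.

(** As a polynomial in [t] the second summand is quadratic, so the third
    derivative in [t] removes it; at the zeros of [a + b (t + u) + c t u] only a
    multiple of [E'''] is left. *)
Lemma antisym_cubic (R : realType) (a b c M : R) (E : {poly R}) :
  a * c != b ^+ 2 -> M - 3 != 0 -> M - 2 != 0 ->
  (forall t u, poly_op (a + b * (t + u) + c * t * u) (b + c * u) M E t
             + poly_op (a + b * (t + u) + c * t * u) (b + c * t) M E u = 0) ->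
  (size E <= 3)%N.
Proof.
move=> acb M3 M2 H.
(* The values t for which the bracket has a zero [u]; b and c do not both vanish, so at most one t
   is lost. *)
pose J := [set t : R | b + c * t != 0].
have JI : infinite_many J.
  move=> P P0; have : P * (b%:P + c *: 'X) = 0.
    apply: (infinite_poly_eq (@setT_infinite R)) => t _.
    rewrite horner0 hornerM !hornerE.
    have [->|bt] := eqVneq (b + c * t) 0; first by rewrite mulr0.
    by rewrite P0 ?mul0r.
  move=> /eqP; rewrite mulf_eq0 => /orP[/eqP //|/eqP E0].
  have C n := congr1 (fun P : {poly R} => P`_n) E0.
  have c0 : c = 0 by have := C 1%N; rewrite coefD coefZ coefC coefX coef0 /= mulr1 add0r.
  have b0 : b = 0 by have := C 0%N; rewrite coefD coefZ coefC coefX coef0 /= mulr0 addr0.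
  by move: acb; rewrite c0 b0 mulr0 expr0n eqxx.
suff E3 : E^`()^`()^`() = 0.
  apply/leq_sizeP => -[|[|[|n]]] // _; have := congr1 (fun P : {poly R} => P`_n) E3.
  by rewrite !coef_deriv coef0 => /eqP; rewrite !mulrn_eq0 /= => /eqP.
apply: (infinite_poly_eq JI) => t tJ; rewrite horner0.
have bt : b + c * t != 0 by [].
(* At this zero the slope b + c u equals (b^2 - ac) / (b + c t), nonzero because ac differs from
   b^2. *)
pose u := - (a + b * t) / (b + c * t).
have Bu : a + b * u + (b + c * u) * t = 0 by rewrite /u; field.
have bu : b + c * u != 0.
  have -> : b + c * u = (b ^+ 2 - a * c) / (b + c * t) by rewrite /u; field.
  by rewrite mulf_neq0 ?invr_eq0 // subr_eq0 eq_sym.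
pose B : {poly R} := (a + b * u)%:P + (b + c * u) *: 'X.
pose Q : {poly R} := B * B * E^`()^`() - (2 * M * (b + c * u)) *: (B * E^`())
  + (M * (M + 1) * (b + c * u) ^+ 2) *: E
  + (E^`()^`().[u] *: (B * B) - (2 * M * E^`().[u]) *: (B * (b%:P + c *: 'X))
     + (M * (M + 1) * E.[u]) *: ((b%:P + c *: 'X) * (b%:P + c *: 'X))).
have Q0 : Q = 0.
  apply: (infinite_poly_eq (@setT_infinite R)) => v _.
  rewrite horner0 -[RHS](H v u) /poly_op /weighted_op /Q /B.
  by rewrite !(hornerD, hornerN, hornerM, hornerZ, hornerC, hornerX); ring.
have := congr1 (fun P : {poly R} => P^`()^`()^`().[t]) Q0.
rewrite /= !deriv0 horner0 /Q /B.
rewrite !(derivD, derivB, derivM, derivZ, derivC, derivX, derivN, deriv0).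
rewrite !(hornerD, hornerN, hornerM, hornerZ, hornerC, hornerX, horner0).
set E5 := (E^`()^`()^`()^`()^`()).[t]; set E4 := (E^`()^`()^`()^`()).[t].
set E3 := (E^`()^`()^`()).[t]; set E2 := E^`()^`().[t]; set E1 := E^`().[t].
move=> Q3.
(* Three derivatives lower the weight from M to M - 3; at the zero of the bracket only the last term
   of the operator survives. *)
have : (a + b * u + (b + c * u) * t) * ((a + b * u + (b + c * u) * t) * E5
   - 2 * (M - 3) * (b + c * u) * E4) + (M - 3) * (M - 2) * (b + c * u) ^+ 2 * E3 = 0.
  by rewrite -[RHS]Q3; ring.
rewrite Bu mul0r add0r => /eqP.
by rewrite !mulf_eq0 (negPf M3) (negPf M2) (negPf bu) /= => /eqP.
Qed.

(** M^2 - 7M + 8 has discriminant 17 and no integer root; M(7 - M) = 8 leaves finitely many M to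
    test. *)
Lemma no_quadratic_root (m : nat) : (3 <= m)%N -> (m.+1 ^ 2 + 8)%N <> (7 * m.+1)%N.
Proof.
move=> m3 Em; have : (m.+1 <= 6)%N by rewrite leqNgt; apply/negP => m6; nia.
by move: m3 Em; case: m => [|[|[|[|[|[|?]]]]]].
Qed.

(** Once E is at most quadratic, the diagonal t = u gives twice the merged equation, which has no
    nonzero quadratic solution. The bound 3 <= m makes M - 3 nonzero for M = m + 1. *)
Lemma antisym_zero (R : realType) (a b c : R) (m : nat) (E : {poly R}) :
  (3 <= m)%N -> a * c != b ^+ 2 ->
  (forall t u, poly_op (a + b * (t + u) + c * t * u) (b + c * u) m.+1%:R E t
             + poly_op (a + b * (t + u) + c * t * u) (b + c * t) m.+1%:R E u = 0) ->
  E = 0.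
Proof.
move=> m3 acb H.
have Mn (i : nat) : (i <= 3)%N -> m.+1%:R - i%:R != 0 :> R.
  by move=> i3; rewrite subr_eq0 eqr_nat; apply/eqP; lia.
have sE : (size E <= 3)%N.
  by apply: (antisym_cubic acb _ _ H); apply: Mn.
have D v : poly_op (quadratic a b c v) (b + c * v) m.+1%:R E v = 0.
  have := H v v; have -> : a + b * (v + v) + c * v * v = quadratic a b c v.
    by rewrite /quadratic; ring.
  by move=> /eqP; rewrite -mulr2n mulrn_eq0 /= => /eqP.
have M0 : m.+1%:R != 0 :> R by rewrite pnatr_eq0.
have M1 : m.+1%:R + 1 != 0 :> R by rewrite natr1 pnatr_eq0.
have [c0|c0] := eqVneq c 0; last first.
  by apply: (diag_quadratic0 sE c0 M0 _ _ M1 D); [exact: (Mn 1%N)|exact: (Mn 2%N)].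
have b0 : b != 0.
  by apply: contra acb => /eqP b0; rewrite c0 b0 mulr0 expr0n.
apply: (diag_quadratic0_affine (a := a) sE b0 M0 _ M1); first exact: (Mn 3%N).
  have -> : m.+1%:R ^+ 2 - 7 * m.+1%:R + 8 = (m.+1 ^ 2 + 8)%:R - (7 * m.+1)%:R :> R.
    by rewrite natrD natrX natrM; ring.
  by rewrite subr_eq0 eqr_nat; apply/eqP/no_quadratic_root.
by move=> v; have := D v; rewrite c0 mul0r addr0.
Qed.

(** With w = b + c t and K = ac - b^2 one has c P = K + w^2. The solutions c P w and c P (K - w^2),
    of degrees three and four, span the space: subtracting them leaves a quadratic solution, which
    is zero. *)
Lemma veronese_diag (R : realType) (a b c : R) (E : {poly R}) :
  (size E <= 5)%N -> c != 0 ->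
  (forall v, poly_op (quadratic a b c v) (b + c * v) 3 E v = 0) ->
  exists nu0 nu1 : R, forall t, E.[t] =
    nu0 * (b + c * t) * (a * c - b ^+ 2 + (b + c * t) ^+ 2)
    + nu1 * ((a * c - b ^+ 2) ^+ 2 - (b + c * t) ^+ 4).
Proof.
move=> sE c0 H; pose K := a * c - b ^+ 2.
pose v1 : {poly R} := (b * K + b ^+ 3)%:P + (c * K + 3 * b ^+ 2 * c) *: 'X
  + (3 * b * c ^+ 2) *: 'X^2 + c ^+ 3 *: 'X^3.
pose v2 : {poly R} := (K ^+ 2 - b ^+ 4)%:P - (4 * b ^+ 3 * c) *: 'X
  - (6 * b ^+ 2 * c ^+ 2) *: 'X^2 - (4 * b * c ^+ 3) *: 'X^3 - c ^+ 4 *: 'X^4.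
have v1E t : v1.[t] = (b + c * t) * (K + (b + c * t) ^+ 2).
  by rewrite /v1 !hornerE /=; ring.
have v2E t : v2.[t] = K ^+ 2 - (b + c * t) ^+ 4.
  by rewrite /v2 !hornerE /=; ring.
have v1op v : poly_op (quadratic a b c v) (b + c * v) 3 v1 v = 0.
  rewrite /poly_op /weighted_op /quadratic /v1 /K.
  by rewrite !(derivD, derivB, derivZ, derivC, derivX, derivXn, derivMn) !hornerE /=; ring.
have v2op v : poly_op (quadratic a b c v) (b + c * v) 3 v2 v = 0.
  rewrite /poly_op /weighted_op /quadratic /v2 /K.
  by rewrite !(derivD, derivB, derivN, derivZ, derivC, derivX, derivXn, derivMn) !hornerE /=; ring.
(* Chosen to cancel the coefficients of degree four and then three. *)
pose nu1 := - E`_4 / c ^+ 4; pose nu0 := (E`_3 + nu1 * (4 * b * c ^+ 3)) / c ^+ 3.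
have E0 : E - nu0 *: v1 - nu1 *: v2 = 0.
  have n2 : (3 : R) - 2 != 0 by rewrite (_ : 3 - 2 = 1) ?oner_neq0 //; ring.
  have n1 : (3 : R) - 1 != 0 by rewrite (_ : 3 - 1 = 2%:R) ?pnatr_eq0 //; ring.
  have n3 : (3 : R) + 1 != 0 by rewrite (_ : 3 + 1 = 4%:R) ?pnatr_eq0 //; ring.
  have n0 : (3 : R) != 0 by rewrite pnatr_eq0.
  apply: (diag_quadratic0 (a := a) (b := b) _ c0 n0 n1 n2 n3) => [|v].
    apply/leq_sizeP => n n3'; rewrite !coefB !coefZ /v1 /v2.
    rewrite !(coefD, coefB, coefN, coefZ, coefC, coefX, coefXn).
    case: n n3' => [|[|[|[|[|n]]]]] // _ /=.
    - by rewrite /nu0; field.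
    - by rewrite /nu1; field.
    by rewrite nth_default ?(leq_trans sE) //; ring.
  rewrite !poly_opB H.
  have opZ s (N : {poly R}) : poly_op (quadratic a b c v) (b + c * v) 3 (s *: N) v =
     s * poly_op (quadratic a b c v) (b + c * v) 3 N v.
    by rewrite /poly_op /weighted_op !derivZ !hornerZ; ring.
  by rewrite !opZ v1op v2op; ring.
exists nu0, nu1 => t; clearbody v1 v2; have := congr1 (fun P : {poly R} => P.[t]) E0.
rewrite !(hornerD, hornerN, hornerZ) horner0 v1E v2E => /eqP; rewrite -addrA -opprD subr_eq0 => /eqP ->.
by rewrite /K; ring.
Qed.

(** * Product Segre-Veronese structures *)

Lemma tpower_sym (R : realType) (n : nat) (e : R * R) : tpower 'I_n e \in SymT R n.
Proof.
apply/SymTP => sigma; apply/ffunP => eps; rewrite !ffunE.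
rewrite [RHS](reindex_inj (@perm_inj _ sigma)) /=.
by apply: eq_bigr => r _; rewrite ffunE.
Qed.

Section Product.
Variables (R : realType) (k : nat) (d : 'I_k -> nat).
Variables (Gamma : gammas R d) (hprod : product_segre_veronese Gamma).

Lemma product_bracket j x : bracket (Gamma j) x = 1.
Proof.
rewrite hprod /bracket pairing_tpower big1 // => s _.
by rewrite /line /= mulr0 addr0.
Qed.

Lemma product_hatprod x : hatprod Gamma x = 1.
Proof. by rewrite /hatprod big1 // => j _; rewrite product_bracket expr1n. Qed.

Lemma product_decomposes p : decomposes Gamma p (fun=> (1, 0)).
Proof.
move=> j hj; exists (tpower _ (1, 0)); rewrite hprod; apply/ffunP => eps.
rewrite !ffunE (prod_slots_split hj); congr (_ * _).
  by apply: eq_bigr => r _; rewrite ffunE.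
by apply: eq_bigr => r _; rewrite ffunE.
Qed.

Lemma product_denominator p t : denominator d p (fun=> (1, 0) : R * R) t = 1.
Proof.
by rewrite /denominator big1 // => j _; rewrite /line /= mulr0 addr0 expr1n.
Qed.

Lemma product_hat_ratio s x : hat_ratio Gamma s x = 1.
Proof.
rewrite /hat_ratio /hat_poly product_hatprod invr1 scale1r big1 // => j _.
by rewrite /slope !product_bracket subrr scale0r add0r expr1n.
Qed.

End Product.

(** With one group Gamma_j lives on an empty set of slots, where a tensor power is the empty product
    1. Veronese structures are thus handled as product structures with k = 1. *)
Lemma veronese_product (R : realType) (k : nat) (d : 'I_k -> nat) (Gamma : gammas R d) :
  veronese Gamma -> product_segre_veronese Gamma.
Proof.
move=> [k1 G1] j; rewrite G1; subst k; apply/ffunP => eps; rewrite !ffunE big1 // => s _.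
case: s => s Ps; case/andP: (Ps) => /negP[].
by rewrite (ord1 j) (ord1 (tag s)).
Qed.

(** Vacuous: there is no j other than p. *)
Lemma veronese_decomposes (R : realType) (k : nat) (d : 'I_k -> nat)
    (Gamma : gammas R d) p e : veronese Gamma -> decomposes Gamma p e.
Proof. by move=> [k1 _] j hj; subst k; case/andP: (hj) => /negP[]; rewrite (ord1 j) (ord1 p). Qed.

(** A relation between B and B' becomes one between the squares after multiplication by B. *)
Lemma squares_indep_not_dep (R : realType) (k : nat) (d : 'I_k -> nat)
    (beta : Vdual R d) s : squares_indep beta s ->
  ~ lin_dep_poly s [tuple bracket beta; partial s (bracket beta)].
Proof.
move=> /lin_indepP hi [c [i ci] cE].
pose C (j : 'I_3) : {poly R} := match val j with 0%N => c ord0 | 1%N => c (lift ord0 ord0) | _ => 0 end.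
have C0 : forall j, C j = 0.
  apply: hi => x; have := cE x.
  rewrite !big_ord_recl !big_ord0 /tnth /= /C /= horner0 mul0r => E.
  by rewrite -[RHS](mulr0 (bracket beta x)) -[in RHS]E /=; ring.
have [E|E] : i = ord0 \/ i = lift ord0 ord0.
  by case: i {ci} => [[|[|//]] ?]; [left|right]; apply: val_inj.
  by move/eqP: ci; apply; rewrite E; exact: C0 (@Ordinal 3 0 isT).
by move/eqP: ci; apply; rewrite E; exact: C0 (@Ordinal 3 1 isT).
Qed.

(** A [kappa_form] whose factor is constant and absorbed into the coefficients. *)
Definition pair_form (R : realType) (k : nat) (d : 'I_k -> nat) (beta : Vdual R d)
    (s s' : slot d) (a b c : R) : Prop :=
  forall x, bracket beta x = a + b * (x s + x s') + c * x s * x s'.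

Lemma pair_or (n : nat) (q r s : 'I_n) : n = 2%N -> q != r -> s = q \/ s = r.
Proof.
move=> n2; subst n; rewrite -!val_eqE /= => qr.
have [/eqP E|sq] := eqVneq (val s) (val q); first by left; apply/eqP.
right; apply/eqP; rewrite -val_eqE; apply/eqP.
have := ltn_ord q; have := ltn_ord r; have := ltn_ord s.
by move: qr sq; rewrite /=; lia.
Qed.

Section PairForm.
Variables (R : realType) (k : nat) (d : 'I_k -> nat).
Variables (Gamma : gammas R d) (hprod : product_segre_veronese Gamma).
Variables (p : 'I_k) (dp2 : d p = 2%N) (q r : 'I_(d p)) (qr : q != r).

Let Sqr : Slot q != Slot r :> slot d. Proof. by rewrite Slot_eq. Qed.
Let Srq : Slot r != Slot q :> slot d. Proof. by rewrite Slot_eq eq_sym. Qed.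

(** All brackets of Gamma are 1, so the bracket of beta is a sum of functions of separate groups,
    and its slope in x_q involves x_r only. *)
Lemma product_slope (beta : Vdual R d) x x' : beta \in hspace Gamma ->
  x (Slot r) = x' (Slot r) -> slope beta (Slot q) x = slope beta (Slot q) x'.
Proof.
move=> /hspace_bracket[T [_ TE]] xr.
have BE y t : bracket beta (upd y (Slot q) t) =
    contract (T p) (fun s => if s == q then t else y (Slot r))
    + \sum_(j | j != p) contract (T j) (fun i => y (Slot i)).
  rewrite TE (bigD1 p) //= (product_bracket hprod) mulr1; congr (_ + _).
    congr contract; apply/funext => s; have [->|->] := pair_or s dp2 qr.
      by rewrite upd_same eqxx.
    by rewrite upd_other ?Srq // eq_sym (negPf qr).
  apply: eq_bigr => j jp; rewrite (product_bracket hprod) mulr1.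
  by rewrite contract_group_upd // eq_sym.
by rewrite /slope !BE xr; ring.
Qed.

(** The slope is kappa (b + c x_r) and depends on x_r only; at a value of x_r where b + c x_r is
    nonzero, kappa must be constant. If ac = b^2, the form would satisfy a linear relation with its
    derivative. *)
Lemma product_pair_form (beta : Vdual R d) kappa a b c : beta \in hspace Gamma ->
  ~ lin_dep_poly (Slot q) [tuple bracket beta; partial (Slot q) (bracket beta)] ->
  kappa_form beta (Slot q) (Slot r) kappa a b c ->
  exists a' b' c', pair_form beta (Slot q) (Slot r) a' b' c' /\ a' * c' != b' ^+ 2.
Proof.
move=> beta_h nd hk.
(* The excluded relations in the form used below; for ac = b^2 and b nonzero take (l, m) = (b,
   -a). *)
have dep (l m : R) : (l != 0) || (m != 0) ->
    (forall x, l * bracket beta x + (m - l * x (Slot q)) * slope beta (Slot q) x = 0) -> False.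
  move=> lm H; apply: nd.
  exists (fun i : 'I_2 => if val i == 0%N then l%:P else m%:P - l *: 'X).
    case/orP: (lm) => [l0|m0]; first by exists ord0; rewrite /= polyC_eq0.
    exists (lift ord0 ord0); apply/eqP => /= /(congr1 (fun P : {poly R} => P.[0])).
    by rewrite !hornerE /= subr0 => m0'; rewrite m0' eqxx in m0.
  move=> x; rewrite !big_ord_recl big_ord0 /tnth /= partial_bracket !hornerE /=.
  by rewrite -[RHS](H x) /=; ring.
have [u bu] : exists u, b + c * u != 0.
  apply: contrapT => h; have bc u : b + c * u = 0.
    by apply/eqP; apply: contraT => bu; case: h; exists u.
  apply: (dep 0 1); first by rewrite oner_neq0 orbT.
  by move=> x; rewrite (kappa_slope _ Sqr hk) bc; ring.
pose k0 := slope beta (Slot q) (upd (fun=> 0) (Slot r) u) / (b + c * u).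
have kE x : kappa x = k0.
  rewrite /k0 (@product_slope beta _ (upd x (Slot r) u)) ?upd_same //.
  by rewrite (kappa_slope _ Sqr hk) upd_same mulfK // ((proj1 hk) x u).2.
have BE : pair_form beta (Slot q) (Slot r) (k0 * a) (k0 * b) (k0 * c).
  by move=> x; rewrite (proj2 hk) kE; ring.
have SE x : slope beta (Slot q) x = k0 * b + k0 * c * x (Slot r).
  by rewrite (kappa_slope _ Sqr hk) kE; ring.
exists (k0 * a), (k0 * b), (k0 * c); split=> //; apply/eqP => E.
have [b0|b0] := eqVneq (k0 * b) 0; last first.
  apply: (dep (k0 * b) (- (k0 * a))); first by rewrite b0.
  move=> x; transitivity (x (Slot r) * ((k0 * b) ^+ 2 - k0 * a * (k0 * c))).
    by rewrite BE SE; ring.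
  by rewrite E subrr mulr0.
have [a0|a0] := eqVneq (k0 * a) 0; last first.
  apply: (dep 0 1); first by rewrite oner_neq0 orbT.
  move=> x; move/eqP: E; rewrite b0 expr0n /= mulf_eq0 (negPf a0) /= => /eqP c0.
  by rewrite SE b0 c0; ring.
apply: (dep 1 0); first by rewrite oner_neq0.
by move=> x; rewrite BE SE a0 b0; ring.
Qed.

Variables (beta : Vdual R d) (a b c : R).
Hypotheses (beta_h : beta \in hspace Gamma).
Hypothesis hB : pair_form beta (Slot q) (Slot r) a b c.

Lemma pair_form_slope x s : slope beta s x =
  if s == Slot q then b + c * x (Slot r)
  else if s == Slot r then b + c * x (Slot q) else 0.
Proof.
rewrite /slope !hB; have [->|sq] := eqVneq s (Slot q).
  by rewrite !upd_same !upd_other 1?eq_sym //; ring.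
have [->|sr] := eqVneq s (Slot r).
  by rewrite !upd_same !upd_other //; ring.
by rewrite !upd_other 1?eq_sym // subrr.
Qed.

Let e1 : 'I_k -> R * R := fun=> (1, 0).

(** The remaining terms of the equation are symmetric in [x_q] and [x_r], so
    that only the difference of the two numerators enters after exchanging the
    variables and adding. *)
Lemma product_antisym (I : slot d -> set R) (A : slot d -> R -> R) (N N' : {poly R}) :
  extremal_solution Gamma beta I A ->
  slot_numerator e1 I A q N -> slot_numerator e1 I A r N' ->
  forall t u, let m := (msize d).+1%:R in
    poly_op (a + b * (t + u) + c * t * u) (b + c * u) m (N - N') t
    + poly_op (a + b * (t + u) + c * t * u) (b + c * t) m (N - N') u = 0.
Proof.
move=> hA hN hN'; have hp : decomposes Gamma p e1 by exact: product_decomposes.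
have [alpha alpha_h hE] := equation_at hp hA q.
have [x0 bx0] := box_point hA; have [hI hsm hNs _] := hA.
pose M : R := (msize d).+1%:R.
(* Beta has slope zero at the slots of the other groups, so their operators reduce to B^2 A_s'';
   [k0] collects A_s'' / Delta_s. *)
pose k0 := \sum_(s | tag s != p) jet2 (A s) 1 (x0 s) / Delta s x0.
pose al := pair_coef alpha q r x0.
pose B t u := a + b * (t + u) + c * t * u.
(* [W] is symmetric, so (t - u) W changes sign under the exchange and cancels in the sum. *)
pose W t u := al.1.1 + al.1.2 * (t + u) + al.2 * t * u - B t u ^+ 2 * k0.
have H0 t u : I (Slot q) t -> I (Slot r) u ->
    poly_op (B t u) (b + c * u) M N t - poly_op (B t u) (b + c * t) M N' u = (t - u) * W t u.
  move=> It Iu; pose x := upd x0 (Slot r) u.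
  have bx : forall s, I s (x s) by exact: box_upd.
  have byt : forall s, I s (upd x (Slot q) t s) by exact: box_upd.
  have xr : x (Slot r) = u by rewrite /x upd_same.
  have yB : bracket beta (upd x (Slot q) t) = B t u.
    by rewrite hB upd_same upd_other // xr.
  have DqE : Delta (Slot q) (upd x (Slot q) t) = t - u.
    rewrite /Delta /= (bigD1 r) /= 1?eq_sym // big1 => [|s /andP[sq sr]].
      by rewrite mulr1 upd_same upd_other ?xr.
    by have [E|E] := pair_or s dp2 qr; [rewrite E eqxx in sq|rewrite E eqxx in sr].
  have DrE : Delta (Slot r) (upd x (Slot q) t) = u - t.
    rewrite /Delta /= (bigD1 q) //= big1 => [|s /andP[sq sr]].
      by rewrite mulr1 upd_same upd_other ?xr.
    by have [E|E] := pair_or s dp2 qr; [rewrite E eqxx in sr|rewrite E eqxx in sq].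
  have tu : t - u != 0.
    by have [/(_ (Slot q)) D0 _ _] := hNs _ byt; rewrite -DqE.
  have := hE x t bx It; rewrite /= (slot_numeratorP hA hN) // product_denominator.
  rewrite (product_bracket hprod) !mulr1 mul1r yB DqE pair_form_slope eqxx xr.
  rewrite (bigD1 r) /= 1?eq_sym // big1 ?addr0 => [|s /andP[sq sr]]; last first.
    by have [E|E] := pair_or s dp2 qr; [rewrite E eqxx in sq|rewrite E eqxx in sr].
  rewrite DrE mulr1 pair_form_slope (negPf Srq) eqxx upd_same xr product_hat_ratio //.
  have [oI _ _] := hI (Slot r); have [sA _] := hsm (Slot r).
  rewrite addn1 (jet_op_poly _ _ _ oI sA _ Iu (N := N')); last first.
    by move=> v Iv; rewrite hornerC -hN' // product_denominator.
  have -> : \sum_(s | tag s != p)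
      jet_op (B t u) (slope beta s (upd x (Slot q) t)) M (A s) (hat_ratio Gamma s x) (x s)
      / (Delta s x * bracket (Gamma (tag s)) (upd x (Slot q) t)) = B t u ^+ 2 * k0.
    rewrite mulr_sumr; apply: eq_bigr => s sp.
    have sq : s != Slot q by apply: contraNneq sp => ->.
    have sr : s != Slot r by apply: contraNneq sp => ->.
    rewrite pair_form_slope (negPf sq) (negPf sr) (product_bracket hprod) mulr1.
    have xs : x s = x0 s by rewrite /x upd_other.
    rewrite product_hat_ratio // xs /jet_op /weighted_op.
    have -> : Delta s x = Delta s x0.
      rewrite !DeltaE /x upd_other //; apply: eq_bigr => s' /andP[/eqP ss' _].
      by rewrite upd_other //; apply: contraNneq sp => E; rewrite -ss' E.
    by rewrite mulrA; congr (_ / _); ring.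
  have -> : bracket alpha (upd x (Slot q) t) =
      al.1.1 + al.1.2 * (t + u) + al.2 * t * u.
    by rewrite /x -(upd_comm _ _ _ Sqr) (bracket_pair hp alpha_h qr).
  rewrite -/M => E.
  have ut : u - t != 0 by rewrite -opprB oppr_eq0.
  by rewrite /W -E; field; rewrite tu ut.
(* The identity is known for t in I_q and u in I_r only; it is extended to all pairs before t and u
   are exchanged. *)
have polyB (f : R -> R -> R) : (forall u, polyfun (f^~ u)) -> (forall t, polyfun (f t)) ->
    forall g : R -> R -> R, (forall u, polyfun (g^~ u)) -> (forall t, polyfun (g t)) ->
    (forall t u, I (Slot q) t -> I (Slot r) u -> f t u = g t u) -> forall t u, f t u = g t u.
  move=> f1 f2 g g1 g2 fg t u.
  apply: (infinite_polyfun_eq (box_infinite hA (Slot r)) (f2 t) (g2 t)) => u' Iu.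
  apply: (infinite_polyfun_eq (box_infinite hA (Slot q)) (f1 u') (g1 u')) => t' It.
  exact: fg.
have aff (x y : R) : polyfun (fun t => x + y * t).
  by apply: polyfunD; [exact: polyfunC|apply: polyfunM; [exact: polyfunC|exact: polyfun_id]].
have B1 u : polyfun (B^~ u).
  by apply: polyfun_eq (aff (a + b * u) (b + c * u)) => t; rewrite /B; ring.
have B2 t : polyfun (B t).
  by apply: polyfun_eq (aff (a + b * t) (b + c * t)) => u; rewrite /B; ring.
have opP (F G K0 K1 K2 : R -> R) : polyfun F -> polyfun G -> polyfun K0 -> polyfun K1 ->
    polyfun K2 -> polyfun (fun t => weighted_op (F t) (G t) M (K0 t) (K1 t) (K2 t)).
  move=> hF hG h0 h1 h2; apply: polyfunD; first apply: polyfunB.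
  - by apply: polyfunM => //; exact: polyfunX.
  - by do 2!apply: polyfunM => //; apply: polyfunM => //; exact: polyfunC.
  by apply: polyfunM => //; apply: polyfunM; [exact: polyfunC|exact: polyfunX].
have hor := @polyfun_horner R.
have H : forall t u, poly_op (B t u) (b + c * u) M N t - poly_op (B t u) (b + c * t) M N' u
    = (t - u) * W t u.
  apply: polyB => [u|t|u|t|t u]; last exact: H0.
  - by apply: polyfunB; apply: opP => //; exact: polyfunC.
  - by apply: polyfunB; apply: opP => //; exact: polyfunC.
  - apply: polyfunM; first by apply: polyfunB; [exact: polyfun_id|exact: polyfunC].
    apply: polyfunB; last by apply: polyfunM; [exact: polyfunX|exact: polyfunC].
    by apply: polyfun_eq (aff (al.1.1 + al.1.2 * u) (al.1.2 + al.2 * u)) => t; ring.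
  apply: polyfunM; first by apply: polyfunB; [exact: polyfunC|exact: polyfun_id].
  apply: polyfunB; last by apply: polyfunM; [exact: polyfunX|exact: polyfunC].
  by apply: polyfun_eq (aff (al.1.1 + al.1.2 * t) (al.1.2 + al.2 * t)) => u; ring.
move=> t u m; have Btu : B u t = B t u by rewrite /B; ring.
have W0 : (t - u) * W t u + (u - t) * W u t = 0 by rewrite /W Btu; ring.
rewrite -[RHS]W0 -!H Btu !poly_opB /B -/m; ring.
Qed.

End PairForm.

Lemma is_ell_uniq (R : realType) (k : nat) (d : 'I_k -> nat) (Gamma : gammas R d)
    (beta : Vdual R d) s l l' :
  is_ell Gamma beta s l -> is_ell Gamma beta s l' -> l = l'.
Proof. by move=> [h1 m1] [h2 m2]; apply/eqP; rewrite eqn_leq m1 // m2. Qed.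

Lemma size_affine (R : realType) (a b : R) : (size (a%:P + b *: 'X)%R <= 2)%N.
Proof.
rewrite (leq_trans (size_polyD _ _)) // geq_max (leq_trans (size_polyC_leq1 _)) //=.
by rewrite (leq_trans (size_scale_leq _ _)) // size_polyX.
Qed.

Lemma size_mulS (R : realType) (P Q : {poly R}) i j :
  (size P <= i.+1)%N -> (size Q <= j.+1)%N -> (size (P * Q)%R <= (i + j).+1)%N.
Proof.
move=> Pi Qj; apply: leq_trans (size_polyMleq _ _) _.
by rewrite -subn1 leq_subLR add1n -addnS -addSn; exact: leq_add.
Qed.

Lemma prod_pair (R : realType) (n : nat) (F : 'I_n -> R) (q r : 'I_n) :
  n = 2%N -> q != r -> \prod_s F s = F q * F r.
Proof.
move=> n2 qr; rewrite (bigD1 q) //= (bigD1 r) 1?eq_sym //= big1 ?mulr1 //.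
move=> s /andP[sq sr].
by have [E|E] := pair_or s n2 qr; [rewrite E eqxx in sq|rewrite E eqxx in sr].
Qed.

(** * The value of ell for product structures *)

Section PairEll.
Variables (R : realType) (k : nat) (d : 'I_k -> nat) (d_gt0 : forall j, (0 < d j)%N).
Variables (Gamma : gammas R d) (hprod : product_segre_veronese Gamma).
Variables (p : 'I_k) (dp2 : d p = 2%N) (q r : 'I_(d p)) (qr : q != r).
Variables (beta : Vdual R d) (a b c : R).
Hypothesis hB : pair_form beta (Slot q) (Slot r) a b c.

Let Sqr : Slot q != Slot r :> slot d. Proof. by rewrite Slot_eq. Qed.
Let Srq : Slot r != Slot q :> slot d. Proof. by rewrite Slot_eq eq_sym. Qed.

Let M : R := (msize d + 1)%:R.

(** The coefficients of f, f' and f'' in [weighted_op]: what [coefficient] reduces to when all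
    brackets of Gamma are 1. *)
Definition unit_coef (n : nat) (B b1 : R) : R :=
  match n with
  | 0%N => M * (M + 1) * b1 ^+ 2
  | 1%N => - 2 * M * b1 * B
  | _ => B ^+ 2
  end.

Lemma coefficient_unit Mf s n y : nonsingular Gamma beta y -> (n <= 2)%N ->
  coefficient Gamma beta Mf s n y =
  Mf y / Delta s y * unit_coef n (bracket beta y) (slope beta s y).
Proof.
move=> [D0 _ B0] n2; rewrite /coefficient (iter_partial s) /prefactor.
rewrite (product_hatprod hprod) (product_bracket hprod) !mulr1.
pose b0 := bracket beta (upd y s 0); pose b1 := slope beta s y.
pose U := [set u : R | (b0%:P + b1 *: 'X).[u] != 0].
have oU : open U by exact: open_denominator_neq0.
have bE u : bracket beta (upd y s u) = b0 + b1 * u by rewrite bracket_affine mulrC.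
have Ub u : U u -> b0 + b1 * u != 0 by rewrite /U /= !hornerE.
have ByE : bracket beta y = b0 + b1 * y s by rewrite -bE upd_id.
have Uy : U (y s) by rewrite /U /= !hornerE -ByE.
have -> : (fun u => weight Gamma beta (upd y s u)) =
    (fun u => ((b0 + b1 * u) ^+ (msize d + 1))^-1).
  by apply/funext => u; rewrite /weight (product_hatprod hprod) mul1r bE.
have dw i := deriv_on_affineXV (I := U) i Ub.
have E3 : (msize d + 3 = (msize d + 1).+2)%N by rewrite !addnS.
rewrite -/b1 E3; case: n n2 => [|[|[|//]]] _; rewrite ?subn0 ?subSS ?subn0 /unit_coef.
- have d2 := deriv_onM (deriv_onC (I := U) (- (msize d + 1)%:R * b1)) (dw (msize d + 1).+1).
  rewrite (derive1n2_on oU (dw (msize d + 1)%N) d2 Uy) -ByE bin0 /M !exprS -natr1.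
  by field; rewrite ?D0 ?expf_neq0 ?B0.
- rewrite /derive1n /= (deriv_onE (dw (msize d + 1)%N) Uy) -ByE bin1 /M !exprS.
  by field; rewrite ?D0 ?expf_neq0 ?B0.
rewrite /derive1n /= -ByE binn !exprS.
by field; rewrite ?D0 ?expf_neq0 ?B0.
Qed.

Let DqE (x : slot d -> R) t : Delta (Slot q) (upd x (Slot q) t) = t - x (Slot r).
Proof.
rewrite /Delta /= (bigD1 r) /= 1?eq_sym // big1 => [|s /andP[sq sr]].
  by rewrite mulr1 upd_same upd_other.
by have [E|E] := pair_or s dp2 qr; [rewrite E eqxx in sq|rewrite E eqxx in sr].
Qed.

Let DrE (x : slot d -> R) t : Delta (Slot r) (upd x (Slot q) t) = x (Slot r) - t.
Proof.
rewrite /Delta /= (bigD1 q) //= big1 => [|s /andP[sq sr]].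
  by rewrite mulr1 upd_same upd_other.
by have [E|E] := pair_or s dp2 qr; [rewrite E eqxx in sr|rewrite E eqxx in sq].
Qed.

Let DsE s (x : slot d -> R) t : tag s != p -> Delta s (upd x (Slot q) t) = Delta s x.
Proof.
move=> sp; rewrite !DeltaE upd_other; last by apply: contraNneq sp => ->.
apply: eq_bigr => s' /andP[/eqP ss' _].
by rewrite upd_other //; apply: contraNneq sp => E; rewrite -ss' E.
Qed.

Let BE x t : bracket beta (upd x (Slot q) t) =
  ((a + b * x (Slot r))%:P + (b + c * x (Slot r)) *: 'X).[t].
Proof. by rewrite hB upd_same upd_other // !hornerE; ring. Qed.

Let slot_cases (s : slot d) : s != Slot q -> s = Slot r \/ tag s != p.
Proof.
move=> sq; have [/slot_in_group[s' E]|] := tag s =P p; last by move/eqP; right.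
left; rewrite E; rewrite E Slot_eq in sq.
by have [E'|->] := pair_or s' dp2 qr; [rewrite E' eqxx in sq|].
Qed.

(** Within the group Delta_q / Delta_r = -1, so the degree is at most 2, as for Delta_q times a
    bracket. A slot of another group contributes Delta_q B^2 of degree 3, and such slots exist
    exactly when k differs from 1. *)
Definition pair_ell : nat := ((k != 1) + 2)%N.

Lemma pair_degrees_le :
  degrees_le Gamma beta (fun x => Delta (Slot q) x * hatprod Gamma x) (Slot q) pair_ell.
Proof.
split=> [s n sq n2 x|alpha alpha_h x].
  set u := x (Slot r); pose pB := (a + b * u)%:P + (b + c * u) *: 'X.
  have sB : (size pB <= 2)%N by exact: size_affine.
  have [sr|sp] := slot_cases sq.
    pose pL := b%:P + c *: 'X; have sL : (size pL <= 2)%N by exact: size_affine.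
    have pLE t : pL.[t] = b + c * t by rewrite /pL !hornerE.
    pose P := - match n with 0%N => (M * (M + 1)) *: (pL * pL)
              | 1%N => (- 2 * M) *: (pL * pB) | _ => pB * pB end.
    exists P.
      apply: (@leq_trans 3); last by rewrite /pair_ell addn2 !ltnS.
      rewrite /P size_polyN; case: n {n2 P} => [|[|n]]; last exact: (@size_mulS _ _ _ 1 1).
        by apply: leq_trans (size_scale_leq _ _) _; exact: (@size_mulS _ _ _ 1 1).
      by apply: leq_trans (size_scale_leq _ _) _; exact: (@size_mulS _ _ _ 1 1).
    move=> t Nt; rewrite coefficient_unit // sr (product_hatprod hprod) mulr1 DqE DrE.
    have [/(_ (Slot q)) D0 _ _] := Nt; rewrite DqE in D0.
    have -> : (t - x (Slot r)) / (x (Slot r) - t) = -1.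
      have D1 : x (Slot r) - t != 0 by rewrite -opprB oppr_eq0.
      by field.
    rewrite mulN1r /P hornerN; congr (- _).
    rewrite (pair_form_slope qr hB) (negPf Srq) eqxx upd_same BE -/u -/pB.
    by case: n n2 {P} => [|[|[|//]]] _ /=; rewrite ?hornerZ ?hornerM ?pLE; ring.
  have k1 : (k != 1)%N.
    apply: contra sp => /eqP k1; move: (tag s) p; rewrite k1 => i j.
    by rewrite (ord1 i) (ord1 j).
  pose P := if n == 2%N then (Delta s x)^-1 *: (('X - u%:P) * (pB * pB)) else 0.
  exists P.
    rewrite /pair_ell k1 /P; case: eqP => _; last by rewrite size_poly0.
    apply: leq_trans (size_scale_leq _ _) _; apply: (@size_mulS _ _ _ 1 2).
      by rewrite size_XsubC.
    exact: (@size_mulS _ _ _ 1 1).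
  move=> t Nt; rewrite coefficient_unit // (product_hatprod hprod) mulr1 DqE DsE //.
  have sr : s != Slot r by apply: contraNneq sp => ->.
  rewrite (pair_form_slope qr hB) (negPf sr) (negPf sq) BE -/u -/pB /P.
  case: n n2 {P} => [|[|[|//]]] _ /=; rewrite ?horner0 /unit_coef; [ring|ring|].
  by rewrite hornerZ !hornerM hornerXsubC; ring.
exists (('X - (x (Slot r))%:P) * ((bracket alpha (upd x (Slot q) 0))%:P
    + slope alpha (Slot q) x *: 'X)).
  apply: (@leq_trans 3); last by rewrite /pair_ell addn2 !ltnS.
  by apply: (@size_mulS _ _ _ 1 1); [rewrite size_XsubC|exact: size_affine].
move=> t Nt; rewrite (product_hatprod hprod) mulr1 DqE bracket_affine.
by rewrite hornerM hornerXsubC !hornerE; ring.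
Qed.

Hypothesis acb : a * c != b ^+ 2.

(** Distinct coordinates; the shift by [n] avoids the root of [b + c u]. *)
Let grid (n : nat) (s : slot d) : R := (enum_rank s + n).+1%:R.

Let grid_inj n s s' : grid n s = grid n s' -> s = s'.
Proof.
by rewrite /grid => /eqP; rewrite eqr_nat eqSS eqn_add2r => /eqP/val_inj/enum_rank_inj.
Qed.

(** A line on which the upper bound is attained: b + c x_r nonzero gives B exact degree one in x_q,
    and x_r > 0 keeps the coefficient 1 + x_r nonzero for the tensor used when k = 1. *)
Lemma generic_line : exists x, [/\ b + c * x (Slot r) != 0, 0 < x (Slot r),
  (forall s, tag s != p -> Delta s x != 0) &
  infinite_many [set t : R | nonsingular Gamma beta (upd x (Slot q) t)]].
Proof.
have [n bn] : exists n, b + c * grid n (Slot r) != 0.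
  apply: contrapT => h; have H n : b + c * grid n (Slot r) = 0.
    by apply/eqP; apply: contraT => bn; case: h; exists n.
  have c0 : c = 0.
    have E0 := H 0%N; have E1 := H 1%N; rewrite /grid addn0 in E0.
    rewrite /grid addn1 -natr1 mulrDr mulr1 addrA E0 add0r in E1.
    exact: E1.
  have := H 0%N; rewrite c0 mul0r addr0 => b0.
  by move: acb; rewrite c0 b0 mulr0 expr0n eqxx.
exists (grid n); split=> [//||s _|].
- by rewrite /grid ltr0n.
- rewrite DeltaE; apply/prodf_neq0 => s' /andP[_ s's].
  by rewrite subr_eq0; apply: contra s's => /eqP/grid_inj ->.
move=> P P0; set u := grid n (Slot r) in bn *.
(* The added factors vanish at all singular points of the line. *)
have : P * (('X - u%:P) * ((a + b * u)%:P + (b + c * u) *: 'X)) = 0.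
  apply: (infinite_poly_eq (@setT_infinite R)) => t _; rewrite horner0 !hornerM hornerXsubC.
  rewrite -BE; have [tu|tu] := eqVneq (t - u) 0; first by rewrite tu mul0r mulr0.
  have [B0|B0] := eqVneq (bracket beta (upd (grid n) (Slot q) t)) 0.
    by rewrite B0 !mulr0.
  rewrite P0 ?mul0r //; split=> // [s|j]; last by rewrite product_bracket // oner_eq0.
  have [->|sq] := eqVneq s (Slot q); first by rewrite DqE.
  have [->|sp] := slot_cases sq; first by rewrite DrE -opprB oppr_eq0.
  rewrite DsE // DeltaE; apply/prodf_neq0 => s' /andP[_ s's].
  by rewrite subr_eq0; apply: contra s's => /eqP/grid_inj ->.
move=> /eqP; rewrite !mulf_eq0 polyXsubC_eq0 /= => /orP[/eqP //|/eqP E].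
have := congr1 (fun P : {poly R} => P`_1) E; rewrite coefD coefZ coefC coefX coef0 /=.
by rewrite mulr1 add0r => bu; rewrite bu eqxx in bn.
Qed.

(** For k = 1 degree 2 is attained by the right-hand side of the power of (1, 1), namely (t - u)(1 +
    u)(1 + t); otherwise degree 3 is attained by the coefficient at A_s'' for a slot s outside the
    group. *)
Lemma pair_is_ell : is_ell Gamma beta (Slot q) pair_ell.
Proof.
split; first exact: pair_degrees_le.
move=> n [hc hr]; have [x [bu u0 Ds xinf]] := generic_line.
set u := x (Slot r) in bu u0 *.
pose pB := (a + b * u)%:P + (b + c * u) *: 'X.
have sB : size pB = 2%N.
  by rewrite /pB addrC size_polyDl size_scale ?size_polyX // (leq_ltn_trans (size_polyC_leq1 _)).
have pB0 : pB != 0 by rewrite -size_poly_eq0 sB.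
have Xu0 : 'X - u%:P != 0 :> {poly R} by rewrite polyXsubC_eq0.
rewrite /pair_ell; have [k1|k1] := eqVneq k 1%N; rewrite /= ?add0n ?add1n.
  have [P Ps PE] := hr _ (ins_hspace Gamma (tpower_sym (d p) (1, 1))) x.
  pose Q := (1 + u)%:P + (1 + u) *: 'X.
  have u1 : 1 + u != 0 by rewrite lt0r_neq0 // addr_gt0.
  have sQ : size Q = 2%N.
    by rewrite /Q addrC size_polyDl size_scale ?size_polyX // (leq_ltn_trans (size_polyC_leq1 _)).
  have E : P = ('X - u%:P) * Q.
    apply: (infinite_poly_eq xinf) => t Nt; rewrite -PE // (product_hatprod hprod) mulr1 DqE.
    rewrite bracket_ins (product_bracket hprod) mulr1 contract_tpower (prod_pair _ dp2 qr).
    by rewrite upd_same upd_other // -/u hornerM hornerXsubC /line /Q !hornerE /=; ring.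
  have : size P = 3%N by rewrite E size_mul // ?size_XsubC ?sQ // -size_poly_eq0 sQ.
  by move=> sP; move: Ps; rewrite sP.
have [j jp] : exists j : 'I_k, j != p.
  apply/existsP; apply: contraT; rewrite negb_exists => /forallP jp.
  have k2 : (1 < k)%N by rewrite ltn_neqAle eq_sym k1 (leq_ltn_trans _ (ltn_ord p)).
  have /eqP E0 := negbNE (jp (Ordinal (ltnW k2))).
  have /eqP E1 := negbNE (jp (Ordinal k2)).
  by have := congr1 val (etrans E0 (esym E1)).
pose s : slot d := Slot (Ordinal (d_gt0 j)).
have sp : tag s != p by [].
have sq : s != Slot q by apply: contraNneq sp => ->.
have sr : s != Slot r by apply: contraNneq sp => ->.
have [P Ps PE] := hc s 2%N sq isT x.
have E : P = (Delta s x)^-1 *: (('X - u%:P) * (pB * pB)).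
  apply: (infinite_poly_eq xinf) => t Nt; rewrite -PE // coefficient_unit //.
  rewrite (product_hatprod hprod) mulr1 DqE DsE // BE -/u -/pB /unit_coef.
  by rewrite hornerZ !hornerM hornerXsubC; ring.
have : size P = 4%N.
  rewrite E size_scale ?invr_eq0 ?Ds // !size_mul ?mulf_neq0 // size_XsubC sB //.
by move=> sP; move: Ps; rewrite sP.
Qed.

End PairEll.

(** * An element of h realising the dependent diagonal *)

Section PairWitness.
Variables (R : realType) (k : nat) (d : 'I_k -> nat).
Variables (Gamma : gammas R d) (hprod : product_segre_veronese Gamma).
Variables (p : 'I_k) (dp2 : d p = 2%N) (q r : 'I_(d p)) (qr : q != r).

Let Sqr : Slot q != Slot r :> slot d. Proof. by rewrite Slot_eq. Qed.

(** Its bracket is (1 + x)(1 + y) + (1 - x)(1 - y) = 2 + 2xy, with a = c = 2 and b = 0, so that ac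
    differs from b^2. *)
Definition pair_witness : Vdual R d :=
  ins (P := xpredT) (j := p) (erefl true) (tpower _ (1, 1)) (Gamma p)
  + ins (P := xpredT) (j := p) (erefl true) (tpower _ (1, -1)) (Gamma p).

Lemma pair_witness_hspace : pair_witness \in hspace Gamma.
Proof. by apply: rpredD; apply: ins_hspace; exact: tpower_sym. Qed.

Lemma pair_witness_form : pair_form pair_witness (Slot q) (Slot r) 2 0 2.
Proof.
move=> x; rewrite bracketD !bracket_ins (product_bracket hprod) !mulr1 !contract_tpower.
by rewrite !(prod_pair _ dp2 qr) /line /=; ring.
Qed.

Lemma pair_witness_neq0 : pair_witness != 0.
Proof.
apply/eqP => E; have := pair_witness_form (fun=> 0); rewrite E bracket0 !mul0r !mulr0 !addr0.
by move=> /esym/eqP; rewrite pnatr_eq0.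
Qed.

Lemma pair_witness_bracket x t u :
  bracket pair_witness (upd (upd x (Slot q) t) (Slot r) u) = 2 + 2 * t * u.
Proof.
by rewrite pair_witness_form upd_same upd_other // upd_same mul0r addr0.
Qed.

Lemma pair_witness_slope x t u :
  slope pair_witness (Slot q) (upd (upd x (Slot q) t) (Slot r) u) = 2 * u.
Proof.
by rewrite (pair_form_slope qr pair_witness_form) eqxx upd_same add0r.
Qed.

Lemma pair_witness_squares_indep : squares_indep pair_witness (Slot q).
Proof.
apply/lin_indepP => C CE.
have H t u : (C ord0).[t] * (2 + 2 * t * u) ^+ 2
    + (C (lift ord0 ord0)).[t] * ((2 + 2 * t * u) * (2 * u))
    + (C (lift ord0 (lift ord0 ord0))).[t] * (2 * u) ^+ 2 = 0.
  have := CE (upd (upd (fun=> 0) (Slot q) t) (Slot r) u).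
  rewrite !big_ord_recl big_ord0 /tnth /= partial_bracket pair_witness_bracket.
  by rewrite pair_witness_slope upd_other // upd_same => E; rewrite -[RHS]E /=; ring.
(* The value u = 0 isolates the first coefficient; the difference of u = 1 and u = -1 is then eight
   times the second. *)
have z0 : C ord0 = 0.
  apply: (infinite_poly_eq (@setT_infinite R)) => t _; rewrite horner0.
  by have := H t 0; rewrite !mulr0 !addr0 expr0n /= mulr0 addr0; lra.
have z1 : C (lift ord0 ord0) = 0.
  apply: (infinite_poly_eq (@setT_infinite R)) => t _; rewrite horner0.
  by have := H t 1; have := H t (-1); rewrite z0 horner0; nra.
have z2 : C (lift ord0 (lift ord0 ord0)) = 0.
  apply: (infinite_poly_eq (@setT_infinite R)) => t _; rewrite horner0.
  by have := H t 1; rewrite z0 z1 !horner0; lra.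
case=> [[|[|[|//]]] i]; [rewrite -[RHS]z0|rewrite -[RHS]z1|rewrite -[RHS]z2];
  by congr C; exact: val_inj.
Qed.

Lemma pair_witness_merged_dep : merged_dep pair_witness (Slot q) (Slot r).
Proof.
move=> /lin_indepP hi.
pose C (i : 'I_2) : {poly R} := if val i == 0%N then 'X else - (1 + 'X^2).
have /(_ ord0) : forall i, C i = 0.
  apply: hi => x; rewrite !big_ord_recl big_ord0 /tnth /= partial_bracket /on_diagonal /C /=.
  rewrite -[x in upd x (Slot r)](upd_id x (Slot q)) pair_witness_bracket pair_witness_slope.
  by rewrite !hornerE /=; ring.
by rewrite /C /= => /eqP; rewrite polyX_eq0.
Qed.

Lemma pair_witness_is_ell : (forall j, (0 < d j)%N) ->
  is_ell Gamma pair_witness (Slot q) (pair_ell k).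
Proof.
move=> d_gt0; apply: (pair_is_ell d_gt0 hprod dp2 qr pair_witness_form).
by rewrite expr0n /= mulf_neq0 // pnatr_eq0.
Qed.

End PairWitness.

(** * Occurrence of the dependent cases *)

Lemma ord_eq1 (n : nat) (i j : 'I_n) : n = 1%N -> i = j.
Proof. by move=> n1; subst n; rewrite (ord1 i) (ord1 j). Qed.

Section ProductCases.
Variables (R : realType) (k : nat) (d : 'I_k -> nat) (d_gt0 : forall j, (0 < d j)%N).
Variables (Gamma : gammas R d) (hprod : product_segre_veronese Gamma) (p : 'I_k).

Lemma msize1 : k = 1%N -> msize d = d p.
Proof.
move=> k1; rewrite /msize (bigD1 p) //= big1 ?addn0 // => j; case/negP.
by move: j p; rewrite k1 => i i'; rewrite (ord1 i) (ord1 i').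
Qed.

Lemma k_gt0 : (0 < k)%N.
Proof. exact: leq_ltn_trans (leq0n _) (ltn_ord p). Qed.

Lemma pair_ell_cases : (k = 1%N /\ pair_ell k = 2%N) \/ ((2 <= k)%N /\ pair_ell k = 3%N).
Proof.
rewrite /pair_ell; have [->|k1] := eqVneq k 1%N; [by left|right; split=> //].
by rewrite ltn_neqAle eq_sym k1 k_gt0.
Qed.

Lemma product_pair_structure (q r : 'I_(d p)) beta ell : d p = 2%N -> q != r ->
  beta \in hspace Gamma -> beta != 0 -> is_ell Gamma beta (Slot q) ell ->
  ~ lin_dep_poly (Slot q) [tuple bracket beta; partial (Slot q) (bracket beta)] ->
  merged_dep beta (Slot q) (Slot r) ->
  ell = pair_ell k /\
  exists a b c, pair_form beta (Slot q) (Slot r) a b c /\ a * c != b ^+ 2.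
Proof.
move=> dp2 qr beta_h beta0 hl nd md.
have hp : decomposes Gamma p (fun=> (1, 0)) by exact: product_decomposes.
have [kappa [a0 [b0 [c0 hk]]]] := kappa_form_exists hp beta_h beta0 qr md.
have [a [b [c [hB acb]]]] := product_pair_form hprod dp2 qr beta_h nd hk.
split; last by exists a, b, c.
exact: is_ell_uniq hl (pair_is_ell d_gt0 hprod dp2 qr hB acb).
Qed.

Lemma product_numerators_eq (q r : 'I_(d p)) beta I A a b c N N' :
  d p = 2%N -> q != r -> beta \in hspace Gamma -> extremal_solution Gamma beta I A ->
  pair_form beta (Slot q) (Slot r) a b c -> a * c != b ^+ 2 -> (3 <= msize d)%N ->
  slot_numerator (fun=> (1, 0)) I A q N -> slot_numerator (fun=> (1, 0)) I A r N' ->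
  N = N'.
Proof.
move=> dp2 qr beta_h hA hB acb m3 hN hN'; apply/eqP; rewrite -subr_eq0; apply/eqP.
by apply: (antisym_zero m3 acb) => t u; exact: (product_antisym hprod dp2 qr hB hA hN hN' t u).
Qed.

Lemma product_solution_eq (q r : 'I_(d p)) beta I A a b c (N : 'I_(d p) -> {poly R}) :
  d p = 2%N -> q != r -> beta \in hspace Gamma -> extremal_solution Gamma beta I A ->
  pair_form beta (Slot q) (Slot r) a b c -> a * c != b ^+ 2 -> (3 <= msize d)%N ->
  (forall s, slot_numerator (fun=> (1, 0)) I A s (N s)) ->
  forall (s : 'I_(d p)) t, I (Slot s) t -> A (Slot s) t = (N q).[t].
Proof.
move=> dp2 qr beta_h hA hB acb m3 hN s t It.
have Nqr := product_numerators_eq dp2 qr beta_h hA hB acb m3 (hN q) (hN r).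
have -> : N q = N s by have [->|->] := pair_or s dp2 qr.
by rewrite -hN // product_denominator mulr1.
Qed.

Lemma two_slots : d p = 2%N -> exists q r : 'I_(d p), q != r.
Proof.
move=> dp2; have h0 : (0 < d p)%N by rewrite dp2.
have h1 : (1 < d p)%N by rewrite dp2.
by exists (Ordinal h0), (Ordinal h1).
Qed.

(** For k = 1 both ell and m equal 2, so ell < m forces k >= 2; then ell = 3 and the condition reads
    m >= 4. *)
Lemma product_occurs4 : d p = 2%N ->
  occurs Gamma (fun b (s s' : 'I_(d p)) l => case4 b s s' l) <->
  (4 <= msize d)%N /\ (2 <= k)%N.
Proof.
move=> dp2; split=> [[beta [q [r [ell [beta_h beta0 qr hl [_ lm si md]]]]]]|[m4 k2]].
  have [ellE _] := product_pair_structure dp2 qr beta_h beta0 hl (squares_indep_not_dep si) md.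
  case: pair_ell_cases => -[k1 E]; move: lm; rewrite ellE E => lm //.
  by move: lm; rewrite msize1 // dp2.
have [q [r qr]] := two_slots dp2; exists (pair_witness Gamma p), q, r, (pair_ell k).
split=> //; first exact: pair_witness_hspace.
- exact: (pair_witness_neq0 hprod dp2 qr).
- exact: (pair_witness_is_ell hprod dp2 qr d_gt0).
split=> //; last exact: pair_witness_merged_dep.
  by case: pair_ell_cases => -[k1 ->] //; exact: ltn_trans m4.
exact: (pair_witness_squares_indep hprod dp2 qr).
Qed.

Lemma pair_witness_case5 (q r : 'I_(d p)) : d p = 2%N -> q != r ->
  pair_ell k = msize d -> occurs Gamma (fun b (s s' : 'I_(d p)) l => case5 b s s' l).
Proof.
move=> dp2 qr E; exists (pair_witness Gamma p), q, r, (pair_ell k).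
split=> //; first exact: pair_witness_hspace.
- exact: (pair_witness_neq0 hprod dp2 qr).
- exact: (pair_witness_is_ell hprod dp2 qr d_gt0).
split=> //; last exact: pair_witness_merged_dep.
exact: (squares_indep_not_dep (pair_witness_squares_indep hprod dp2 qr)).
Qed.

Lemma msize_sumn : msize d = sumn (codom d).
Proof. by rewrite sumnE /codom /image_mem big_map big_enum. Qed.

(** The parts other than d_p = 2 are positive with sum 1, so there is exactly one. *)
Lemma perm_codom_3 : d p = 2%N -> msize d = 3%N -> perm_eq (codom d) [:: 1%N; 2%N].
Proof.
move=> dp2; rewrite msize_sumn => s3.
have p2 : 2%N \in codom d by rewrite -dp2 codom_f.
have pr := perm_to_rem p2; have pos : all (fun n => 0 < n)%N (rem 2%N (codom d)).
  by apply/allP => n /mem_rem /codomP[j ->].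
move: s3; rewrite (perm_sumn pr) /= => s1.
have {}s1 : sumn (rem 2%N (codom d)) = 1%N by lia.
apply: (perm_trans pr); rewrite perm_sym (perm_catC [:: 1%N] [:: 2%N]) perm_cons.
case: (rem _ _) pos s1 => [|n [|n' s]] //=; first by rewrite andbT addn0 => _ ->.
by case/and3P => n0 n0' _ E; exfalso; lia.
Qed.

Lemma product_occurs5 : (2 <= k)%N -> d p = 2%N ->
  occurs Gamma (fun b (s s' : 'I_(d p)) l => case5 b s s' l) <->
  msize d = 3%N /\ perm_eq (codom d) [:: 1%N; 2%N].
Proof.
move=> k2 dp2.
have E3 : pair_ell k = 3%N by case: pair_ell_cases => -[k1] //; move: k2; rewrite k1.
split=> [[beta [q [r [ell [beta_h beta0 qr hl [_ lm nd md]]]]]]|[m3 _]].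
  have [ellE _] := product_pair_structure dp2 qr beta_h beta0 hl nd md.
  have m3 : msize d = 3%N by rewrite -lm ellE.
  by split=> //; exact: perm_codom_3.
have [q [r qr]] := two_slots dp2.
by apply: (pair_witness_case5 dp2 qr); rewrite E3.
Qed.

Lemma veronese_occurs5 : k = 1%N ->
  occurs Gamma (fun b (s s' : 'I_(d p)) l => case5 b s s' l) <-> msize d = 2%N.
Proof.
move=> k1; rewrite msize1 //.
split=> [[beta [q [r [ell [_ _ _ _ [dp2 _ _ _]]]]]] //|dp2].
have [q [r qr]] := two_slots dp2.
by apply: (pair_witness_case5 dp2 qr); rewrite msize1 // dp2 /pair_ell k1.
Qed.

End ProductCases.

Theorem theorem3p3p8 (R : realType) (k : nat) (d : 'I_k -> nat)
    (d_gt0 : forall j, (0 < d j)%N) (m : nat) (m_def : m = msize d)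
    (m_ge2 : (2 <= m)%N)
    (Gamma : gammas R d) (hSV : segre_veronese Gamma)
    (p : 'I_k) (e : 'I_k -> R * R)
    (hp : decomposes Gamma p e \/ veronese Gamma)
    (beta : Vdual R d) (beta_h : beta \in hspace Gamma) (beta_neq0 : beta != 0)
    (I : slot d -> set R) (A : slot d -> R -> R)
    (hA : extremal_solution Gamma beta I A)
    (q : 'I_(d p)) (ell L : nat)
    (hell : is_ell Gamma beta (Slot q) ell) (hL : is_L Gamma beta e (Slot q) L) :
  (* (1) *)
  ((lin_dep_poly (Slot q)
      [tuple bracket beta; partial (Slot q) (bracket beta)] <->
    exists (a b : R) (beta' : tensor R (slots d (without p xpredT))),
      beta = ins (P := xpredT) (j := p) (erefl true) (tpower _ (a, b)) beta') /\
   (forall (a b : R) (beta' : tensor R (slots d (without p xpredT))),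
      beta = ins (P := xpredT) (j := p) (erefl true) (tpower _ (a, b)) beta' ->
      (b != 0 ->
       exists2 Upsilon : {poly R}, (size Upsilon <= L.+1)%N &
         forall s : 'I_(d p), exists2 G : R -> R,
           second_antiderivative (I (Slot s))
             (fun t => Upsilon.[t]
                * \prod_(j < k | O_set p e j) line (e j) t ^+ (d j - 1)
                / (a + b * t) ^+ (m + 3)%N) G &
           forall t, I (Slot s) t ->
             A (Slot s) t =
               (a + b * t) ^+ (m + 1)%N
               / \prod_(j < k | O_set p e j) line (e j) t ^+ d j * G t) /\
      (b = 0 ->
       exists2 Upsilon : {poly R}, (size Upsilon <= L.+1)%N &
         forall s : 'I_(d p), exists2 G : R -> R,
           second_antiderivative (I (Slot s))
             (fun t => Upsilon.[t]
                * \prod_(j < k | O_set p e j) line (e j) t ^+ (d j - 1)) G &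
           forall t, I (Slot s) t ->
             A (Slot s) t =
               1 / \prod_(j < k | O_set p e j) line (e j) t ^+ d j * G t)))
  /\
  (* (2) *)
  (forall r : 'I_(d p), q != r -> (2 <= d p)%N -> (ell < m)%N ->
     squares_indep beta (Slot q) ->
     merged_squares_indep beta (Slot q) (Slot r) ->
     exists N : {poly R}, quotient_form e I A (fun _ : 'I_(d p) => N) ell)
  /\
  (* (3) *)
  (forall r : 'I_(d p), q != r -> (2 <= d p)%N -> ell = m ->
     merged_squares_indep beta (Slot q) (Slot r) ->
     exists N : {poly R}, quotient_form e I A (fun _ : 'I_(d p) => N) (m + 2)%N)
  /\
  (* (4) *)
  ((forall r : 'I_(d p), q != r -> case4 beta q r ell ->
      exists2 N : 'I_(d p) -> {poly R}, quotient_form e I A N ell &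
        exists (kappa : (slot d -> R) -> R) (a b c : R),
          kappa_form beta (Slot q) (Slot r) kappa a b c /\
          dagger d p e a b c
            (fun x => ((N q).[x] - (N r).[x]) / denominator d p e x)) /\
   (product_segre_veronese Gamma ->
      (d p = 2%N ->
       (occurs Gamma (fun b (s s' : 'I_(d p)) l => case4 b s s' l) <->
        (4 <= m)%N /\ (2 <= k)%N)) /\
      (forall r : 'I_(d p), q != r -> case4 beta q r ell ->
         ell = 3%N /\
         exists2 N : {poly R}, (size N <= ell.+1)%N &
           forall (s : 'I_(d p)) t, I (Slot s) t -> A (Slot s) t = N.[t])))
  /\
  (* (5) *)
  ((forall r : 'I_(d p), q != r -> case5 beta q r ell ->
      exists2 N : 'I_(d p) -> {poly R}, quotient_form e I A N (m + 2)%N &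
        exists (kappa : (slot d -> R) -> R) (a b c : R),
          kappa_form beta (Slot q) (Slot r) kappa a b c /\
          dagger d p e a b c
            (fun x => ((N q).[x] - (N r).[x]) / denominator d p e x)) /\
   (veronese Gamma ->
      (occurs Gamma (fun b (s s' : 'I_(d p)) l => case5 b s s' l) <-> m = 2%N) /\
      (forall r : 'I_(d p), q != r -> case5 beta q r ell ->
       forall (kappa : (slot d -> R) -> R) (a b c : R),
         kappa_form beta (Slot q) (Slot r) kappa a b c ->
         c != 0 -> (forall x : R, quadratic a b c x != 0) ->
         exists (N : {poly R}) (nu0 nu1 : 'I_(d p) -> R),
           (size N <= 5)%N /\
           forall (s : 'I_(d p)) t, I (Slot s) t ->
             A (Slot s) t =
               N.[t]
               + nu0 s * (b + c * t) * (a * c - b ^+ 2 + (b + c * t) ^+ 2)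
               + nu1 s * ((a * c - b ^+ 2) ^+ 2 - (b + c * t) ^+ 4))) /\
   (product_segre_veronese Gamma -> (2 <= k)%N ->
      (d p = 2%N ->
       (occurs Gamma (fun b (s s' : 'I_(d p)) l => case5 b s s' l) <->
        m = 3%N /\ perm_eq (codom d) [:: 1%N; 2%N])) /\
      (forall r : 'I_(d p), q != r -> case5 beta q r ell ->
         m = 3%N /\
         exists2 N : {poly R}, (size N <= (m + 2).+1)%N &
           forall (s : 'I_(d p)) t, I (Slot s) t -> A (Slot s) t = N.[t])))
  /\
  (* (6) *)
  (d p = 1%N -> (ell < m)%N -> squares_indep beta (Slot q) ->
     exists N : {poly R}, quotient_form e I A (fun _ : 'I_(d p) => N) ell)
  /\
  (* (7) *)
  (d p = 1%N -> ell = m ->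
     exists N : {poly R}, quotient_form e I A (fun _ : 'I_(d p) => N) (m + 2)%N).
Proof.
subst m.
have hp' : decomposes Gamma p e by case: hp => [//|hv]; exact: veronese_decomposes.
(* Shared by the cases (4) and (5): dependence on the diagonal gives (dagger) whatever the degree
   bound. *)
have general5 (r : 'I_(d p)) (N : 'I_(d p) -> {poly R}) : q != r ->
    merged_dep beta (Slot q) (Slot r) -> (forall s, slot_numerator e I A s (N s)) ->
    exists (kappa : (slot d -> R) -> R) (a b c : R),
      kappa_form beta (Slot q) (Slot r) kappa a b c /\
      dagger d p e a b c (fun x => ((N q).[x] - (N r).[x]) / denominator d p e x).
  move=> qr md hN.
  have [kappa [a [b [c hk]]]] := kappa_form_exists hp' beta_h beta_neq0 qr md.
  exists kappa, a, b, c; split=> //.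
  have := dagger_of_op d_gt0 (p := p) (e := e) (numerators_kappa d_gt0 hp' beta_h hA qr (hN q) (hN r) hk).
  rewrite (_ : (fun x => _) = (fun x => ((N q).[x] - (N r).[x]) / denominator d p e x)) //.
  by apply/funext => x; rewrite hornerD hornerN.
split; [|split; [|split; [|split; [|split; [|split]]]]].
- split; first exact: (lin_dep_polyP hp' beta_h beta_neq0 q).
  move=> a b beta' betaE.
  have [Y Ys YP] := pure_solution d_gt0 hp' beta_h hA betaE hL.
  split=> [_|b0].
    exists Y => // s; have [G GF GA] := YP 1 s.
    exists G => t It; last by rewrite -GA // mul1r.
    by have := GF t It; rewrite mul1r.
  have a0 : a != 0 by have := pure_neq0 beta_neq0 q betaE; rewrite b0 eqxx orbF.
  exists ((a ^- 2) *: Y); first exact: leq_trans (size_scale_leq _ _) Ys.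
  (* With b = 0 the scaling a^(m+1) cancels the power in front of [G] and leaves a^(m+1) / a^(m+3) =
     1 / a^2 in the integrand. *)
  move=> s; have [G GF GA] := YP (a ^+ (msize d + 1)) s; exists G => t It.
    have [G1 G2 ->] := GF t It; split=> //; rewrite b0 mul0r addr0 hornerZ.
    have -> : (msize d + 3 = (msize d + 1).+2)%N by rewrite !addnS.
    by rewrite !exprS; field; rewrite a0 expf_neq0.
  have := GA t It; rewrite b0 mul0r addr0 -mulrA => /(mulfI (expf_neq0 _ a0)) ->.
  by rewrite mul1r.
- move=> r qr dp2 lm si mi.
  have [N Ns NE] := slot_numerators_ell hp' beta_h hA hell lm si.
  have Neq := slot_numerators_eq d_gt0 hp' beta_h hA qr mi NE.
  exists (N q); apply: (slot_numerator_form hp' hA) => s //.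
  by have := NE s; rewrite Neq.
- move=> r qr dp2 lm mi.
  have [|N Ns NE] := slot_numerators hp' beta_h hA hell; first by rewrite lm.
  have Neq := slot_numerators_eq d_gt0 hp' beta_h hA qr mi NE.
  exists (N q); apply: (slot_numerator_form hp' hA) => s; first by rewrite addn2.
  by have := NE s; rewrite Neq.
- split=> [r qr [dp2 lm si md]|hprod].
    have [N Ns NE] := slot_numerators_ell hp' beta_h hA hell lm si.
    exists N; first exact: (slot_numerator_form hp' hA).
    exact: general5.
  split=> [dp2|r qr [dp2 lm si md]]; first exact: product_occurs4.
  have [ellE [a [b [c [hB acb]]]]] := product_pair_structure d_gt0 hprod dp2 qr beta_h
     beta_neq0 hell (squares_indep_not_dep si) md.
  (* The given [e] need not be normalised; with (1, 0) the denominator is 1 and A_q is its own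
     numerator. *)
  have hp1 : decomposes Gamma p (fun=> (1, 0)) by exact: product_decomposes.
  have [N Ns NE] := slot_numerators_ell hp1 beta_h hA hell lm si.
  have ell3 : ell = 3%N.
    rewrite ellE; case: (pair_ell_cases p) => -[k1 E] //.
    by move: lm; rewrite ellE E (msize1 d p) // dp2.
  split=> //; exists (N q) => // s t It.
  apply: (product_solution_eq hprod dp2 qr beta_h hA hB acb _ NE It).
  by rewrite -ell3 ltnW.
- split=> [r qr [dp2 lm nd md]|].
    have [|N Ns NE] := slot_numerators hp' beta_h hA hell; first by rewrite lm.
    exists N; first by apply: (slot_numerator_form hp' hA) => // s; rewrite addn2.
    exact: general5.
  split=> [hv|hprod k2].
    have hprod := veronese_product hv; have [k1 _] := hv.
    split=> [|r qr [dp2 lm nd md] kappa a b c hk c0 _]; first exact: veronese_occurs5.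
    have hp1 : decomposes Gamma p (fun=> (1, 0)) by exact: product_decomposes.
    have [|N Ns NE] := slot_numerators hp1 beta_h hA hell; first by rewrite lm.
    have m2 : msize d = 2%N by rewrite (msize1 d p k1).
    have D := numerators_kappa d_gt0 hp1 beta_h hA qr (NE q) (NE r) hk.
    rewrite m2 in D Ns.
    have [|nu0 [nu1 E]] := veronese_diag _ c0 D.
      by rewrite (leq_trans (size_polyD _ _)) // geq_max size_polyN !Ns.
    (* N_p is the numerator at q, so the other slot carries the whole difference; the sign comes
       from E = N_q - N_r. *)
    exists (N q), (fun s => if s == q then 0 else - nu0), (fun s => if s == q then 0 else - nu1).
    split=> // s t It.
    have -> : A (Slot s) t = (N s).[t] by rewrite -NE // product_denominator mulr1.
    have [->|sq] := eqVneq s q; first by rewrite !mul0r !addr0.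
    have [E'|->] := pair_or s dp2 qr; first by rewrite E' eqxx in sq.
    have := E t; rewrite hornerD hornerN => Et.
    have -> : (N r).[t] = (N q).[t] - ((N q).[t] - (N r).[t]) by ring.
    by rewrite Et; ring.
  split=> [dp2|r qr [dp2 lm nd md]]; first exact: product_occurs5.
  have [ellE [a [b [c [hB acb]]]]] := product_pair_structure d_gt0 hprod dp2 qr beta_h
     beta_neq0 hell nd md.
  have hp1 : decomposes Gamma p (fun=> (1, 0)) by exact: product_decomposes.
  have [|N Ns NE] := slot_numerators hp1 beta_h hA hell; first by rewrite lm.
  have m3 : msize d = 3%N.
    rewrite -lm ellE; case: (pair_ell_cases p) => -[k1 E] //.
    by move: k2; rewrite k1.
  split=> //; exists (N q); first by rewrite addn2.
  by apply: (product_solution_eq hprod dp2 qr beta_h hA hB acb _ NE); rewrite m3.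
- move=> dp1 lm si.
  have [N Ns NE] := slot_numerators_ell hp' beta_h hA hell lm si.
  have sE s : s = q by exact: ord_eq1.
  by exists (N q); apply: (slot_numerator_form hp' hA) => s; rewrite ?(sE s) ?addn2 //.
move=> dp1 lm.
have [|N Ns NE] := slot_numerators hp' beta_h hA hell; first by rewrite lm.
have sE s : s = q by exact: ord_eq1.
by exists (N q); apply: (slot_numerator_form hp' hA) => s; rewrite ?(sE s) ?addn2 //.
Qed.
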